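(* Let $G$ be a finite solvable group and let $X$ be a 2-dimensional metrizable space. Then $X \tau K(G,1)$ if and only if $X \tau K(G_{ab},1)$.
   Context: For topological spaces $X$ and $M$, the notation $X \tau M$ (Kuratowski) means that every continuous map from a closed subset of $X$ to $M$ extends to a continuous map $X \to M$. $K(G,1)$ denotes an Eilenberg–MacLane CW complex of type $(G,1)$, and $G_{ab} = G/[G,G]$ is the abelianization of $G$. *)

(* Defs.v *)
From HB Require Import structures.
From mathcomp Require Import all_boot all_order all_algebra.
From mathcomp Require Import fingroup quotient nilpotent.
From mathcomp Require Import all_classical all_reals topology normedtype.

Set Implicit Arguments.
Unset Strict Implicit.
Unset Printing Implicit Defensive.

Import Order.TTheory GRing.Theory Num.Theory.
Import numFieldNormedType.Exports.

Local Open Scope classical_set_scope.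
Local Open Scope ring_scope.
Local Open Scope card_scope.

(* [A] is used as a type, with the subspace topology. *)
Definition kuratowski_tau (X M : topologicalType) : Prop :=
  forall A : set X, closed A ->
  forall f : A -> M, continuous f ->
  exists2 g : X -> M, continuous g & forall a : A, g (set_val a) = f a.

Definition metrizable (R : realType) (X : topologicalType) : Prop :=
  exists (M : metricType R) (f : X -> M) (g : M -> X),
    [/\ cancel f g, cancel g f, continuous f & continuous g].

Definition open_cover (X : topologicalType) (U : set (set X)) : Prop :=
  U `<=` open /\ \bigcup_(A in U) A = setT.

Definition covering_dim_le (X : topologicalType) (n : nat) : Prop :=
  forall U : set (set X), open_cover U ->
  exists V : set (set X),
    [/\ open_cover V,
        forall B, V B -> exists2 A, U A & B `<=` A &
        forall x, [set B | V B /\ B x] #<= `I_n.+1].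

(* The cases [0] and [n.+1] are separated because of the empty space, whose
   dimension is -1. *)
Definition covering_dim_eq (X : topologicalType) (n : nat) : Prop :=
  covering_dim_le X n /\
  (if n is m.+1 then ~ covering_dim_le X m else [set: X] !=set0).

(* The cube [0, 1]^n is the model of the closed n-disc. *)
Section Cube.
Variables (R : realType) (n : nat).

Definition cube : set 'rV[R]_n := [set v | forall i, 0 <= v ord0 i <= 1].
Definition open_cube : set 'rV[R]_n := [set v | forall i, 0 < v ord0 i < 1].
Definition cube_boundary : set 'rV[R]_n := cube `\` open_cube.

End Cube.
Arguments cube {R n}.
Arguments open_cube {R n}.
Arguments cube_boundary {R n}.

(* Only the values of [cw_map e] on the cube are relevant. *)
Record cw_structure (R : realType) (K : topologicalType) := CWStructure {
  cw_cell : Type;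
  cw_dim : cw_cell -> nat;
  cw_map : forall e : cw_cell, 'rV[R]_(cw_dim e) -> K;
  cw_map_continuous : forall e, {within cube, continuous (@cw_map e)};
  cw_map_homeo : forall e, exists2 h : K -> 'rV[R]_(cw_dim e),
    {within @cw_map e @` open_cube, continuous h} &
    forall v, open_cube v -> h (@cw_map e v) = v;
  cw_disjoint : trivIset setT (fun e => @cw_map e @` open_cube);
  cw_cover : \bigcup_e (@cw_map e @` open_cube) = setT;
  cw_closure_finite : forall e, exists F : set cw_cell,
    [/\ finite_set F,
        forall e', F e' -> (cw_dim e' < cw_dim e)%N &
        @cw_map e @` cube_boundary `<=`
          \bigcup_(e' in F) (@cw_map e' @` open_cube)];
  cw_weak_topology : forall A : set K,
    (forall e, closed (A `&` @cw_map e @` cube)) -> closed A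
}.

Definition cw_complex (R : realType) (K : topologicalType) : Prop :=
  hausdorff_space K /\ inhabited (cw_structure R K).

Definition path_connected (R : realType) (K : topologicalType) : Prop :=
  [set: K] !=set0 /\
  forall x y : K, exists p : R -> K,
    [/\ {within `[0, 1], continuous p}, p 0 = x & p 1 = y].

(* Homotopy groups. A spheroid is represented by a function on the whole of
   R^n of which only the values on the cube matter, since they alone enter
   [homotopic]. *)
Section HomotopyGroup.
Variables (R : realType) (K : topologicalType) (x0 : K).

Definition spheroid n : set ('rV[R]_n -> K) :=
  [set f | {within cube, continuous f} /\
           forall v, cube_boundary v -> f v = x0].

Definition homotopic n (f g : 'rV[R]_n -> K) : Prop :=
  exists H : R * 'rV[R]_n -> K,
    [/\ {within `[0, 1] `*` cube, continuous H},
        forall v, cube v -> H (0, v) = f v /\ H (1, v) = g v &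
        forall (t : R) v, 0 <= t <= 1 -> cube_boundary v -> H (t, v) = x0].

Definition homotopy_class n (f : 'rV[R]_n -> K) : set ('rV[R]_n -> K) :=
  [set g | spheroid g /\ homotopic f g].

Definition homotopy_group n : set (set ('rV[R]_n -> K)) :=
  [set homotopy_class f | f in @spheroid n].

Definition concat n (f g : 'rV[R]_n.+1 -> K) (v : 'rV[R]_n.+1) : K :=
  let rescale c := \row_j (if j == ord0 then 2 * v ord0 j - c else v ord0 j) in
  if v ord0 ord0 <= 2^-1 then f (rescale 0) else g (rescale 1).

Definition homotopy_mul n (a b : set ('rV[R]_n.+1 -> K)) :
    set ('rV[R]_n.+1 -> K) :=
  [set h | spheroid h /\
           exists f g, [/\ a f, b g & homotopic h (concat f g)]].

End HomotopyGroup.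
Arguments homotopy_group R {K} x0 n.

Definition fundamental_group_isog (R : realType) (K : topologicalType)
    (x0 : K) (G : groupType) : Prop :=
  exists phi : set ('rV[R]_1 -> K) -> G,
    set_bij (homotopy_group R x0 1) setT phi /\
    forall a b, homotopy_group R x0 1 a -> homotopy_group R x0 1 b ->
      phi (homotopy_mul x0 a b) = (phi a * phi b)%g.

Definition homotopy_group_trivial (R : realType) (K : topologicalType)
    (x0 : K) (n : nat) : Prop :=
  homotopy_group R x0 n = [set homotopy_class x0 (cst x0)].

(* [K] is a K(G,1). *)
Definition eilenberg_maclane1 (R : realType) (G : groupType)
    (K : topologicalType) : Prop :=
  [/\ cw_complex R K, path_connected R K &
      exists x0 : K, fundamental_group_isog R x0 G /\
        forall n, (1 < n)%N -> homotopy_group_trivial R x0 n].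

Definition abelianization (gT : finGroupType) (G : {group gT}) :=
  (G / [~: G, G])%G.

(* Main.v *)
(* Let d be a distance on X, of dimension at most 2, and K a CW complex of type
   (G, 1); only its fundamental group matters. X tau K turns out to depend on G
   only through the principal bundles over subsets of X, encoded here by
   Alexander-Spanier 1-cocycles. An element g of G is called fillable if, for
   every map of a closed subset of X to the boundary of a triangle, the bundle
   pulled back from the one with monodromy g extends to a bundle over X with
   group G.

   If X tau K, then every g is fillable: extend over X the composite with a loop
   representing g. Conversely, if every g is fillable, a map from a closed set A
   to K is extended in two steps: extend the bundle induced from the universal
   covering of K over X (over the nerve of a cover of dimension 2 the only
   obstructions are the monodromies of the triangles), then map X to K through
   the nerve, following this bundle. Since X itself has no segments, maps are first
   extended from the Dirac measures to nearby measures of finite support on X.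

   So X tau K says that all elements of G are fillable. This passes to quotients
   and to extensions, and fillable elements form a subgroup. If the abelianization
   is fillable, then so are the cyclic groups of prime order p dividing its order,
   hence all p-elements of G for these p; in a solvable group they generate G. *)
Require Import Defs.
From HB Require Import structures.
From mathcomp Require Import all_boot all_order all_algebra.
From mathcomp Require Import fingroup morphism quotient cyclic pgroup sylow.
From mathcomp Require Import nilpotent abelian maximal commutator.
From mathcomp Require Import all_classical all_reals topology normedtype.
From mathcomp Require Import numfun.
From mathcomp Require Import ring lra.

Set Implicit Arguments.
Unset Strict Implicit.
Unset Printing Implicit Defensive.

Import Order.TTheory GRing.Theory Num.Theory.
Import numFieldNormedType.Exports.

Local Open Scope classical_set_scope.
Local Open Scope ring_scope.

(** * Pointwise continuity and pseudo-distances *)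

(** No nerve is realised as a space: every construction takes place on [X], through the weights of a
    partition of unity. A triangle of the nerve becomes the closed set where its three weights are
    at least 1/4. At most three weights are nonzero at a point, so these sets are disjoint for
    different triangles and each obstruction is removed independently of the others. Among at most
    three weights of sum 1 one is at least 1/3, which labels each point by a vertex; hence the
    thresholds 1/4 < 3/10 < 1/3.

    A CW complex need not be metrizable, and the maps to be extended start from a space of measures.
    The extension to neighbourhoods is therefore proved for every pseudo-metric source, one skeleton
    at a time; the skeleta can be assembled because a continuous map from such a source meets
    locally only finitely many cells.

    Fillability speaks of three closed sets without common point, not of [K] or of holonomy: this
    allows the groups [G], its subgroups and its quotients to be compared over the same [X]. *)

Definition cts_in (X K : topologicalType) (A : set X) (f : X -> K) (x : X) :=
  forall V, nbhs (f x) V -> \forall y \near x, A y -> V (f y).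

Definition cts_at (X K : topologicalType) (f : X -> K) (x : X) :=
  forall V, nbhs (f x) V -> \forall y \near x, V (f y).

Lemma cts_inP (X K : topologicalType) (A : set X) (f : X -> K) :
  {within A, continuous f} <-> forall x, A x -> cts_in A f x.
Proof. by rewrite subspace_continuousP; split=> h x /h. Qed.

Lemma cts_in_sub (X K : topologicalType) (A B : set X) (f : X -> K) x :
  A `<=` B -> cts_in B f x -> cts_in A f x.
Proof. by move=> AB fB V /fB; apply: filterS => y h /AB/h. Qed.

Lemma cts_at_in (X K : topologicalType) (A : set X) (f : X -> K) x :
  cts_at f x -> cts_in A f x.
Proof. by move=> fB V /fB; apply: filterS. Qed.

Lemma cts_in_at (X K : topologicalType) (A : set X) (f : X -> K) x :
  nbhs x A -> cts_in A f x -> cts_at f x.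
Proof. by move=> xA fA V /fA; apply: filterS2 xA => y Ay /(_ Ay). Qed.

Lemma cts_in_eq (X K : topologicalType) (A : set X) (f g : X -> K) x :
  f x = g x -> (\forall y \near x, A y -> f y = g y) -> cts_in A g x ->
  cts_in A f x.
Proof.
move=> fg nfg gA V; rewrite fg => /gA; apply: filterS2 nfg => y h1 h2 Ay.
by rewrite h1//; apply: h2.
Qed.

Lemma cts_inU (X K : topologicalType) (A B : set X) (f : X -> K) x :
  cts_in A f x -> cts_in B f x -> cts_in (A `|` B) f x.
Proof.
by move=> fA fB V fV; apply: filterS2 (fA _ fV) (fB _ fV) => y hA hB [/hA|/hB].
Qed.

Lemma cts_at_eq (X K : topologicalType) (f g : X -> K) x :
  (\forall y \near x, f y = g y) -> cts_at g x -> cts_at f x.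
Proof.
move=> nfg gA V; rewrite (nbhs_singleton nfg) => /gA; apply: filterS2 nfg => y.
by move=> ->.
Qed.

Lemma cts_in_comp (X Y K : topologicalType) (A : set X) (B : set Y) (f : X -> Y)
    (g : Y -> K) x : (forall x, A x -> B (f x)) ->
  cts_in A f x -> cts_in B g (f x) -> cts_in A (g \o f) x.
Proof.
move=> AB fA gB V /gB /fA; apply: filterS => y h Ay.
by apply: h => //; apply: AB.
Qed.

Lemma cts_at_comp (X Y K : topologicalType) (f : X -> Y) (g : Y -> K) x :
  cts_at f x -> cts_at g (f x) -> cts_at (g \o f) x.
Proof. by move=> fA gB V /gB /fA. Qed.

Section Dist.
Variable R : realType.

(** Points at distance 0 are not identified: the space of measures used below is only
    pseudo-metric. *)
Definition dist_for (X : topologicalType) (d : X -> X -> R) :=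
  [/\ forall x, d x x = 0, forall x y, d x y = d y x,
      forall x y z, d x z <= d x y + d y z &
      forall x V, nbhs x V <-> exists2 e, 0 < e & forall y, d x y < e -> V y].

Variables (X : topologicalType) (d : X -> X -> R).
Hypothesis dX : dist_for d.

Lemma dist_refl x : d x x = 0. Proof. by case: dX. Qed.
Lemma dist_sym x y : d x y = d y x. Proof. by case: dX. Qed.
Lemma dist_tri x y z : d x z <= d x y + d y z. Proof. by case: dX. Qed.
Lemma dist_nbhs x V :
  nbhs x V <-> exists2 e, 0 < e & forall y, d x y < e -> V y.
Proof. by case: dX. Qed.

Lemma dist_ge0 x y : 0 <= d x y.
Proof. by have := dist_tri x y x; rewrite dist_refl (dist_sym y x); lra. Qed.

Lemma near_dist x e : 0 < e -> \forall y \near x, d x y < e.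
Proof. by move=> e0; apply/dist_nbhs; exists e. Qed.

(** Adding 1 makes the infimum exist for empty [A] and bounds it by 1, so that [distset A] can later
    serve as a test function with values in [0, 1]. *)
Definition distset (A : set X) (x : X) : R :=
  inf ([set d x a | a in A] `|` [set 1]).

Let has_inf_ds A x : has_inf ([set d x a | a in A] `|` [set 1]).
Proof.
split; first by exists 1; right.
by exists 0 => _ [[a _ <-]|->]; [exact: dist_ge0|exact: ler01].
Qed.

Lemma distset_ge0 A x : 0 <= distset A x.
Proof.
apply: lb_le_inf; first by exists 1; right.
by move=> _ [[a _ <-]|->]; [exact: dist_ge0|exact: ler01].
Qed.

Lemma distset_le1 A x : distset A x <= 1.
Proof. by apply: ge_inf; [case: (has_inf_ds A x)|right]. Qed.

Lemma distset_le A x a : A a -> distset A x <= d x a.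
Proof. by move=> Aa; apply: ge_inf; [case: (has_inf_ds A x)|left; exists a]. Qed.

Lemma distset_lt A x e : distset A x < e -> e <= 1 -> exists2 a, A a & d x a < e.
Proof.
move=> h e1; have [_ [[a Aa <-]|->] lt] := inf_lt (has_inf_ds A x).1 h.
  by exists a.
by move: lt; rewrite ltNge e1.
Qed.

Lemma distset0 A x : A x -> distset A x = 0.
Proof.
move=> Ax; apply/eqP; rewrite eq_le distset_ge0 andbT.
by rewrite -[leRHS](dist_refl x) distset_le.
Qed.

Lemma distset_lip A x y : `|distset A x - distset A y| <= d x y.
Proof.
wlog h : x y / distset A y <= distset A x.
  move=> wl; have [/wl //|/ltW/wl] := leP (distset A y) (distset A x).
  by rewrite distrC dist_sym.
rewrite ger0_norm ?subr_ge0// lerBlDr -lerBlDl.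
apply: lb_le_inf; first by exists 1; right.
move=> _ [[a Aa <-]|->].
  by have := distset_le x Aa; have := dist_tri x y a; lra.
by have := distset_le1 A x; have := dist_ge0 x y; lra.
Qed.

Lemma distset_gt0 A x : closed A -> ~ A x -> 0 < distset A x.
Proof.
move=> cA Ax; rewrite lt_neqAle distset_ge0 andbT eq_sym; apply/eqP => h.
have := closed_openC cA; rewrite openE => /(_ _ Ax) /dist_nbhs [e e0 he].
have m0 : 0 < Num.min e 1 by rewrite lt_min e0 ltr01.
have [||a Aa da] := @distset_lt A x (Num.min e 1); first by rewrite h.
  by rewrite ge_min lexx orbT.
by apply: (he a _ Aa); apply: (lt_le_trans da); rewrite ge_min lexx.
Qed.

Lemma lip_continuous (f : X -> R) C :
  (forall x y, `|f x - f y| <= C * d x y) -> continuous f.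
Proof.
move=> lf x; apply/cvgrPdist_lt => e e0.
have C0 : 0 < `|C| + 1 by have := normr_ge0 C; lra.
near=> y; apply: (le_lt_trans (lf _ _)).
apply: (@le_lt_trans _ _ ((`|C| + 1) * d x y)).
  apply: ler_wpM2r; first exact: dist_ge0.
  by have := ler_norm C; lra.
rewrite mulrC -ltr_pdivlMr//; near: y.
by apply: near_dist; rewrite divr_gt0.
Unshelve. all: by end_near. Qed.

Lemma distset_continuous A : continuous (distset A).
Proof. by apply: (@lip_continuous _ 1) => x y; rewrite mul1r distset_lip. Qed.

(* The usual formula; it also separates sets that are only closed in the
   complement of a common boundary. *)
Definition sep (A B : set X) (x : X) : R :=
  distset A x / (distset A x + distset B x).

Lemma sep0 A B x : A x -> sep A B x = 0.
Proof. by move=> Ax; rewrite /sep distset0// mul0r. Qed.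

Lemma sep1 A B x : B x -> 0 < distset A x -> sep A B x = 1.
Proof. by move=> Bx A0; rewrite /sep (distset0 Bx) addr0 divff// gt_eqF. Qed.

Lemma sep_ge0 A B x : 0 <= sep A B x.
Proof. by rewrite divr_ge0 ?addr_ge0 ?distset_ge0. Qed.

Lemma sep_le1 A B x : sep A B x <= 1.
Proof.
rewrite /sep; have := distset_ge0 A x; have := distset_ge0 B x => hB hA.
have [h|h] := eqVneq (distset A x + distset B x) 0; first by rewrite h invr0 mulr0.
by rewrite ler_pdivrMr ?mul1r; lra.
Qed.

Lemma sep_cts A B x : 0 < distset A x + distset B x -> {for x, continuous (sep A B)}.
Proof.
move=> h; apply: cvgM; first exact: distset_continuous.
apply: cvgV; first by rewrite gt_eqF.
by apply: cvgD; exact: distset_continuous.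
Qed.

Lemma sep_continuous A B :
  closed A -> closed B -> A `&` B = set0 -> continuous (sep A B).
Proof.
move=> cA cB AB x; apply: sep_cts.
have hA := distset_ge0 A x; have hB := distset_ge0 B x.
have [Ax|Ax] := pselect (A x); last by have := distset_gt0 cA Ax; lra.
have [Bx|Bx] := pselect (B x); last by have := distset_gt0 cB Bx; lra.
by have : (A `&` B) x by []; rewrite AB.
Qed.

Lemma dist_normal : normal_space X.
Proof.
apply/(@normal_separatorP R) => A B cA cB AB; apply/(@uniform_separatorP _ R).
exists (sep A B); split; first exact: sep_continuous.
- by move=> _ [x _ <-] /=; rewrite in_itv/= sep_ge0 sep_le1.
- by move=> _ [x Ax <-] /=; rewrite sep0.
- move=> _ [x Bx <-] /=; rewrite sep1//; apply: distset_gt0 => // Ax.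
  by have : (A `&` B) x by []; rewrite AB.
Qed.

End Dist.

(** * The cube *)

Lemma near_finite (T I : Type) (F : set_system T) (D : set I)
    (P : I -> T -> Prop) : Filter F -> finite_set D ->
  (forall i, D i -> \forall x \near F, P i x) ->
  \forall x \near F, forall i, D i -> P i x.
Proof.
move=> FF fD h; have [s Ds] := (@finite_seqP {classic I} D).1 fD.
have {}h : forall i : {classic I}, i \in s -> \forall x \near F, P i x.
  by move=> i si; apply: h; rewrite Ds.
suff : \forall x \near F, forall i : {classic I}, i \in s -> P i x.
  by apply: filterS => x hx i; rewrite Ds => /hx.
elim: s {Ds} h => [|i s IH] h; first by apply: nearW.
apply: filterS2 (h i (mem_head _ _)) (IH _) => [x hi hs j|j js].
  by rewrite inE => /predU1P[->|/hs].
by apply: h; rewrite inE js orbT.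
Qed.

Lemma closed_bigcup_fin (T : topologicalType) (I : Type) (D : set I)
    (F : I -> set T) : finite_set D -> (forall i, D i -> closed (F i)) ->
  closed (\bigcup_(i in D) F i).
Proof. exact: (@closed_bigcup T {classic I}). Qed.

Section CubeNorm.
Variables (R : realType) (n : nat).
Implicit Types v w : 'rV[R]_n.

Definition mid : 'rV[R]_n := const_mx 2^-1.
(** The gauge of the cube seen from its centre, for the sup norm; the factor 2 comes from the
    half-side 1/2. *)
Definition cnorm v : R := 2 * `|v - mid|.

Lemma rV_norm_le v (e : R) : 0 <= e -> (forall j, `|v ord0 j| <= e) -> `|v| <= e.
Proof.
move=> e0 h; rewrite /Num.norm/= mx_normrE; apply/bigmax_leP; split=> // -[i j] _.
by rewrite (ord1 i).
Qed.

Lemma rV_norm_lt v (e : R) : 0 < e -> (forall j, `|v ord0 j| < e) -> `|v| < e.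
Proof.
move=> e0 h; rewrite /Num.norm/= mx_normrE; apply/bigmax_ltP; split=> // -[i j] _.
by rewrite (ord1 i).
Qed.

Lemma le_rV_norm v j : `|v ord0 j| <= `|v|.
Proof. by rewrite /Num.norm/= mx_normrE; apply: (le_bigmax _ _ (ord0, j)). Qed.

Lemma cube_cnorm v : cube v <-> cnorm v <= 1.
Proof.
rewrite /cnorm; split=> [h|h j].
  have h' : `|v - mid| <= 2^-1; last lra.
  apply: rV_norm_le => [|j]; first lra.
  by have := h j; rewrite !mxE ler_norml; lra.
have : `|(v - mid) ord0 j| <= 2^-1 by apply: le_trans (le_rV_norm _ _) _; lra.
by rewrite ler_norml !mxE; lra.
Qed.

Lemma open_cube_cnorm v : open_cube v <-> cnorm v < 1.
Proof.
rewrite /cnorm; split=> [h|h j].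
  have h' : `|v - mid| < 2^-1; last lra.
  apply: rV_norm_lt => [|j]; first lra.
  by have := h j; rewrite !mxE ltr_norml; lra.
have : `|(v - mid) ord0 j| < 2^-1 by apply: le_lt_trans (le_rV_norm _ _) _; lra.
by rewrite ltr_norml !mxE; lra.
Qed.

Lemma open_cube_cube v : open_cube v -> cube v.
Proof. by move=> /open_cube_cnorm /ltW /cube_cnorm. Qed.

Lemma cube_boundary_cnorm v : cube_boundary v <-> cnorm v = 1.
Proof.
split=> [[/cube_cnorm h1 h2]|h].
  apply/eqP; rewrite eq_le h1 leNgt; apply/negP => h3.
  by apply: h2; apply/open_cube_cnorm.
split; first by apply/cube_cnorm; rewrite h.
by move/open_cube_cnorm; rewrite h ltxx.
Qed.

Lemma cnorm_ge0 v : 0 <= cnorm v.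
Proof. by rewrite mulr_ge0. Qed.

Lemma cnorm_lip v w : cnorm v <= cnorm w + 2 * `|v - w|.
Proof.
rewrite /cnorm; have := ler_normD (w - mid) (v - w); rewrite addrC.
rewrite (_ : v - w + (w - mid) = v - mid); last by rewrite addrA subrK.
by lra.
Qed.

Lemma cube_compact : compact (@cube R n).
Proof.
rewrite (_ : cube = [set v | forall i, `[0%R, 1%R]%classic (v ord0 i)]).
  by apply: (@rV_compact R n (fun=> `[0%R, 1%R]%classic)) => i; exact: segment_compact.
by apply/seteqP; split=> v h i; have := h i; rewrite /= in_itv.
Qed.

(* Radial expansion; [push_out v 1] lies on the boundary of the cube as soon as
   [1/2 <= cnorm v]. *)
Definition push_coef (v : 'rV[R]_n) (t : R) : R := (1 - t) + t / Num.max (cnorm v) 2^-1.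
Definition push_out v t := mid + push_coef v t *: (v - mid).

Let mx_gt0 v : 0 < Num.max (cnorm v) 2^-1.
Proof. by rewrite lt_max invr_gt0 ltr0n orbT. Qed.

Lemma push_coef_ge0 v t : 0 <= t <= 1 -> 0 <= push_coef v t.
Proof.
move=> /andP[t0 t1]; rewrite /push_coef addr_ge0 ?subr_ge0// divr_ge0//.
exact/ltW/mx_gt0.
Qed.

Lemma push_out0 v : push_out v 0 = v.
Proof. by rewrite /push_out /push_coef subr0 mul0r addr0 scale1r addrC subrK. Qed.

Lemma cnorm_push_out v t : 0 <= t <= 1 -> cnorm (push_out v t) = push_coef v t * cnorm v.
Proof.
move=> t01; rewrite /cnorm /push_out [mid + _]addrC addrK normrZ ger0_norm//.
  by rewrite mulrCA.
exact: push_coef_ge0.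
Qed.

Lemma push_out_cube v t : 0 <= t <= 1 -> cube v -> cube (push_out v t).
Proof.
move=> t01 /cube_cnorm h; apply/cube_cnorm; rewrite cnorm_push_out// /push_coef mulrDl.
rewrite mulrAC -[t * _ / _]mulrA.
have : cnorm v / Num.max (cnorm v) 2^-1 <= 1.
  by rewrite ler_pdivrMr ?mx_gt0// mul1r le_max lexx.
have := cnorm_ge0 v; move: t01 => /andP[t0 t1] r0 h2; nra.
Qed.

Lemma push_out1_boundary v : cube v -> 2^-1 <= cnorm v -> cube_boundary (push_out v 1).
Proof.
move=> _ h; apply/cube_boundary_cnorm; rewrite cnorm_push_out ?ler01 ?lexx//.
rewrite /push_coef subrr add0r mul1r max_l// mulVf//.
by apply/eqP; lra.
Qed.

(** The point moves along its ray by at most the gap to the boundary. Near the boundary the push is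
    thus a small perturbation, wherever it is stopped. *)
Lemma push_out_near v t : 0 <= t <= 1 -> cube v -> 2^-1 <= cnorm v ->
  `|push_out v t - v| <= (1 - cnorm v) / 2.
Proof.
move=> t01 /cube_cnorm h1 h.
have -> : push_out v t - v = (push_coef v t - 1) *: (v - mid).
  by apply/rowP => j; rewrite /push_out !mxE; ring.
rewrite /push_coef max_l// normrZ.
have r0 : 0 < cnorm v by lra.
have -> : 1 - t + t / cnorm v - 1 = t * ((cnorm v)^-1 - 1) by lra.
have i1 : 0 <= (cnorm v)^-1 - 1 by rewrite subr_ge0 invf_ge1.
rewrite ger0_norm; last by apply: mulr_ge0 => //; case/andP: t01.
rewrite (_ : `|v - mid| = cnorm v / 2); last by rewrite /cnorm; lra.
rewrite mulrA ler_pM2r ?invr_gt0// -mulrA mulrBl mul1r mulVf ?gt_eqF//.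
by case/andP: t01; nra.
Qed.

End CubeNorm.

(** * Locally finite images in CW complexes *)

Section CW.
Variables (R : realType) (K : topologicalType) (cw : cw_structure R K).
Hypothesis hK : hausdorff_space K.

Notation cell := (cw_cell cw).
Notation dim := (@cw_dim R K cw).
Definition ocell (e : cell) : set K := @cw_map _ _ cw e @` open_cube.
Definition ccell (e : cell) : set K := @cw_map _ _ cw e @` cube.

Lemma ccell_compact e : compact (ccell e).
Proof.
by apply: continuous_compact; [exact: cw_map_continuous|exact: cube_compact].
Qed.

Lemma ccell_closed e : closed (ccell e).
Proof. exact/(compact_closed hK)/ccell_compact. Qed.

Lemma ocell_ccell e : ocell e `<=` ccell e.
Proof. by move=> _ [v hv <-]; exists v => //; exact: open_cube_cube. Qed.

Lemma cell_exists y : {e | ocell e y}.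
Proof.
apply: cid; have : [set: K] y by [].
by rewrite -(cw_cover cw) => -[e _ he]; exists e.
Qed.

Definition cell_of y : cell := projT1 (cell_exists y).
Lemma cell_ofP y : ocell (cell_of y) y.
Proof. exact: (projT2 (cell_exists y)). Qed.

Lemma ocell_inj e e' y : ocell e y -> ocell e' y -> e = e'.
Proof. by move=> h h'; apply: (cw_disjoint (c := cw)) => //; exists y. Qed.

Lemma cell_of_eq e y : ocell e y -> cell_of y = e.
Proof. by move=> h; apply: ocell_inj (cell_ofP y) h. Qed.

Lemma ccell_finite e : exists F : set cell,
  [/\ finite_set F, ccell e `<=` \bigcup_(e' in F) ocell e' &
      forall e', F e' -> e' = e \/ (dim e' < dim e)%N].
Proof.
have [F [fF hF FF]] := cw_closure_finite e.
exists (F `|` [set e]); split.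
- by rewrite finite_setU; split => //; exact: finite_set1.
- move=> _ [v hv <-]; have [ho|ho] := pselect (open_cube v).
    by exists e; [right|exists v].
  have [e' Fe' h] := FF _ (ex_intro2 _ _ v (conj hv ho) erefl).
  by exists e' => //; left.
- by move=> e' [/hF|->]; [right|left].
Qed.

Lemma bcell_sub e : @cw_map _ _ cw e @` cube_boundary `<=`
  \bigcup_(e' in [set e' | (dim e' < dim e)%N]) ocell e'.
Proof.
have [F [fF hF FF]] := cw_closure_finite e.
by move=> y /FF [e' /hF h1 h2]; exists e'.
Qed.

(** By closure finiteness the trace on a closed cell is a finite union of compact sets, closed since
    [K] is Hausdorff; the weak topology concludes. *)
Lemma subcomplex_closed (J : set cell) :
  (forall e, J e -> @cw_map _ _ cw e @` cube_boundary `<=` \bigcup_(e' in J) ocell e') ->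
  closed (\bigcup_(e in J) ocell e).
Proof.
move=> hJ; apply: cw_weak_topology => e.
have [F [fF hF _]] := ccell_finite e.
have -> : \bigcup_(e0 in J) ocell e0 `&` @cw_map _ _ cw e @` cube =
    \bigcup_(e' in F `&` J) (ccell e' `&` ccell e).
  apply/seteqP; split=> y.
    move=> [[e' Je' he'] ey]; have [e'' Fe'' he''] := hF _ ey.
    have ee := ocell_inj he' he''; rewrite -ee in Fe''.
    by exists e' => //; split=> //; exact: ocell_ccell.
  move=> [e' [Fe' Je'] [[v cv <-] ey]]; split=> //.
  have [ho|ho] := pselect (open_cube v); first by exists e' => //; exists v.
  by apply: (hJ _ Je'); exists v.
apply: closed_bigcup_fin; first exact: finite_setIl.
by move=> e' _; apply: closedI; exact: ccell_closed.
Qed.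

(** The strict bound makes [skel 0] empty, so that inductions on skeleta start from nothing. *)
Definition skel n : set K := \bigcup_(e in [set e | (dim e < n)%N]) ocell e.

Lemma skel_closed n : closed (skel n).
Proof.
apply: subcomplex_closed => e /= en y /bcell_sub [e' /= h1 h2].
by exists e' => //=; exact: ltn_trans en.
Qed.

(** Boundaries consist of cells of smaller dimension, so removing one [n]-cell leaves a subcomplex;
    hence this cell is open relative to [skel n.+1]. *)
Lemma skelD_closed e n : dim e = n -> closed (skel n.+1 `\` ocell e).
Proof.
move=> en.
have -> : skel n.+1 `\` ocell e =
    \bigcup_(e' in [set e' | (dim e' < n.+1)%N /\ e' <> e]) ocell e'.
  apply/seteqP; split=> y.
    by move=> [[e' he' y1] y2]; exists e' => //; split=> // ee; rewrite ee in y1.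
  move=> [e' [h1 h2] y1]; split; first by exists e'.
  by move=> y2; apply: h2; exact: ocell_inj y1 y2.
apply: subcomplex_closed => e' [h1 h2] y /bcell_sub [e'' /= h3 h4].
exists e'' => //; have h5 : (dim e'' < n)%N.
  by apply: leq_trans h3 _.
by split; [exact: ltnW|move=> ee; rewrite ee en ltnn in h5].
Qed.

Lemma skel_cell n y : skel n y <-> (dim (cell_of y) < n)%N.
Proof.
split; last by move=> h; exists (cell_of y) => //; exact: cell_ofP.
by move=> [e en /cell_of_eq ->].
Qed.

(** A cast gives the characteristic maps of all [n]-cells one common domain, so that the cell can
    vary with a point while the coordinates stay in a fixed space. *)
Definition cell_par n (e : cell) : 'rV[R]_n -> K :=
  if eqVneq (dim e) n is EqNotNeq p
  then fun v => @cw_map _ _ cw e (castmx (erefl, esym p) v)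
  else fun=> @cw_map _ _ cw e 0.

Lemma cell_par_dim e : @cell_par (dim e) e = @cw_map _ _ cw e.
Proof.
apply/funext => v; rewrite /cell_par; case: eqVneq => [p|/eqP//].
by rewrite (eq_irrelevance (esym p) erefl) castmx_id.
Qed.

Lemma cell_parP n e : dim e = n ->
  [/\ {within cube, continuous (@cell_par n e)},
      @cell_par n e @` open_cube = ocell e,
      @cell_par n e @` cube_boundary `<=` skel n &
      exists2 h : K -> 'rV[R]_n, {within ocell e, continuous h} &
        forall v, open_cube v -> h (@cell_par n e v) = v].
Proof.
move=> en; subst n; rewrite cell_par_dim; split=> //.
- exact: cw_map_continuous.
- exact: bcell_sub.
- exact: cw_map_homeo.
Qed.

(* If the image of [f] met infinitely many cells near [a], a sequence converging
   to [a] could be chosen with values in distinct cells; its values would form a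
   closed discrete set. *)
Lemma locally_finite_image (X : topologicalType) (d : X -> X -> R) (A : set X)
    (f : X -> K) a : dist_for d -> A a -> cts_in A f a ->
  exists2 F : set cell, finite_set F &
    \forall x \near a, A x -> F (cell_of (f x)).
Proof.
move=> dX Aa fa; apply: contrapT => /forall2NP nF.
have pickP (s : seq X) (k : nat) : exists x, [/\ A x, d a x < k.+1%:R^-1 &
    ~ (exists2 y, y \in (s : seq {classic X}) & cell_of (f x) = cell_of (f y))].
  have [|hF] := nF [set e | exists2 y, y \in (s : seq {classic X}) & e = cell_of (f y)].
    case. rewrite (_ : [set e | _] = (fun y => cell_of (f y)) @` [set` (s : seq {classic X})]).
      exact/finite_image/finite_seq.
    by apply/seteqP; split=> e [y ys]; [move=> ->; exists y|move=> <-; exists y].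
  apply: contrapT => nx; apply: hF; apply/(dist_nbhs dX).
  exists k.+1%:R^-1; first by rewrite invr_gt0 ltr0n.
  move=> x dx Ax; apply: contrapT => h; apply: nx; exists x; split=> //.
pose nxt s k := projT1 (cid (pickP s k)).
(* The list starts with [a], so that the chosen cells also avoid the cell of [f a] and [f a] stays
   outside the closed set of chosen values. *)
pose fix g (k : nat) : seq X := if k is k'.+1 then nxt (g k') k' :: g k' else [:: a].
pose z k := nxt (g k) k.
have zP k : [/\ A (z k), d a (z k) < k.+1%:R^-1 &
    ~ (exists2 y, y \in (g k : seq {classic X}) & cell_of (f (z k)) = cell_of (f y))].
  exact: (projT2 (cid (pickP (g k) k))).
have gz k l : (k < l)%N -> z k \in (g l : seq {classic X}).
  elim: l => // l IH; rewrite ltnS leq_eqVlt => /orP[/eqP ->|/IH h] /=.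
    exact: (@mem_head {classic X}).
  by rewrite (@in_cons {classic X}) h orbT.
have ga k : a \in (g k : seq {classic X}).
  by elim: k => [|k IH] /=; rewrite (@in_cons {classic X}) ?IH ?orbT ?eqxx.
clearbody z; clearbody g; clear nxt.
have zinj k l : cell_of (f (z k)) = cell_of (f (z l)) -> k = l.
  move=> e; apply/eqP; rewrite eqn_leq; apply/andP; split; rewrite leqNgt; apply/negP => h.
    by have [_ _] := zP k; apply; exists (z l); [exact: gz|exact: e].
  by have [_ _] := zP l; apply; exists (z k); [exact: gz|exact: esym e].
pose Z := [set f (z k) | k in [set: nat]].
have cZ : closed Z.
  apply: cw_weak_topology => e; have [F [fF hF _]] := ccell_finite e.
  apply: ((@accessible_finite_set_closed K).1 (hausdorff_accessible hK)).
  apply: (@sub_finite_set _ _ (\bigcup_(e' in F) (Z `&` ocell e'))).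
    by move=> y [Zy /hF [e' Fe' h]]; exists e'.
  apply: bigcup_finite => // e' _.
  have [[y [[k _ zy] hy]]|n] := pselect (exists y, (Z `&` ocell e') y); last first.
    rewrite (_ : _ `&` _ = set0); first exact: finite_set0.
    by apply/seteqP; split=> // y hy; apply: n; exists y.
  apply: (@sub_finite_set _ _ [set y]); last exact: finite_set1.
  move=> y' [[l _ zy'] hy']; rewrite -zy -zy'; congr (f (z _)).
  by apply: zinj; rewrite zy zy' (cell_of_eq hy) (cell_of_eq hy').
have nZ : ~ Z (f a).
  move=> [k _ zk]; have [_ _] := zP k; apply; exists a; first exact: ga.
  by rewrite zk.
have /fa : nbhs (f a) (~` Z).
  by apply: open_nbhs_nbhs; split=> //; exact: closed_openC.
move=> /(dist_nbhs dX) [e e0 he].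
have [k hk] : exists k, k.+1%:R^-1 < e.
  have /archi_boundP h : 0 <= e^-1 by rewrite invr_ge0 ltW.
  exists (Num.bound e^-1); rewrite invf_plt ?posrE ?ltr0n//.
  by apply: (lt_trans h); rewrite ltr_nat.
have [Az dz _] := zP k.
by apply: (he (z k)) => //; [exact: lt_trans hk|exists k].
Qed.

End CW.

(** * Extension to neighbourhoods *)

(** Compactness of the cube merges the neighbourhoods of the points of the fibre over [y] into one
    margin [e], valid for the fibres over nearby points too; off the fibre, separation in [K] keeps
    the values away from [y]. *)
Lemma tube (R : realType) (K : topologicalType) n (Phi : 'rV[R]_n -> K) (y : K)
    (Q : set 'rV[R]_n) : hausdorff_space K -> {within cube, continuous Phi} ->
  (forall u, cube u -> Phi u = y -> nbhs u Q) ->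
  exists2 e : R, 0 < e & \forall z \near y,
    forall u w, cube u -> Phi u = z -> `|w - u| < e -> Q w.
Proof.
move=> hK cPhi hQ.
have cP x : cube x -> cts_in cube Phi x by exact: ((cts_inP _ _).1 cPhi x).
pose P (p : R * K) (u : 'rV[R]_n) := cube u -> Phi u = p.2 ->
  forall w, `|w - u| < p.1 -> Q w.
have := (compact_near_coveringP _).1 (@cube_compact R n) (R * K)%type
  (filter_prod (0^'+) (nbhs y)) P _ _.
case=> [x cx|[A B] /= [hA hB] AB]; last first.
  have [e [Ae e0]] : exists e, A e /\ 0 < e.
    have : \forall e \near 0^'+, A e /\ 0 < e by apply: filterI => //; exact: nbhs_right_gt.
    exact: filter_ex.
  exists e => //; apply: filterS hB => z Bz u w cu uz wu.
  exact: (AB (e, z) (conj Ae Bz) u cu cu uz).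
have [xy|xy] := pselect (Phi x = y).
  have /nbhs_ballP[e /= e0 he] := hQ _ cx xy.
  exists (ball x (e / 2), ([set t | t < e / 2] `*` setT)) => /=.
    split; first by apply: nbhsx_ballx; rewrite divr_gt0.
    exists ([set t | t < e / 2], setT) => //=; split; last exact: filterT.
    by near=> t => /=; near: t; apply: nbhs_right_lt; rewrite divr_gt0.
  move=> [u [t z]] /= [xu [te _]] cu _ w wu; apply: he.
  move: xu; rewrite -!ball_normE /= => xu.
  rewrite distrC (le_lt_trans (ler_distD u _ _))// (splitr e).
  by rewrite ltrD//; [exact: lt_trans wu te|rewrite distrC].
move: hK; rewrite open_hausdorff => /(_ (Phi x) y).
have nxy : Phi x != y by apply/eqP.
move=> /(_ nxy) [[A B] /= [/set_mem Ax /set_mem By] [oA oB AB]].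
exists ([set u | cube u -> A (Phi u)], setT `*` B).
  split; first by apply: cP => //; exact: open_nbhs_nbhs.
  by exists (setT, B) => //; split; [exact: filterT|exact: open_nbhs_nbhs].
move=> [u [t z]] /= [hu [_ Bz]] cu uz; have : (A `&` B) z.
  by split=> //; rewrite -[z]uz; exact: hu.
by rewrite (eqP AB).
Unshelve. all: by end_near. Qed.

Lemma closed_preim (X K : topologicalType) (A : set X) (f : X -> K) (Y : set K) :
  closed A -> closed Y -> (forall x, A x -> cts_in A f x) ->
  closed (A `&` f @^-1` Y).
Proof.
move=> cA cY fA x xc; have Ax : A x by apply: cA; exact: (closureS (@subIsetl _ A _)) xc.
split=> //; apply: contrapT => nY.
have /(fA _ Ax) h : nbhs (f x) (~` Y).
  by apply: open_nbhs_nbhs; split=> //; exact: closed_openC.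
by have [y [[Ay Yy] hy]] := xc _ h; exact: hy Ay Yy.
Qed.

Lemma rV_cts_at (R : realType) (X : topologicalType) n (v : X -> 'rV[R]_n) (A : set X) x :
  (forall j, cts_in A (fun y => v y ord0 j : R) x) -> cts_in A v x.
Proof.
move=> h V /nbhs_ballP[e /= e0 he].
have : \forall y \near x, forall j, A y -> ball (v x ord0 j) e (v y ord0 j).
  by apply: filter_forall => j; apply: h; exact: nbhsx_ballx.
apply: filterS => y hy Ay; apply: he; split=> // i j; rewrite (ord1 i).
exact: hy.
Qed.

Lemma rV_cts_dist (R : realType) (X : topologicalType) n (v : X -> 'rV[R]_n) (A : set X) x :
  (forall e, 0 < e -> \forall y \near x, A y -> `|v y - v x| < e) <-> cts_in A v x.
Proof.
split=> [h V /nbhs_ballP[e /= e0 he]|h e e0].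
  apply: filterS (h _ e0) => y hy Ay; apply: he; rewrite -ball_normE /= distrC.
  exact: hy.
have := h _ (nbhsx_ballx (v x) _ e0); apply: filterS => y hy Ay.
by have := hy Ay; rewrite -ball_normE /= distrC.
Qed.

Section CtsReal.
Variables (R : realType) (X : topologicalType) (f : X -> R) (x : X).
Hypothesis cf : cts_at f x.

Lemma cts_at_lt c : f x < c -> \forall y \near x, f y < c.
Proof. by move=> h; apply: (cf (V := [set s | s < c])); exact: lt_nbhsl. Qed.

Lemma cts_at_gt c : c < f x -> \forall y \near x, c < f y.
Proof.
move=> h; apply: (cf (V := [set s | c < s])); apply: open_nbhs_nbhs.
by split=> //; exact: open_gt.
Qed.

Lemma cts_at_ne c : f x <> c -> \forall y \near x, f y <> c.
Proof.
move=> h; have [/cts_at_lt|/cts_at_gt|//] := ltgtP (f x) c;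
  by apply: filterS => y h1 h2; rewrite h2 ltxx in h1.
Qed.

End CtsReal.

Section Clamp.
Variable R : realType.

Definition clamp01 (t : R) : R := Num.max 0 (Num.min 1 t).

Lemma clamp01_itv t : 0 <= clamp01 t <= 1.
Proof. by rewrite /clamp01 le_max lexx ge_max ler01 ge_min lexx. Qed.

Lemma clamp01_id t : 0 <= t <= 1 -> clamp01 t = t.
Proof. by move=> /andP[t0 t1]; rewrite /clamp01 min_r// max_r. Qed.

Lemma clamp01_continuous : continuous clamp01.
Proof.
move=> t; rewrite /clamp01; apply: continuous_max; first exact: cvg_cst.
by apply: continuous_min; [exact: cvg_cst|exact: cvg_id].
Qed.

End Clamp.

Section NE.
Variables (R : realType) (K : topologicalType).

(** The notion of absolute neighbourhood extensor, for pseudo-metric sources and for a subset [Y] of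
    [K]. *)
Definition nbhd_ext (Y : set K) : Prop :=
  forall (X : topologicalType) (d : X -> X -> R), dist_for d ->
  forall (A : set X) (f : X -> K), closed A ->
    (forall x, A x -> cts_in A f x) -> (forall x, A x -> Y (f x)) ->
  exists (U : set X) (F : X -> K), [/\ open U, A `<=` U,
    forall x, U x -> cts_at F x, forall x, U x -> Y (F x) &
    forall x, A x -> F x = f x].

End NE.

(* Near the points sent to open cells of dimension [n] the map is extended in the
   cell coordinates by Tietze's theorem and pushed radially out of the cells as
   the point moves away from [A]; what reaches the boundary of the cells is
   extended in the skeleton of lower dimension. *)
Section Step.
Variables (R : realType) (K : topologicalType) (cw : cw_structure R K).
Hypothesis hK : hausdorff_space K.
Variable n : nat.
Hypothesis NEn : nbhd_ext R (skel cw n).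
Variables (X : topologicalType) (d : X -> X -> R) (A : set X) (f : X -> K).
Hypotheses (dX : dist_for d) (cA : closed A) (fA : forall x, A x -> cts_in A f x).
Hypothesis fS : forall x, A x -> skel cw n.+1 (f x).

Let A1 := A `&` f @^-1` skel cw n.
Let O := A `\` f @^-1` skel cw n.
Let al x := cell_of cw (f x).
Let Phi (e : cw_cell cw) : 'rV[R]_n -> K := @cell_par _ _ cw n e.

Let cA1 : closed A1.
Proof. exact: closed_preim cA (@skel_closed _ _ cw hK n) fA. Qed.

Let dim_al x : O x -> cw_dim (al x) = n.
Proof.
move=> [Ax nx]; apply/eqP; rewrite eqn_leq.
have := (skel_cell cw n.+1 _).1 (fS Ax); rewrite ltnS => -> /=.
by rewrite leqNgt; apply/negP => h; apply: nx; apply/skel_cell.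
Qed.

Let hom_ex e : exists h : K -> 'rV[R]_n, cw_dim e = n ->
  {within ocell e, continuous h} /\ forall v, open_cube v -> h (Phi e v) = v.
Proof.
have [en|en] := eqVneq (cw_dim e) n; last first.
  by exists (fun=> 0) => h; rewrite h eqxx in en.
by have [_ _ _ [h h1 h2]] := cell_parP en; exists h.
Qed.

Let hom e := projT1 (cid (hom_ex e)).
Let v x := hom (al x) (f x).

Let vP x : O x -> open_cube (v x) /\ Phi (al x) (v x) = f x.
Proof.
move=> Ox; have en := dim_al Ox.
have [_ h2] := projT2 (cid (hom_ex (al x))) en.
have [_ ho _ _] := cell_parP en.
have : ocell (al x) (f x) by exact: cell_ofP.
by rewrite -ho => -[w ow wx]; rewrite /v /hom -wx h2.
Qed.

Let al_near x : O x -> \forall y \near x, A y -> O y /\ al y = al x.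
Proof.
move=> [Ax nx]; have en := dim_al (conj Ax nx).
have c := closed_preim cA (@skelD_closed _ _ cw hK _ _ en) fA.
have : nbhs x (~` (A `&` f @^-1` (skel cw n.+1 `\` ocell (al x)))).
  apply: open_nbhs_nbhs; split; first exact: closed_openC.
  by move=> [_ [_ h]]; apply: h; exact: cell_ofP.
apply: filterS => y hy Ay.
have oy : ocell (al x) (f y).
  by apply: contrapT => h; apply: hy; split=> //; split=> //; exact: fS.
have e : al y = al x by exact: cell_of_eq oy.
split=> //; split=> // /skel_cell; rewrite -/(al y) e en ltnn.
by [].
Qed.

Let v_cts x : O x -> cts_in A v x.
Proof.
move=> Ox; have en := dim_al Ox.
have [h1 h2] := projT2 (cid (hom_ex (al x))) en.
have [Ax nx] := Ox.
have hx : cts_in (ocell (al x)) (hom (al x)) (f x).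
  by apply: (cts_inP _ _).1 => //; exact: cell_ofP.
have hh : cts_in (A `&` [set y | al y = al x]) (hom (al x) \o f) x.
  apply: cts_in_comp hx; last by apply: cts_in_sub (fA Ax) => y [].
  by move=> y [_ <-]; exact: cell_ofP.
move=> V Vx.
have := al_near Ox; apply: filterS2 (hh V Vx) => y h3 h4 Ay.
have [_ e] := h4 Ay.
by rewrite /v e; exact: h3.
Qed.

Let d1 := distset d A1.
(** The cell coordinates need not have limits at [A1]. Centred and multiplied by the distance to
    [A1], they extend by 0 to all of [A], so that Tietze's theorem applies; dividing by the distance
    afterwards restores them on [O]. *)
Let vb j x : R := if `[< O x >] then d1 x * (v x ord0 j - 2^-1) else 0.

Let vb_bd j x : `|vb j x| <= d1 x.
Proof.
rewrite /vb; case: asboolP => [Ox|_]; last by rewrite normr0 distset_ge0.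
have [/(_ j) /andP[h1 h2] _] := vP Ox.
have d0 : 0 <= d1 x := distset_ge0 dX A1 x.
rewrite normrM (ger0_norm d0) ler_piMr// ler_norml; lra.
Qed.

Let vb_cts j x : A x -> cts_in A (vb j) x.
Proof.
move=> Ax; have [Ox|Ox] := pselect (O x).
  have h : cts_in A (fun y => d1 y * (v y ord0 j - 2^-1)) x.
    have FF : Filter (within A (nbhs x)) by exact: within_filter.
    apply: (@cvgM R X (within A (nbhs x)) FF d1 (fun y => v y ord0 j - 2^-1)).
      by apply: cvg_within_filter; exact: distset_continuous.
    apply: cvgB; last exact: cvg_cst.
    apply: (@cts_in_comp _ _ _ A setT v (fun w => w ord0 j)) => //.
      exact: v_cts.
    by apply: cts_at_in; exact: coord_continuous.
  apply: cts_in_eq h; first by rewrite /vb; case: asboolP.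
  apply: filterS (al_near Ox) => y hy Ay; have [Oy _] := hy Ay.
  by rewrite /vb; case: asboolP.
have A1x : A1 x by split=> //; apply: contrapT => nx; apply: Ox.
have vx : vb j x = 0 by rewrite /vb; case: asboolP.
apply: cts_at_in; rewrite /cts_at; change (vb j @ x --> vb j x); rewrite vx.
apply/cvgr0Pnorm_lt => e e0.
have : d1 y @[y --> x] --> 0.
  by rewrite -(distset0 dX A1x); exact: distset_continuous.
move=> /cvgr0Pnorm_lt /(_ e e0); apply: filterS => y; apply: le_lt_trans.
by apply: le_trans (vb_bd j y) _; exact: ler_norm.
Qed.

Let gex j : exists g : X -> R, continuous g /\ forall x, A x -> g x = vb j x.
Proof.
have [|x Ax|g [h1 h2 _]] := @continuous_bounded_extension X R (dist_normal dX) A cA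
  (vb j) 1 ltr01.
- by apply/cts_inP => x Ax; exact: vb_cts.
- by apply: le_trans (vb_bd j x) _; exact: distset_le1.
- by exists g; split=> // x Ax; rewrite h1// inE.
Qed.

Let g j := projT1 (cid (gex j)).
Let v' x : 'rV[R]_n := \row_j clamp01 (2^-1 + g j x / d1 x).

Let v'_cube x : cube (v' x).
Proof. by move=> j; rewrite mxE clamp01_itv. Qed.

Let d1_gt0 x : ~ A1 x -> 0 < d1 x.
Proof. exact: distset_gt0. Qed.

Let v'_cts x : ~ A1 x -> cts_at v' x.
Proof.
move=> /d1_gt0 d0; suff : cts_in setT v' x by apply: cts_in_at; exact: filterT.
apply: rV_cts_at => j; apply: cts_at_in.
have -> : (fun y => v' y ord0 j) = (fun y => clamp01 (2^-1 + g j y / d1 y)).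
  by apply/funext => y; rewrite mxE.
apply: cts_at_comp; last exact: clamp01_continuous.
have [gc _] := projT2 (cid (gex j)).
apply: (@cvgD R R^o X (nbhs x) _ (cst 2^-1) (fun y => g j y / d1 y)).
  exact: cvg_cst.
apply: (@cvgM R X (nbhs x) _ (g j) (fun y => (d1 y)^-1)); first exact: gc.
by apply: cvgV; [rewrite gt_eqF|exact: distset_continuous].
Qed.

Let v'E x : O x -> v' x = v x.
Proof.
move=> Ox; apply/rowP => j; rewrite mxE /g.
have [_ ->] := projT2 (cid (gex j)); last by case: Ox.
have A1x : ~ A1 x by move=> [_ h]; case: Ox => _; exact.
have d0 := d1_gt0 A1x.
rewrite /vb; case: asboolP => // _; rewrite mulrAC divff ?gt_eqF// mul1r.
rewrite addrC subrK clamp01_id//.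
by have [/open_cube_cube/(_ j)] := vP Ox.
Qed.

(* [W] is a neighbourhood of [O], so thin near [A1] that [v'] is there a good
   approximation of [v]. *)
Let good o r e := [/\ O o, 0 < r <= e,
  forall a, A1 a -> 2 * e <= d o a,
  forall x, d o x < r -> `|v' x - v o| < e &
  forall a, A a -> d o a < 2 * r -> al a = al o].

Let good_ex o : O o -> exists r e, good o r e.
Proof.
move=> Oo; have A1o : ~ A1 o by move=> [_ h]; case: Oo => _; exact.
have [e1 e10 h1] : exists2 e, 0 < e & forall y, d o y < e -> ~ A1 y.
  apply/(dist_nbhs dX); apply: open_nbhs_nbhs; split=> //.
  exact: closed_openC.
pose e := e1 / 2; have e0 : 0 < e by rewrite divr_gt0.
have [e2 e20 h2] : exists2 r, 0 < r & forall y, d o y < r -> `|v' y - v' o| < e.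
  apply/(dist_nbhs dX).
  have := (rV_cts_dist _ setT _).2 (cts_at_in _ (v'_cts A1o)) e e0.
  by apply: filterS => y; exact.
have [e3 e30 h3] := (dist_nbhs dX _ _).1 (al_near Oo).
exists (Num.min e (Num.min e2 (e3 / 2))), e; split => //.
- by rewrite !lt_min e0 e20 divr_gt0//= ge_min lexx.
- move=> a A1a; rewrite leNgt; apply/negP => h; apply: (h1 a _ A1a).
  by rewrite /e in h; lra.
- by move=> x; rewrite !lt_min => /and3P[_ /h2 + _]; rewrite (v'E Oo).
- move=> a Aa h; have [] // := h3 a _ Aa; apply: (lt_le_trans h).
  have : Num.min e (Num.min e2 (e3 / 2)) <= e3 / 2 by rewrite !ge_min lexx !orbT.
  by lra.
Qed.

Let W x := exists o r e, good o r e /\ d o x < r.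

Let W_open : open W.
Proof.
rewrite openE => x [o [r [e [h hx]]]]; apply/(dist_nbhs dX).
exists (r - d o x); first by rewrite subr_gt0.
move=> y hy; exists o, r, e; split=> //.
by have := dist_tri dX o x y; lra.
Qed.

Let OW : O `<=` W.
Proof.
move=> o Oo; have [r [e h]] := good_ex Oo; exists o, r, e; split=> //.
by rewrite (dist_refl dX); case: h => _ /andP[].
Qed.

Let be x := al (if pselect (W x) is left h then projT1 (cid h) else x).

(** If two of the balls meet, their centres are closer than twice the larger radius, a distance
    within which [good] keeps the cell constant. The label of [x] is therefore independent of the
    chosen centre. *)
Let beE x o r e : good o r e -> d o x < r -> be x = al o.
Proof.
move=> h hx; rewrite /be; case: pselect => [Wx|[]]; last by exists o, r, e.
case: (cid Wx) => o' /= [r' [e' [h' hx']]].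
have [Oo _ _ _ g1] := h; have [Oo' _ _ _ g2] := h'.
have tr := dist_tri dX o x o'; have s1 := dist_sym dX x o'.
have s2 := dist_sym dX o o'.
have [rr|rr] := leP r r'.
  by apply: esym; apply: g2; [case: Oo|lra].
by apply: g1; [case: Oo'|lra].
Qed.

Let be_near x : W x -> \forall y \near x, W y /\ be y = be x.
Proof.
move=> [o [r [e [h hx]]]]; apply/(dist_nbhs dX).
exists (r - d o x); first by rewrite subr_gt0.
move=> y hy; have hy' : d o y < r by have := dist_tri dX o x y; lra.
split; first by exists o, r, e.
by rewrite (beE h hx) (beE h hy').
Qed.

Let dim_be x : W x -> cw_dim (be x) = n.
Proof.
by move=> [o [r [e [h hx]]]]; rewrite (beE h hx) dim_al//; case: h.
Qed.

Let t := sep d O (~` W).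

Let A_O x : A x -> ~ A1 x -> O x.
Proof. by move=> Ax h; split=> // h2; apply: h. Qed.

Let t_cts x : ~ A1 x -> cts_at t x.
Proof.
move=> A1x; apply: (sep_cts dX).
have a0 := distset_ge0 dX O x; have b0 := distset_ge0 dX (~` W) x.
have [Wx|Wx] := pselect (W x).
  have : 0 < distset d (~` W) x.
    apply: (distset_gt0 dX); first exact: open_closedC.
    by move=> h; exact: h.
  by lra.
have Ax : ~ A x by move=> Ax; apply: Wx; apply: OW; exact: A_O.
have : 0 < distset d A x by exact: distset_gt0.
suff : distset d A x <= distset d O x by lra.
rewrite leNgt; apply/negP => h.
have [o Oo] := distset_lt dX h (distset_le1 dX A x).
have [Ao _] := Oo.
by rewrite ltNge (distset_le dX _ Ao).
Qed.

Let tO x : O x -> t x = 0.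
Proof. exact: (sep0 dX). Qed.

Let tW x : ~ A1 x -> t x < 1 -> W x.
Proof.
move=> A1x h; apply: contrapT => Wx; move: h; rewrite /t (sep1 dX) ?ltxx//.
have Ax : ~ A x by move=> Ax; apply: Wx; apply: OW; exact: A_O.
have : 0 < distset d A x by exact: distset_gt0.
suff : distset d A x <= distset d O x by lra.
rewrite leNgt; apply/negP => h.
have [o Oo] := distset_lt dX h (distset_le1 dX A x).
have [Ao _] := Oo.
by rewrite ltNge (distset_le dX _ Ao).
Qed.

(** The push is complete already at [t x = 2^-1]: this level lies inside [W] and can serve as the
    interface with the extension in the lower skeleton. *)
Let tau x := clamp01 (2 * t x).
Let Psi x := Phi (be x) (push_out (v' x) (tau x)).

Let tau_itv x : 0 <= tau x <= 1. Proof. exact: clamp01_itv. Qed.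

Let Phi_cts e w : cw_dim e = n -> cube w -> cts_in cube (Phi e) w.
Proof.
by move=> en; have [c _ _ _] := cell_parP en; exact: ((cts_inP _ _).1 c w).
Qed.

Let coef_cts (x : X) : ~ A1 x ->
  cts_at (fun y => push_out (v' y) (tau y)) x.
Proof.
move=> A1x; have vc : {for x, continuous v'} := v'_cts A1x.
have tc : {for x, continuous tau}.
  apply: (@cts_at_comp _ _ _ (fun y => 2 * t y) (@clamp01 R)).
    by apply: cvgM; [exact: cvg_cst|exact: t_cts].
  exact: clamp01_continuous.
have rc : {for x, continuous (fun y => cnorm (v' y))}.
  apply: cvgM; first exact: cvg_cst.
  by apply: cvg_norm; apply: cvgB; [exact: vc|exact: cvg_cst].
have mc : {for x, continuous (fun y => Num.max (cnorm (v' y)) 2^-1)}.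
  by apply: continuous_max; [exact: rc|exact: cvg_cst].
apply: cvgD; first exact: cvg_cst.
apply: cvgZ; last by apply: cvgB; [exact: vc|exact: cvg_cst].
apply: cvgD; first by apply: cvgB; [exact: cvg_cst|exact: tc].
apply: cvgM; first exact: tc.
apply: cvgV; last exact: mc.
by rewrite gt_eqF// lt_max invr_gt0 ltr0n orbT.
Qed.

Let Psi_cts x : ~ A1 x -> W x -> cts_at Psi x.
Proof.
move=> A1x Wx; apply: (@cts_at_eq _ _ _ (fun y => Phi (be x) (push_out (v' y) (tau y)))).
  by apply: filterS (be_near Wx) => y [_ e]; rewrite /Psi e.
apply: (@cts_in_at _ _ setT); first exact: filterT.
apply: (@cts_in_comp _ _ _ setT cube _ (Phi (be x))).
- by move=> y _; apply: push_out_cube.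
- exact/cts_at_in/coef_cts.
- by apply: Phi_cts; [exact: dim_be|exact: push_out_cube].
Qed.

(** Only finitely many cells occur near [a]. In each of them the fibre over [f a] lies on the
    boundary of the cube, since [f a] is in the lower skeleton; [tube] keeps the coordinates near
    such points close to the boundary, where the push moves them little. *)
Let Psi_limit a V : A1 a -> nbhs (f a) V ->
  \forall x \near a, ~ A1 x -> W x -> V (Psi x) /\ 2^-1 < cnorm (v' x).
Proof.
move=> A1a fV; have [Aa Sa] := A1a.
have [F fF hF] := locally_finite_image cw hK dX Aa (fA Aa).
have tubeF e : cw_dim e = n -> exists2 r : R, 0 < r & \forall z \near f a,
    forall u w, cube u -> Phi e u = z -> `|w - u| < r -> cube w -> V (Phi e w).
  move=> en; have [c ho hb _] := cell_parP en.
  by apply: tube hK c _ => u cu ue; apply: (Phi_cts en cu); move: fV; rewrite -ue.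
have tubeR e (s : R) : cw_dim e = n -> 0 < s -> exists2 r : R, 0 < r &
    \forall z \near f a,
    forall u w, cube u -> Phi e u = z -> `|w - u| < r -> 1 - s < cnorm w.
  move=> en s0; have [c ho hb _] := cell_parP en.
  apply: tube hK c _ => u cu ue.
  have ru : cnorm u = 1.
    apply/eqP; rewrite eq_le ((cube_cnorm _).1 cu) /= leNgt; apply/negP => h.
    have : ocell e (f a) by rewrite -ho -ue; exists u => //; exact/open_cube_cnorm.
    move: Sa => [e' /= h1 h2] h3; have ee := ocell_inj h2 h3.
    by rewrite ee en ltnn in h1.
  apply/nbhs_ballP; exists (s / 2) => /=; first by rewrite divr_gt0.
  move=> w; rewrite -ball_normE /= => h.
  by have := cnorm_lip u w; rewrite ru; lra.
have key e : F e -> \forall x \near a, forall o r s, good o r s -> d o x < r ->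
    al o = e -> V (Psi x) /\ 2^-1 < cnorm (v' x).
  move=> Fe; have [en|en] := eqVneq (cw_dim e) n; last first.
    apply: nearW => x o r s [Oo _ _ _ _] _ ee.
    by rewrite -ee dim_al// eqxx in en.
  have [r1 r10 h1] := tubeF e en.
  pose s1 := Num.min 2^-1 (r1 / 2).
  have s10 : 0 < s1 by rewrite lt_min invr_gt0 ltr0n divr_gt0.
  have [r2 r20 h2] := tubeR e s1 en s10.
  have [e1 e10 {}h1] := (dist_nbhs dX _ _).1 (fA Aa h1).
  have [e2 e20 {}h2] := (dist_nbhs dX _ _).1 (fA Aa h2).
  (* With [2 * s <= d o a], [d o x < s] and [d a x < m] one gets [s < m] and [d o a < 2 * m]: hence
     the halves of [e1] and [e2]. The error of [v'] is below [r1 / 4], and the push adds at most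
     another [r1 / 4]. *)
  pose m := Num.min (e1 / 2) (Num.min (e2 / 2) (Num.min (r1 / 4) r2)).
  have m0 : 0 < m by rewrite !lt_min !divr_gt0.
  have [m1 m2 m3 m4] : [/\ m <= e1 / 2, m <= e2 / 2, m <= r1 / 4 & m <= r2].
    by rewrite /m !ge_min !lexx !orbT.
  apply/(dist_nbhs dX); exists m => // x dx o r s gd ox ee.
  have [Oo /andP[r0 rs] gA gv gal] := gd.
  have := gA a A1a => sa.
  have tr := dist_tri dX o x a; have sy := dist_sym dX x a.
  have sy2 := dist_sym dX o a.
  have [Ao _] := Oo; have [ov pv] := vP Oo; rewrite ee in pv.
  have vv := gv x ox.
  have hr := h2 o ltac:(lra) Ao (v o) (v' x) (open_cube_cube ov) pv ltac:(lra).
  have s12 : s1 <= 2^-1 by rewrite /s1 ge_min lexx.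
  have s13 : s1 <= r1 / 2 by rewrite /s1 ge_min lexx orbT.
  have rv : 2^-1 < cnorm (v' x) by lra.
  split=> //; rewrite /Psi (beE gd ox) ee.
  apply: (h1 o ltac:(lra) Ao (v o) _ (open_cube_cube ov) pv); last exact: push_out_cube.
  have h3 := @push_out_near _ _ (v' x) (tau x) (tau_itv x) (v'_cube x) (ltW rv).
  have h4 := ler_distD (v' x) (push_out (v' x) (tau x)) (v o).
  lra.
have all := near_finite (@nbhs_filter _ a) fF key.
have [e0 e00 he0] := (dist_nbhs dX _ _).1 hF.
have : \forall x \near a, d a x < e0 / 2 by apply: (near_dist dX); rewrite divr_gt0.
apply: filterS2 all => x hx dax A1x [o [r [s [gd ox]]]].
have [Oo /andP[r0 rs] gA gv gal] := gd.
have := gA a A1a => sa.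
have tr := dist_tri dX o x a; have sy := dist_sym dX x a.
have sy2 := dist_sym dX o a.
by apply: (hx (al o) _ o r s gd ox erefl); apply: he0; [lra|case: Oo].
Qed.

(** The set from which the lower skeleton takes over: besides [A1], the part of the level [t = 2^-1]
    where the push has reached the boundary of the cube. The points of this level too close to the
    centre form [Bad] and are cut out of the neighbourhood. *)
Let S' x := A1 x \/ [/\ ~ A1 x, t x = 2^-1 & 2^-1 <= cnorm (v' x)].
Let Bad x := [/\ ~ A1 x, t x = 2^-1 & cnorm (v' x) <= 2^-1].

Let cnorm_cts x : ~ A1 x -> cts_at (fun y => cnorm (v' y)) x.
Proof.
move=> A1x; have vc : {for x, continuous v'} := v'_cts A1x.
apply: cvgM; first exact: cvg_cst.
by apply: cvg_norm; apply: cvgB; [exact: vc|exact: cvg_cst].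
Qed.

Let nA1_near x : ~ A1 x -> \forall y \near x, ~ A1 y.
Proof.
by move=> A1x; apply: open_nbhs_nbhs; split=> //; exact: closed_openC.
Qed.

Let t_ne x : ~ A1 x -> t x <> 2^-1 -> \forall y \near x, t y <> 2^-1.
Proof.
by move=> A1x tx; exact: (cts_at_ne (t_cts A1x)).
Qed.

Let closed_S' : closed S'.
Proof.
rewrite -openC openE => x /not_orP[A1x nx].
have h := nA1_near A1x.
have [tx|tx] := pselect (t x = 2^-1); last first.
  by apply: filterS2 h (t_ne A1x tx) => y h1 h2 [//|[]].
have rx : cnorm (v' x) < 2^-1.
  by rewrite ltNge; apply/negP => r; apply: nx; split.
have : \forall y \near x, cnorm (v' y) < 2^-1.
  exact: (cts_at_lt (cnorm_cts A1x)).
by apply: filterS2 h => y h1 h2 [//|[_ _]]; rewrite leNgt h2.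
Qed.

Let closed_Bad : closed Bad.
Proof.
rewrite -openC openE => x nx.
have [A1x|A1x] := pselect (A1 x).
  apply: filterS (Psi_limit A1x (filterT : nbhs (f x) setT)) => y hy [A1y ty ry].
  have [|_] := hy A1y; first by apply: tW => //; lra.
  by rewrite ltNge ry.
have h := nA1_near A1x.
have [tx|tx] := pselect (t x = 2^-1); last first.
  by apply: filterS2 h (t_ne A1x tx) => y h1 h2 [].
have rx : 2^-1 < cnorm (v' x).
  by rewrite ltNge; apply/negP => r; apply: nx; split.
have : \forall y \near x, 2^-1 < cnorm (v' y).
  exact: (cts_at_gt (cnorm_cts A1x)).
by apply: filterS2 h => y h1 h2 [_ _]; rewrite leNgt h2.
Qed.

Let g0 x := if `[< A1 x >] then f x else Psi x.

Let tW2 x : ~ A1 x -> t x <= 2^-1 -> W x.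
Proof. by move=> h1 h2; apply: tW => //; lra. Qed.

Let g0_cts x : S' x -> cts_in S' g0 x.
Proof.
move=> Sx V; rewrite /g0; case: asboolP => [A1x fV|A1x fV].
  have [Ax _] := A1x.
  apply: filterS2 (Psi_limit A1x fV) (fA Ax fV) => y h1 h2 Sy.
  case: asboolP => [[Ay _]|A1y]; first exact: h2.
  case: Sy => [//|[_ ty _]].
  by have [] := h1 A1y (tW2 A1y _); first lra.
case: Sx => [//|[_ tx _]].
have := Psi_cts A1x (tW2 A1x _) fV.
move=> /(_ ltac:(lra)).
by apply: filterS2 (nA1_near A1x) => y A1y Vy _; case: asboolP.
Qed.

Let Psi_skel x : ~ A1 x -> W x -> skel cw n.+1 (Psi x).
Proof.
move=> A1x Wx; have en := dim_be Wx; have [c ho hb _] := cell_parP en.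
have [h|h] := pselect (open_cube (push_out (v' x) (tau x))).
  exists (be x); first by rewrite /= en.
  by rewrite -ho; exists (push_out (v' x) (tau x)).
have [|e /= h1 h2] := hb (Psi x).
  by exists (push_out (v' x) (tau x)) => //; split=> //; exact: push_out_cube.
by exists e => //=; exact: ltnW.
Qed.

Let g0_skel x : S' x -> skel cw n (g0 x).
Proof.
rewrite /g0; case: asboolP => [[_ //]|A1x [//|[_ tx rx]]].
have Wx : W x by apply: tW2 => //; lra.
have en := dim_be Wx; have [c ho hb _] := cell_parP en.
apply: hb; exists (push_out (v' x) (tau x)) => //.
have -> : tau x = 1 by rewrite /tau tx divff ?pnatr_eq0// clamp01_id ?ler01 ?lexx.
exact: push_out1_boundary.
Qed.

(** The pushed map serves where [t <= 2^-1] off [A1], the extension in the lower skeleton elsewhere.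
    They agree on the interface off [Bad], and at the points of [A1] both tend to [f]. *)
Lemma nbhd_ext_step : exists (U : set X) (F : X -> K), [/\ open U, A `<=` U,
  forall x, U x -> cts_at F x, forall x, U x -> skel cw n.+1 (F x) &
  forall x, A x -> F x = f x].
Proof.
have [UY [gY [oUY SUY cgY gYs gYE]]] := NEn dX closed_S' g0_cts g0_skel.
pose G x := if `[< ~ A1 x /\ t x <= 2^-1 >] then Psi x else gY x.
pose U1 := [set x | ~ A1 x /\ t x < 2^-1].
have oU1 : open U1.
  rewrite openE => x [A1x tx].
  have : \forall y \near x, t y < 2^-1.
    exact: (cts_at_lt (t_cts A1x)).
  by apply: filterS2 (nA1_near A1x) => y.
exists (U1 `|` (UY `&` ~` Bad)), G; split.
- apply: openU => //; apply: openI => //; exact: (closed_openC closed_Bad).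
- move=> x Ax; have [A1x|A1x] := pselect (A1 x).
    by right; split; [apply: SUY; left|case].
  by left; split=> //; rewrite tO// ?invr_gt0//; exact: A_O.
- have inU1 x : U1 x -> cts_at G x.
    move=> U1x; have [A1x tx] := U1x.
    apply: (@cts_at_eq _ _ _ Psi); last by apply: Psi_cts => //; apply: tW2 => //; exact: ltW.
    apply: filterS (open_nbhs_nbhs (conj oU1 U1x)) => y [A1y ty].
    by rewrite /G; case: asboolP => // -[]; split=> //; exact: ltW.
  move=> x [/inU1//|[Ux Bx]].
  have gcut : G x = gY x -> (\forall y \near x, ~ A1 y -> t y <= 2^-1 ->
      forall V, nbhs (gY x) V -> V (Psi y) \/ True) -> True by [].
  have [A1x|A1x] := pselect (A1 x).
    have Gx : G x = gY x by rewrite /G; case: asboolP => // -[].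
    have gfx : gY x = f x by rewrite gYE; [rewrite /g0; case: asboolP|left].
    move=> V; rewrite Gx => gV; have fV := gV; rewrite gfx in fV.
    apply: filterS2 (cgY _ Ux _ gV) (Psi_limit A1x fV) => y h1 h2.
    rewrite /G; case: asboolP => // -[A1y ty].
    by have [] := h2 A1y (tW2 A1y ty).
  have [tx|tx|tx] := ltgtP (t x) 2^-1; first exact: inU1.
    apply: (@cts_at_eq _ _ _ gY); last exact: cgY.
    have : \forall y \near x, 2^-1 < t y by exact: (cts_at_gt (t_cts A1x)).
    apply: filterS => y ty; rewrite /G; case: asboolP => // -[_].
    by rewrite leNgt ty.
  have rx : 2^-1 < cnorm (v' x).
    by rewrite ltNge; apply/negP => h; apply: Bx; split.
  have Wx : W x by apply: tW2 => //; lra.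
  have gx : gY x = Psi x.
    rewrite gYE; last by right; split=> //; exact: ltW.
    by rewrite /g0; case: asboolP.
  have Gx : G x = Psi x by rewrite /G; case: asboolP.
  move=> V; rewrite Gx => PV; have gV := PV; rewrite -gx in gV.
  apply: filterS2 (cgY _ Ux _ gV) (Psi_cts A1x Wx PV) => y h1 h2.
  by rewrite /G; case: asboolP.
- move=> x Ux; rewrite /G; case: asboolP => [[A1x tx]|nx].
    by apply: Psi_skel => //; exact: tW2.
  have UYx : UY x.
    by case: Ux => [[A1x tx]|[]//]; exfalso; apply: nx; split=> //; exact: ltW.
  have [e /= h1 h2] := gYs _ UYx.
  by exists e => //=; exact: ltnW.
- move=> x Ax; have [A1x|A1x] := pselect (A1 x).
    rewrite /G; case: asboolP => [[]//|_]; rewrite gYE; last by left.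
    by rewrite /g0; case: asboolP.
  have Ox := A_O Ax A1x.
  rewrite /G tO//; case: asboolP => [_|[]]; last by split=> //; rewrite invr_ge0.
  rewrite /Psi /tau tO// mulr0 clamp01_id ?lexx ?ler01// push_out0 v'E//.
  have [_ <-] := vP Ox; congr (Phi _ _).
  have [r [e h]] := good_ex Ox; rewrite (beE h)// (dist_refl dX).
  by case: h => _ /andP[].
Qed.

End Step.

Section OpenFun.
Variables (R : realType) (X : topologicalType) (f : X -> R) (c : R).
Hypothesis cf : continuous f.

Lemma open_lt_fun : open [set x | f x < c].
Proof. by rewrite openE => x; exact: (cts_at_lt (@cf x)). Qed.

Lemma open_gt_fun : open [set x | c < f x].
Proof. by rewrite openE => x; exact: (cts_at_gt (@cf x)). Qed.

Lemma closed_le_fun : closed [set x | f x <= c].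
Proof.
rewrite -openC (_ : ~` _ = [set x | c < f x]); first exact: open_gt_fun.
by apply/seteqP; split=> x /=; rewrite ltNge => /negP.
Qed.

Lemma closed_ge_fun : closed [set x | c <= f x].
Proof.
rewrite -openC (_ : ~` _ = [set x | f x < c]); first exact: open_lt_fun.
by apply/seteqP; split=> x /=; rewrite ltNge => /negP.
Qed.

End OpenFun.

Lemma closed_nbhd (R : realType) (X : topologicalType) (d : X -> X -> R) (T M : set X) :
  dist_for d -> closed T -> open M -> T `<=` M ->
  exists N V, [/\ closed N, open V, T `<=` V, V `<=` N & N `<=` M].
Proof.
move=> dX cT oM TM.
have dis : T `&` ~` M = set0 by apply/seteqP; split=> // x [/TM].
have cM : closed (~` M) by exact: open_closedC.
have sc := sep_continuous dX cT cM dis.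
exists [set x | sep d T (~` M) x <= 2^-1], [set x | sep d T (~` M) x < 2^-1].
split.
- exact: closed_le_fun.
- exact: open_lt_fun.
- by move=> x Tx /=; rewrite (sep0 dX)// invr_gt0.
- by move=> x /= /ltW.
- move=> x /= h; apply: contrapT => Mx; move: h; rewrite (sep1 dX)//.
    by rewrite leNgt invf_lt1 ?ltr0n// ltr1n.
  apply: (distset_gt0 dX) => // Tx.
  by have : (T `&` ~` M) x by []; rewrite dis.
Qed.

Lemma distsetS (R : realType) (X : topologicalType) (d : X -> X -> R) (A B : set X) x :
  dist_for d -> A `<=` B -> distset d B x <= distset d A x.
Proof.
move=> dX AB; rewrite leNgt; apply/negP => h.
have [a Aa] := distset_lt dX h (distset_le1 dX B x).
by rewrite ltNge (distset_le dX _ (AB _ Aa)).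
Qed.

(** * From the skeleta to the whole complex *)

Section NEK.
Variables (R : realType) (K : topologicalType) (cw : cw_structure R K).
Hypothesis hK : hausdorff_space K.

Lemma nbhd_ext_skel n : nbhd_ext R (skel cw n).
Proof.
elim: n => [|n IH].
  move=> X d dX A f cA fA Af; have A0 : A = set0.
    by apply/seteqP; split=> // x /Af [].
  by rewrite A0; exists set0, f; split => //; exact: open0.
by move=> X d dX A f cA fA Af; exact: (nbhd_ext_step hK IH dX cA fA Af).
Qed.

Lemma skelS m n : (m <= n)%N -> skel cw m `<=` skel cw n.
Proof. by move=> mn y [e em ey]; exists e => //; exact: leq_trans mn. Qed.

Section Union.
Variables (X : topologicalType) (d : X -> X -> R) (A : set X) (f : X -> K).
Hypotheses (dX : dist_for d) (cA : closed A) (fA : forall x, A x -> cts_in A f x).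

(** The points where [f] is not locally in [skel n]. These closed sets decrease, and local
    finiteness of the image makes every point of [A] leave them at some rank. *)
Let N n := [set a | A a /\ ~ \forall y \near a, A y -> skel cw n (f y)].

Let cN n : closed (N n).
Proof.
rewrite -openC openE => x nx.
have [Ax|Ax] := pselect (A x); last first.
  have : nbhs x (~` A) by apply: open_nbhs_nbhs; split=> //; exact: closed_openC.
  by apply: filterS => y Ay [].
have /nbhs_interior : \forall y \near x, A y -> skel cw n (f y).
  by apply: contrapT => h; apply: nx.
by apply: filterS => y hy [_].
Qed.

Let NS m n : (m <= n)%N -> N n `<=` N m.
Proof.
move=> mn a [Aa h]; split=> // h2; apply: h; apply: filterS h2 => y h Ay.
by apply: skelS mn _ _; exact: h.
Qed.

Let N_ex a : A a -> exists n, ~ N n a.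
Proof.
move=> Aa; have [F fF hF] := locally_finite_image cw hK dX Aa (fA Aa).
suff [n hn] : exists n, forall e, F e -> (cw_dim e < n)%N.
  exists n => -[_ []]; apply: filterS hF => y h Ay.
  by apply/skel_cell; apply: hn; exact: h.
have [s Fs] := (@finite_seqP {classic (cw_cell cw)} F).1 fF.
exists (\max_(e <- s) cw_dim e).+1 => e; rewrite Fs => es.
by rewrite ltnS (@leq_bigmax_seq {classic (cw_cell cw)}).
Qed.

(** The closed sets [C n] exhaust [A], and the open set [E n] separates each from the rest: [C n]
    lies in [E n], whose trace on [A] lies in [C n.+1]. The decreasing thresholds leave the room for
    this. *)
Let C n := [set a | A a /\ n.+1%:R^-1 <= distset d (N n) a].
Let E n := [set a | n.+2%:R^-1 < distset d (N n) a].

Let cC n : closed (C n).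
Proof.
apply: closedI => //.
by apply: closed_ge_fun; exact: (distset_continuous dX).
Qed.

Let oE n : open (E n).
Proof.
by apply: open_gt_fun; exact: (distset_continuous dX).
Qed.

Let CE n : C n `<=` E n.
Proof.
move=> a [_ h]; apply: lt_le_trans h.
by rewrite ltf_pV2 ?posrE ?ltr0n// ltr_nat.
Qed.

Let EC n : E n `&` A `<=` C n.+1.
Proof.
move=> a [h Aa]; split=> //; apply: ltW; apply: lt_le_trans h _.
by apply: distsetS => //; apply: NS.
Qed.

Let Cskel n a : C n a -> skel cw n (f a).
Proof.
move=> [Aa h]; have : ~ N n a.
  by move=> /(distset0 dX) h2; rewrite h2 invr_le0 lern0 in h.
move=> h2; have : \forall y \near a, A y -> skel cw n (f y).
  by apply: contrapT => h3; apply: h2.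
by move=> /nbhs_singleton; exact.
Qed.

Let C_ex a : A a -> exists n, C n a.
Proof.
move=> Aa; have [m hm] := N_ex Aa.
have d0 := distset_gt0 dX (@cN m) hm.
have /archi_boundP h : 0 <= (distset d (N m) a)^-1 by rewrite invr_ge0 ltW.
pose k := maxn m (Num.bound (distset d (N m) a)^-1).
exists k; split=> //.
apply: (@le_trans _ _ (distset d (N m) a)); last first.
  by apply: distsetS => //; apply: NS; exact: leq_maxl.
rewrite invf_ple ?posrE ?ltr0n//; apply: ltW; apply: (lt_le_trans h).
by rewrite ler_nat (leq_trans (leq_maxr m _)).
Qed.

Let stage n (p : set X * (X -> K)) := [/\ closed p.1, p.1 `&` A `<=` C n,
  forall x, p.1 x -> cts_in p.1 p.2 x, forall x, p.1 x -> skel cw n (p.2 x) &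
  forall x, A x -> p.1 x -> p.2 x = f x].

(** The map is glued with [f] on [C n.+1], extended in the skeleton, and restricted to a closed
    neighbourhood that meets [A] only inside [E n]. This keeps the trace on [A] within [C n.+1],
    where [f] takes values in the right skeleton. *)
Let stage_next n p : stage n p -> exists q, stage n.+1 q /\
  [/\ p.1 `<=` (q.1)°, C n `<=` (q.1)° & forall x, p.1 x -> q.2 x = p.2 x].
Proof.
case: p => M F [/= cM MA FM Fs Ff].
pose T := M `|` C n.+1.
pose h x := if `[< M x >] then F x else f x.
have hM x : M x -> h x = F x by move=> Mx; rewrite /h; case: asboolP.
have hf x : A x -> h x = f x.
  by move=> Ax; rewrite /h; case: asboolP => // Mx; exact: Ff.
have cT : closed T by exact: closedU.
have hT x : T x -> cts_in T h x.
  move=> Tx; apply: cts_inU.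
    have [Mx|Mx] := pselect (M x).
      apply: cts_in_eq (FM _ Mx); first exact: hM.
      by apply: nearW => y; exact: hM.
    move=> V _; have : nbhs x (~` M) by apply: open_nbhs_nbhs; split=> //; exact: closed_openC.
    by apply: filterS => y My /My.
  have [Cx|Cx] := pselect (C n.+1 x).
    have [Ax _] := Cx.
    apply: (@cts_in_sub _ _ _ A); first by move=> y [].
    by apply: cts_in_eq (fA Ax); [exact: hf|apply: nearW => y; exact: hf].
  move=> V _; have : nbhs x (~` C n.+1).
    by apply: open_nbhs_nbhs; split=> //; exact: closed_openC.
  by apply: filterS => y My /My.
have hs x : T x -> skel cw n.+1 (h x).
  move=> [Mx|Cx]; first by rewrite hM//; apply: skelS (leqnSn n) _ _; exact: Fs.
  by rewrite hf; [exact: Cskel|case: Cx].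
have [U [F' [oU TU cF' F's F'h]]] := @nbhd_ext_skel n.+1 X d dX T h cT hT hs.
have CC : C n `<=` C n.+1.
  by move=> x Cx; apply: EC; split; [exact: CE|case: Cx].
have [|||N' [V [cN' oV TV VN NU]]] := @closed_nbhd R X d (M `|` C n)
    (U `&` (~` A `|` E n)) dX.
- exact: closedU.
- by apply: openI => //; apply: openU => //; exact: closed_openC.
- move=> x [Mx|Cx]; split.
  + by apply: TU; left.
  + by have [Ax|] := pselect (A x); [right; apply/CE/MA|left].
  + by apply: TU; right; exact: CC.
  + by right; exact: CE.
have Vint : V `<=` N'° by rewrite -open_subsetE.
exists (N', F'); split; last first.
  split=> /= x; first by move=> Mx; apply: Vint; apply: TV; left.
    by move=> Mx; apply: Vint; apply: TV; right.
  by move=> Mx; rewrite F'h ?hM//; left.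
split=> //=.
- move=> x [Nx Ax]; apply: EC; split=> //.
  by have [_ []] := NU _ Nx.
- by move=> x Nx; apply/cts_at_in/cF'; have [] := NU _ Nx.
- by move=> x Nx; apply: F's; have [] := NU _ Nx.
- move=> x Ax Nx; have [_ [//|Ex]] := NU _ Nx.
  by rewrite F'h ?hf//; right; apply: EC.
Qed.

Let stage0 : stage 0 (set0, f).
Proof.
by split=> /=; [exact: closed0|move=> x []|move=> x []|move=> x []|].
Qed.

Let nxt n (p : {p | stage n p}) : {p | stage n.+1 p} :=
  exist _ (sval (cid (stage_next (svalP p)))) (svalP (cid (stage_next (svalP p)))).1.

Let stages n := nat_rect (fun n => {p | stage n p}) (exist _ (set0, f) stage0) nxt n.

Let M n := (sval (stages n)).1.
Let F n := (sval (stages n)).2.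

Let stageP n : stage n (M n, F n).
Proof. by have := svalP (stages n); rewrite /M /F; case: (sval _). Qed.

Let stageS n : [/\ M n `<=` (M n.+1)°, C n `<=` (M n.+1)° &
  forall x, M n x -> F n.+1 x = F n x].
Proof. exact: (svalP (cid (stage_next (svalP (stages n))))).2. Qed.

Let MS m n : (m <= n)%N -> M m `<=` M n /\ forall x, M m x -> F n x = F m x.
Proof.
elim: n => [|n IH]; first by rewrite leqn0 => /eqP ->; split=> [x|].
rewrite leq_eqVlt => /predU1P[->|]; first by split=> [x|].
rewrite ltnS => /IH [h1 h2].
have [h3 _ h4] := stageS n; split=> x Mx.
  by apply: interior_subset; apply: h3; exact: h1.
by rewrite h4 ?h2//; exact: h1.
Qed.

Lemma nbhd_ext_union : exists (U : set X) (G : X -> K), [/\ open U, A `<=` U,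
  forall x, U x -> cts_at G x & forall x, A x -> G x = f x].
Proof.
pose G x := if pselect (exists n, M n x) is left h then F (projT1 (cid h)) x else f x.
have GE n x : M n x -> G x = F n x.
  move=> Mx; rewrite /G; case: pselect => [h|[]]; last by exists n.
  case: (cid h) => k /= Mk; have [kn|nk] := leqP k n.
    by have [_ ->] := MS kn.
  by have [_ ->] := MS (ltnW nk).
exists (\bigcup_n (M n)°), G; split.
- by apply: bigcup_open => n _; exact: open_interior.
- move=> a Aa; have [n Cn] := C_ex Aa; exists n.+1 => //.
  by have [_ h _] := stageS n; exact: h.
- move=> x [n _ Mx]; have [_ _ h _ _] := stageP n.
  apply: (@cts_at_eq _ _ _ (F n)).
    by apply: filterS Mx => y; exact: GE.
  by apply: (cts_in_at Mx); apply: h; exact: nbhs_singleton.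
- move=> a Aa; have [n Cn] := C_ex Aa.
  have [_ h _] := stageS n; have Ma := interior_subset (h _ Cn).
  rewrite (GE n.+1)//; have [_ _ _ _ hf] := stageP n.+1.
  exact: hf.
Qed.

End Union.

Theorem cw_nbhd_ext (X : topologicalType) (d : X -> X -> R) (A : set X) (f : X -> K) :
  dist_for d -> closed A -> (forall x, A x -> cts_in A f x) ->
  exists (U : set X) (F : X -> K), [/\ open U, A `<=` U,
    forall x, U x -> cts_at F x & forall x, A x -> F x = f x].
Proof. by move=> dX cA fA; exact: nbhd_ext_union dX cA fA. Qed.

End NEK.

(** * Curves up to homotopy *)

Section ContReal.
Variables (R : realType) (X : topologicalType).
Implicit Types f g : X -> R.

Lemma contC (c : R) : continuous (fun _ : X => c).
Proof. by move=> x; exact: cvg_cst. Qed.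
Lemma contD f g : continuous f -> continuous g -> continuous (fun x => f x + g x).
Proof. by move=> cf cg x; apply: cvgD; [exact: cf|exact: cg]. Qed.
Lemma contN f : continuous f -> continuous (fun x => - f x).
Proof. by move=> cf x; apply: cvgN; exact: cf. Qed.
Lemma contM f g : continuous f -> continuous g -> continuous (fun x => f x * g x).
Proof. by move=> cf cg x; apply: cvgM; [exact: cf|exact: cg]. Qed.
Lemma cont_max f g : continuous f -> continuous g -> continuous (fun x => Num.max (f x) (g x)).
Proof. by move=> cf cg x; apply: continuous_max; [exact: cf|exact: cg]. Qed.
Lemma cont_min f g : continuous f -> continuous g -> continuous (fun x => Num.min (f x) (g x)).
Proof. by move=> cf cg x; apply: continuous_min; [exact: cf|exact: cg]. Qed.
Lemma cont_clamp f : continuous f -> continuous (fun x => clamp01 (f x)).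
Proof. by move=> cf x; apply: continuous_comp; [exact: cf|exact: clamp01_continuous]. Qed.
End ContReal.

Lemma cont_id (X : topologicalType) : continuous (fun x : X => x).
Proof. by move=> x; exact: cvg_id. Qed.
Lemma cont_fst (X Y : topologicalType) : continuous (fun x : X * Y => x.1).
Proof. by move=> x; exact: cvg_fst. Qed.
Lemma cont_snd (X Y : topologicalType) : continuous (fun x : X * Y => x.2).
Proof. by move=> x; exact: cvg_snd. Qed.
Lemma cont_comp (X Y Z : topologicalType) (f : X -> Y) (g : Y -> Z) :
  continuous f -> continuous g -> continuous (fun x => g (f x)).
Proof. by move=> cf cg x; apply: continuous_comp; [exact: cf|exact: cg]. Qed.
Lemma cont_pair (X Y Z : topologicalType) (f : X -> Y) (g : X -> Z) :
  continuous f -> continuous g -> continuous (fun x => (f x, g x)).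
Proof. by move=> cf cg x; apply: cvg_pair; [exact: cf|exact: cg]. Qed.

Ltac rcont := lazymatch goal with
  | |- forall x, continuous_at x (fun y => @?f y + @?g y) =>
      apply: (contD (f := f) (g := g)); rcont
  | |- forall x, continuous_at x (fun y => @?f y * @?g y) =>
      apply: (contM (f := f) (g := g)); rcont
  | |- forall x, continuous_at x (fun y => - @?f y) => apply: (contN (f := f)); rcont
  | |- forall x, continuous_at x (fun y => Num.max (@?f y) (@?g y)) =>
      apply: (cont_max (f := f) (g := g)); rcont
  | |- forall x, continuous_at x (fun y => Num.min (@?f y) (@?g y)) =>
      apply: (cont_min (f := f) (g := g)); rcont
  | |- forall x, continuous_at x (fun y => clamp01 (@?f y)) =>
      apply: (cont_clamp (f := f)); rcont
  | |- forall x, continuous_at x (fun y => y) => exact: cont_id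
  | |- forall x, continuous_at x (fun y => fst y) => exact: cont_fst
  | |- forall x, continuous_at x (fun y => snd y) => exact: cont_snd
  | |- forall x, continuous_at x (fun _ => ?c) => exact: contC
  | |- _ => first [assumption | exact: cont_fst | exact: cont_snd | exact: cont_id | idtac]
  end.

Lemma glue (R : realType) (X K : topologicalType) (f g : X -> K) (h : X -> R) c :
  continuous f -> continuous g -> continuous h ->
  (forall x, h x = c -> f x = g x) ->
  continuous (fun x => if h x <= c then f x else g x).
Proof.
move=> cf cg ch fg x; change (cts_at (fun x => if h x <= c then f x else g x) x).
have [hx|hx|hx] := ltgtP (h x) c.
- apply: (@cts_at_eq _ _ _ f); last exact: cf.
  by apply: filterS (cts_at_lt (@ch x) hx) => y /ltW ->.
- apply: (@cts_at_eq _ _ _ g); last exact: cg.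
  by apply: filterS (cts_at_gt (@ch x) hx) => y; rewrite ltNge => /negbTE ->.
- move=> V; rewrite hx lexx => fV; have gV := fV; rewrite (fg x hx) in gV.
  have h1 : \forall y \near x, V (f y) := cf x _ fV.
  have h2 : \forall y \near x, V (g y) := cg x _ gV.
  by apply: filterS2 h1 h2 => y h1 h2 /=; case: ifP.
Qed.

Section Paths.
Variables (R : realType) (K : topologicalType).

(** Curves are total on [R], so that continuity involves no subspace; [peq] compares them on [0, 1]
    only. *)
Record curve (x y : K) := Curve {
  curve_fun :> R -> K;
  curve_cont : continuous curve_fun;
  curve0 : curve_fun 0 = x;
  curve1 : curve_fun 1 = y }.

Definition peq x y (p q : curve x y) := exists H : R * R -> K,
  [/\ continuous H, forall t, 0 <= t <= 1 -> H (0, t) = p t,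
      forall t, 0 <= t <= 1 -> H (1, t) = q t &
      forall s, 0 <= s <= 1 -> H (s, 0) = x /\ H (s, 1) = y].

(** [D] is composed with the straight homotopy between two plane paths with common ends. The
    reparametrisations and the triangle relation below are instances. *)
Lemma square_peq x y (p q : curve x y) (D : R * R -> K) (a1 a2 b1 b2 : R -> R) :
  continuous D -> continuous a1 -> continuous a2 -> continuous b1 -> continuous b2 ->
  a1 0 = b1 0 -> a2 0 = b2 0 -> a1 1 = b1 1 -> a2 1 = b2 1 ->
  (forall t, 0 <= t <= 1 -> D (a1 t, a2 t) = p t) ->
  (forall t, 0 <= t <= 1 -> D (b1 t, b2 t) = q t) -> peq p q.
Proof.
move=> cD ca1 ca2 cb1 cb2 e10 e20 e11 e21 hp hq.
exists (fun st => D ((1 - st.1) * a1 st.2 + st.1 * b1 st.2,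
                     (1 - st.1) * a2 st.2 + st.1 * b2 st.2)); split.
- apply: (@cont_comp _ _ _ (fun st : R * R => ((1 - st.1) * a1 st.2 + st.1 * b1 st.2,
                     (1 - st.1) * a2 st.2 + st.1 * b2 st.2)) D) => //.
  by apply: cont_pair; rcont; apply: cont_comp => //; exact: cont_snd.
- by move=> t t01 /=; rewrite subr0 !mul1r !mul0r !addr0 hp.
- by move=> t t01 /=; rewrite subrr !mul1r !mul0r !add0r hq.
- have e (s u : R) : (1 - s) * u + s * u = u by ring.
  move=> s _ /=; rewrite e10 e20 e11 e21 !e -e10 -e20 -e11 -e21.
  by rewrite !hp ?lexx ?ler01// curve0 curve1.
Qed.

Lemma repar_peq x y (p q : curve x y) (D : R -> K) (a b : R -> R) :
  continuous D -> continuous a -> continuous b -> a 0 = b 0 -> a 1 = b 1 ->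
  (forall t, 0 <= t <= 1 -> D (a t) = p t) ->
  (forall t, 0 <= t <= 1 -> D (b t) = q t) -> peq p q.
Proof.
move=> cD ca cb e0 e1 hp hq.
apply: (@square_peq _ _ p q (fun z => D z.1) a (cst 0) b (cst 0)) => //.
- by apply: cont_comp => //; exact: cont_fst.
- exact: contC.
- exact: contC.
Qed.

Lemma peq_ext x y (p q : curve x y) : (forall t, 0 <= t <= 1 -> p t = q t) -> peq p q.
Proof.
move=> h; apply: (@repar_peq _ _ p q p id id) => //; try exact: cont_id.
  exact: curve_cont.
Qed.

Lemma peq_refl x y (p : curve x y) : peq p p.
Proof. exact: peq_ext. Qed.

Lemma peq_sym x y (p q : curve x y) : peq p q -> peq q p.
Proof.
move=> [H [cH h0 h1 hb]]; exists (fun st => H (1 - st.1, st.2)); split.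
- apply: (@cont_comp _ _ _ (fun st : R * R => (1 - st.1, st.2)) H) => //.
  by apply: cont_pair; rcont.
- by move=> t t01 /=; rewrite subr0 h1.
- by move=> t t01 /=; rewrite subrr h0.
- by move=> s s01 /=; apply: hb; lra.
Qed.

Lemma peq_trans x y (p q r : curve x y) : peq p q -> peq q r -> peq p r.
Proof.
move=> [H [cH h0 h1 hb]] [I [cI i0 i1 ib]].
exists (fun st => if st.1 <= 2^-1 then H (2 * st.1, clamp01 st.2)
  else I (2 * st.1 - 1, clamp01 st.2)); split.
- apply: (@glue R (R * R)%type K (fun st => H (2 * st.1, clamp01 st.2))
    (fun st => I (2 * st.1 - 1, clamp01 st.2)) (fun st => st.1)).
  + apply: (@cont_comp _ _ _ (fun st : R * R => (2 * st.1, clamp01 st.2)) H) => //.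
    by apply: cont_pair; rcont.
  + apply: (@cont_comp _ _ _ (fun st : R * R => (2 * st.1 - 1, clamp01 st.2)) I) => //.
    by apply: cont_pair; rcont.
  + exact: cont_fst.
  + move=> [s t] /= ->; rewrite divff ?pnatr_eq0// subrr h1 ?i0//; exact: clamp01_itv.
- by move=> t t01 /=; rewrite invr_ge0 ler0n mulr0 clamp01_id// h0.
- move=> t t01 /=; rewrite leNgt invf_lt1 ?ltr0n// ltr1n /= mulr1.
  by rewrite (_ : 2 - 1 = 1) ?clamp01_id ?i1//; lra.
- move=> s s01 /=; rewrite !clamp01_id ?lexx ?ler01//.
  by case: ifP => h; [apply: hb|apply: ib]; lra.
Qed.

Definition pid x : curve x x := @Curve x x (fun=> x) (fun t => cvg_cst x) erefl erefl.

Definition pinv_fun x y (p : curve x y) (t : R) := p (1 - t).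
Lemma pinv_cont x y (p : curve x y) : continuous (pinv_fun p).
Proof. by apply: cont_comp; [rcont|exact: curve_cont]. Qed.
Lemma pinv0 x y (p : curve x y) : pinv_fun p 0 = y.
Proof. by rewrite /pinv_fun subr0 curve1. Qed.
Lemma pinv1 x y (p : curve x y) : pinv_fun p 1 = x.
Proof. by rewrite /pinv_fun subrr curve0. Qed.
Definition pinv x y (p : curve x y) : curve y x :=
  @Curve y x (pinv_fun p) (@pinv_cont x y p) (pinv0 p) (pinv1 p).

Definition pcat_fun x y z (p : curve x y) (q : curve y z) (t : R) :=
  if t <= 2^-1 then p (2 * t) else q (2 * t - 1).
Lemma pcat_cont x y z (p : curve x y) (q : curve y z) : continuous (pcat_fun p q).
Proof.
apply: glue.
- by apply: (@cont_comp _ _ _ (fun t : R => 2 * t) p); [rcont|exact: curve_cont].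
- by apply: (@cont_comp _ _ _ (fun t : R => 2 * t - 1) q); [rcont|exact: curve_cont].
- exact: cont_id.
- by move=> t ->; rewrite divff ?pnatr_eq0// subrr curve0 curve1.
Qed.
Lemma pcat0 x y z (p : curve x y) (q : curve y z) : pcat_fun p q 0 = x.
Proof. by rewrite /pcat_fun invr_ge0 ler0n mulr0 curve0. Qed.
Lemma pcat1 x y z (p : curve x y) (q : curve y z) : pcat_fun p q 1 = z.
Proof.
rewrite /pcat_fun leNgt invf_lt1 ?ltr0n// ltr1n /= mulr1.
by rewrite (_ : 2 - 1 = 1) ?curve1//; lra.
Qed.
Definition pcat x y z (p : curve x y) (q : curve y z) : curve x z :=
  @Curve x z (pcat_fun p q) (@pcat_cont x y z p q) (pcat0 p q) (pcat1 p q).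

Lemma peq_cat x y z (p p' : curve x y) (q q' : curve y z) :
  peq p p' -> peq q q' -> peq (pcat p q) (pcat p' q').
Proof.
move=> [H [cH h0 h1 hb]] [I [cI i0 i1 ib]].
exists (fun st => if st.2 <= 2^-1 then H (clamp01 st.1, 2 * st.2)
  else I (clamp01 st.1, 2 * st.2 - 1)); split.
- apply: (@glue R (R * R)%type K (fun st => H (clamp01 st.1, 2 * st.2))
    (fun st => I (clamp01 st.1, 2 * st.2 - 1)) (fun st => st.2)).
  + apply: (@cont_comp _ _ _ (fun st : R * R => (clamp01 st.1, 2 * st.2)) H) => //.
    by apply: cont_pair; rcont.
  + apply: (@cont_comp _ _ _ (fun st : R * R => (clamp01 st.1, 2 * st.2 - 1)) I) => //.
    by apply: cont_pair; rcont.
  + exact: cont_snd.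
  + move=> [s t] /= ->; rewrite divff ?pnatr_eq0// subrr.
    have [_ ->] := hb (clamp01 s) (clamp01_itv s).
    by have [-> _] := ib (clamp01 s) (clamp01_itv s).
- move=> t t01 /=; rewrite clamp01_id ?lexx ?ler01// /pcat_fun.
  by case: leP => h; [apply: h0|apply: i0]; lra.
- move=> t t01 /=; rewrite clamp01_id ?lexx ?ler01// /pcat_fun.
  by case: leP => h; [apply: h1|apply: i1]; lra.
- move=> s s01 /=; rewrite invr_ge0 ler0n mulr0.
  rewrite leNgt invf_lt1 ?ltr0n// ltr1n /= mulr1 (_ : 2 - 1 = 1); last lra.
  by have [-> _] := hb _ (clamp01_itv s); have [_ ->] := ib _ (clamp01_itv s).
Qed.

Lemma pcatA x y z w (p : curve x y) (q : curve y z) (r : curve z w) :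
  peq (pcat (pcat p q) r) (pcat p (pcat q r)).
Proof.
(* The piecewise linear map sending 1/4 to 1/2 and 1/2 to 3/4: it carries the break points of the
   left bracketing to those of the right one. *)
apply: (@repar_peq _ _ _ _ (pcat p (pcat q r))
  (fun t => Num.min (2 * t) (Num.min (t + 4^-1) ((t + 1) / 2))) id).
- exact: curve_cont.
- by rcont.
- exact: cont_id.
- by rewrite mulr0 !minElt; do ![case: ifP => //]; lra.
- by rewrite !minElt; do ![case: ifP]; lra.
- move=> t t01 /=; rewrite /pcat_fun /=.
  have [h1|h1] := leP t 2^-1.
    have [h2|h2] := leP (2 * t) 2^-1.
      rewrite min_l; last by rewrite le_min; apply/andP; split; lra.
      by rewrite h2 /pcat_fun; case: leP => // ?; exfalso; lra.
    rewrite min_r; last by rewrite ge_min; apply/orP; left; lra.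
    rewrite min_l; last lra.
    case: leP => h3; first by exfalso; lra.
    rewrite /pcat_fun; case: leP => h4; last by exfalso; lra.
    by case: leP => h5; [exfalso; lra|congr (q _); lra].
  rewrite min_r; last by rewrite ge_min; apply/orP; left; lra.
  rewrite min_r; last lra.
  case: leP => h3; first by exfalso; lra.
  rewrite /pcat_fun; case: leP => h4; first by exfalso; lra.
  by congr (r _); lra.
- by [].
Qed.

Lemma pcat1p x y (p : curve x y) : peq (pcat (pid x) p) p.
Proof.
apply: (@repar_peq _ _ _ _ p (fun t => Num.max 0 (2 * t - 1)) id).
- exact: curve_cont.
- by rcont.
- exact: cont_id.
- by rewrite maxElt; case: ifP => //; lra.
- by rewrite maxElt; case: ifP => //; lra.
- move=> t t01 /=; rewrite /pcat_fun /=; case: leP => h.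
    by rewrite max_l ?curve0//; lra.
  by rewrite max_r//; lra.
- by [].
Qed.

Lemma pcatp1 x y (p : curve x y) : peq (pcat p (pid y)) p.
Proof.
apply: (@repar_peq _ _ _ _ p (fun t => Num.min 1 (2 * t)) id).
- exact: curve_cont.
- by rcont.
- exact: cont_id.
- by rewrite minElt; case: ifP => //; lra.
- by rewrite minElt; case: ifP => //; lra.
- move=> t t01 /=; rewrite /pcat_fun /=; case: leP => h.
    by rewrite min_r//; lra.
  by rewrite min_l ?curve1//; lra.
- by [].
Qed.

Lemma pcatpV x y (p : curve x y) : peq (pcat p (pinv p)) (pid x).
Proof.
apply: (@repar_peq _ _ _ _ p (fun t => Num.min (2 * t) (2 - 2 * t)) (fun=> 0)).
- exact: curve_cont.
- by rcont.
- by rcont.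
- by rewrite minElt; case: ifP => //; lra.
- by rewrite minElt; case: ifP => //; lra.
- move=> t t01 /=; rewrite /pcat_fun /= /pinv_fun; case: leP => h.
    by rewrite min_l//; lra.
  by rewrite min_r; [congr (p _); lra|lra].
- by move=> t _; rewrite curve0.
Qed.

Lemma pinvK x y (p : curve x y) : peq (pinv (pinv p)) p.
Proof.
apply: peq_ext => t _ /=; rewrite /pinv_fun /= /pinv_fun; congr (p _); lra.
Qed.

Lemma pcatVp x y (p : curve x y) : peq (pcat (pinv p) p) (pid y).
Proof.
apply: peq_trans (pcatpV (pinv p)).
by apply: peq_cat; [exact: peq_refl|apply: peq_sym; exact: pinvK].
Qed.

(* [D] matters on the triangle with vertices (0, 0), (1, 0) and (0, 1) only. *)
Lemma triangle_peq x y z (p : curve x y) (q : curve y z) (r : curve x z) (D : R * R -> K) :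
  continuous D -> (forall t, 0 <= t <= 1 -> D (t, 0) = p t) ->
  (forall t, 0 <= t <= 1 -> D (1 - t, t) = q t) ->
  (forall t, 0 <= t <= 1 -> D (0, t) = r t) -> peq (pcat p q) r.
Proof.
move=> cD hp hq hr.
apply: (@square_peq _ _ _ _ D (fun t => Num.min (2 * t) (2 - 2 * t))
  (fun t => Num.max 0 (2 * t - 1)) (fun=> 0) id) => //; try by rcont.
- by rewrite minElt; case: ifP => //; lra.
- by rewrite maxElt; case: ifP => //; lra.
- by rewrite minElt; case: ifP => //; lra.
- by rewrite maxElt; case: ifP => //; lra.
- move=> t t01 /=; rewrite /pcat_fun; case: leP => h.
    rewrite min_l; last lra.
    by rewrite max_l ?hp//; lra.
  rewrite min_r; last lra.
  rewrite max_r; last lra.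
  by rewrite -hq; [congr (D (_, _)); lra|lra].
Qed.

End Paths.

(** * Holonomy *)

Lemma cont_pair_at (X Y Z : topologicalType) (f : X -> Y) (g : X -> Z) x :
  cts_at f x -> cts_at g x -> cts_at (fun x => (f x, g x)) x.
Proof. by move=> cf cg; apply: cvg_pair; [exact: cf|exact: cg]. Qed.

(* The square [H] is collapsed to a triangle along its two constant sides. *)
Lemma triangle_fill (R : realType) (K : topologicalType) (x y z : K)
    (p : curve R x y) (q : curve R y z) (r : curve R x z) : peq (pcat p q) r ->
  exists D : R * R -> K, [/\ continuous D,
    forall t, 0 <= t <= 1 -> D (t, 0) = p t,
    forall t, 0 <= t <= 1 -> D (1 - t, t) = q t &
    forall t, 0 <= t <= 1 -> D (0, t) = r t].
Proof.
move=> [H [cH h0 h1 hb]].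
(* [(b, c)] retracts the plane to the triangle. On the line [c + b / 2 = tau] of the triangle, [b]
   runs from 0 to [m], and [s] rescales it: 1 on the side [b = 0], and 0 on the two others. *)
pose b (w : R * R) := clamp01 w.1.
pose c (w : R * R) := Num.min (Num.max 0 w.2) (1 - b w).
pose tau w := c w + b w / 2.
pose m w := Num.min (2 * tau w) (2 - 2 * tau w).
pose s w := clamp01 (1 - b w / m w).
have cb : continuous b by rewrite /b; rcont.
have cc : continuous c by rewrite /c; rcont.
have ct : continuous tau by rewrite /tau; rcont.
have cm : continuous m by rewrite /m; rcont.
have b01 w : 0 <= b w <= 1 by exact: clamp01_itv.
have c01 w : 0 <= c w <= 1 - b w.
  have /andP[b0 b1] := b01 w.
  by rewrite /c le_min le_max lexx ge_min lexx orbT subr_ge0 b1.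
have t01 w : 0 <= tau w <= 1.
  by have := b01 w; have := c01 w; rewrite /tau; lra.
(* Where [m] vanishes [s] may jump, but there [tau] is 0 or 1. Compactness of the segment makes [H]
   close to a constant near these two sides, uniformly in [s]. *)
have ends (e : R) V : e = 0 \/ e = 1 -> nbhs (H (0, e)) V ->
    \forall t \near e, `[0%R, 1%R]%classic `<=` [set s | V (H (s, t))].
  move=> he hV.
  apply: ((compact_near_coveringP _).1 (@segment_compact R 0 1) R (nbhs e)
    (fun t s => V (H (s, t)))) => u.
  rewrite /= in_itv /= => u01; suff hv : nbhs (H (u, e)) V.
    have [[A B] hAB AB] := cH (u, e) V hv.
    by exists (A, B) => // -[a' b'] h; exact: (AB (a', b') h).
  have [a0 a1] := hb u u01; have [c0 c1] := hb 0 ltac:(lra).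
  by case: he hV => ->; rewrite ?a0 ?c0 ?a1 ?c1.
exists (fun w => H (s w, tau w)); split.
- move=> w; change (cts_at (fun w => H (s w, tau w)) w).
  have [m0|m0] := eqVneq (m w) 0; last first.
    have sc : {for w, continuous s}.
      apply: continuous_comp; last exact: clamp01_continuous.
      apply: cvgB; first exact: cvg_cst.
      by apply: cvgM; [exact: cb|apply: cvgV => //; exact: cm].
    apply: (@cts_at_comp _ _ _ (fun w => (s w, tau w)) H); last exact: cH.
    by apply: cont_pair_at; [exact: sc|exact: ct].
  have e : tau w = 0 \/ tau w = 1.
    move: m0; rewrite /m minElt; case: ifP => _ h; [left|right]; lra.
  move=> V hV.
  have hV' : nbhs (H (0, tau w)) V.
    have [a0 a1] := hb (s w) (clamp01_itv _); have [d0 d1] := hb 0 ltac:(lra).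
    by case: e hV => ->; rewrite ?a0 ?d0 ?a1 ?d1.
  have : \forall w' \near w, `[0%R, 1%R]%classic `<=` [set s | V (H (s, tau w'))].
    exact: (ct w _ (ends _ _ e hV')).
  by apply: filterS => w' h; apply: h; rewrite /= in_itv; exact: clamp01_itv.
- move=> t ht.
  have bE : b (t, 0) = t by rewrite /b clamp01_id.
  have cE : c (t, 0) = 0 by rewrite /c maxxx bE min_l//; lra.
  have tE : tau (t, 0) = t / 2 by rewrite /tau bE cE add0r.
  have mE : m (t, 0) = t by rewrite /m tE min_l; lra.
  rewrite tE; have [t0|t0] := eqVneq t 0.
    rewrite t0 mul0r curve0; have [-> //] := hb (s (0, 0)) (clamp01_itv _).
  have -> : s (t, 0) = 0.
    by rewrite /s bE mE divff// subrr clamp01_id ?lexx ?ler01.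
  rewrite h0; last lra.
  rewrite /= /pcat_fun; case: leP => h; last by exfalso; lra.
  by congr (p _); lra.
- move=> t ht.
  have bE : b (1 - t, t) = 1 - t by rewrite /b clamp01_id//=; lra.
  have cE : c (1 - t, t) = t.
    by rewrite /c bE /= max_r ?min_l//; lra.
  have tE : tau (1 - t, t) = (1 + t) / 2 by rewrite /tau bE cE; lra.
  have mE : m (1 - t, t) = 1 - t by rewrite /m tE min_r; lra.
  rewrite tE; have [t0|t0] := eqVneq t 1.
    rewrite t0 curve1 (_ : (1 + 1) / 2 = 1); last lra.
    by have [_ ->] := hb (s (1 - 1, 1)) (clamp01_itv _).
  have -> : s (1 - t, t) = 0.
    rewrite /s bE mE divff ?subr_eq0 1?eq_sym// subrr clamp01_id ?lexx ?ler01//.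
  rewrite h0; last lra.
  rewrite /= /pcat_fun; case: leP => h; last by congr (q _); lra.
  have -> : t = 0 by lra.
  by rewrite curve0 addr0 mulrA mulr1 divff ?pnatr_eq0// curve1.
- move=> t ht.
  have bE : b (0, t) = 0 by rewrite /b clamp01_id//= lexx ler01.
  have cE : c (0, t) = t by rewrite /c bE /= max_r ?min_l//; lra.
  have tE : tau (0, t) = t by rewrite /tau bE cE; lra.
  have -> : s (0, t) = 1.
    by rewrite /s bE mul0r subr0 clamp01_id// ler01 lexx.
  by rewrite tE h1.
Qed.

(** * Loops as one-dimensional spheroids *)

Section FundamentalGroup.
Variables (R : realType) (K : topologicalType) (x0 : K).
Notation loop := (curve R x0 x0).

Definition sph (p : R -> K) (v : 'rV[R]_1) : K := p (v ord0 ord0).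

Lemma cube1 (v : 'rV[R]_1) : cube v <-> 0 <= v ord0 ord0 <= 1.
Proof. by split=> [|h j]; [exact|rewrite (ord1 j)]. Qed.

Lemma boundary1 (v : 'rV[R]_1) : cube_boundary v <-> v ord0 ord0 = 0 \/ v ord0 ord0 = 1.
Proof.
split=> [[/cube1 h1 h2]|h].
  have [a|a] := eqVneq (v ord0 ord0) 0; first by left.
  have [b|b] := eqVneq (v ord0 ord0) 1; first by right.
  exfalso; apply: h2 => j; rewrite (ord1 j) !lt_neqAle.
  by rewrite eq_sym a b /=.
split; first by apply/cube1; case: h => ->; rewrite ?lexx ?ler01.
by move=> /(_ ord0); case: h => ->; rewrite ltxx ?andbF.
Qed.

Lemma homotopic_cube (f f' g g' : 'rV[R]_1 -> K) :
  (forall v, cube v -> f v = f' v) -> (forall v, cube v -> g v = g' v) ->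
  homotopic x0 f g -> homotopic x0 f' g'.
Proof.
move=> hf hg [H [h1 h2 h3]]; exists H; split=> // v cv.
by rewrite -hf// -hg//; exact: h2.
Qed.

Lemma const_mx_cts (a : R * R -> R) : continuous a ->
  continuous (fun z => const_mx (a z) : 'rV[R]_1).
Proof.
move=> ca z; change (cts_at (fun z => const_mx (a z) : 'rV[R]_1) z).
apply: (@cts_in_at _ _ setT); first exact: filterT.
apply: rV_cts_at => j; apply: cts_at_in.
rewrite (_ : (fun y => const_mx (a y) ord0 j) = a); first exact: ca.
by apply/funext => y; rewrite mxE.
Qed.

Lemma sph_homotopic (p q : loop) : homotopic x0 (sph p) (sph q) <-> peq p q.
Proof.
split=> [[H [cH h1 h2]]|[H [cH h0 h1 hb]]].
  exists (fun st => H (clamp01 st.1, const_mx (clamp01 st.2))); split.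
  - move=> st; change (cts_at (fun st => H (clamp01 st.1, const_mx (clamp01 st.2))) st).
    apply: (@cts_in_at _ _ setT); first exact: filterT.
    have hm (z : R * R) : setT z -> (`[0%R, 1%R]%classic `*` cube)
        (clamp01 z.1, const_mx (clamp01 z.2) : 'rV[R]_1).
      move=> _; split; first by rewrite /= in_itv; exact: clamp01_itv.
      by apply/cube1; rewrite mxE; exact: clamp01_itv.
    apply: (cts_in_comp (g := H) hm).
      suff c : continuous (fun z : R * R => (clamp01 z.1, const_mx (clamp01 z.2) : 'rV[R]_1)).
        exact/cts_at_in/c.
      by apply: cont_pair; [rcont|apply: const_mx_cts; rcont].
    by apply: (cts_inP _ _).1 cH _ _; exact: hm.
  - move=> t t01 /=; rewrite (@clamp01_id R 0) ?lexx ?ler01//.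
    have [|-> _] := h1 (const_mx (clamp01 t)).
      by apply/cube1; rewrite mxE; exact: clamp01_itv.
    by rewrite /sph mxE clamp01_id.
  - move=> t t01 /=; rewrite (@clamp01_id R 1) ?lexx ?ler01//.
    have [|_ ->] := h1 (const_mx (clamp01 t)).
      by apply/cube1; rewrite mxE; exact: clamp01_itv.
    by rewrite /sph mxE clamp01_id.
  - move=> s s01 /=; split; apply: h2; rewrite ?clamp01_itv//; apply/boundary1;
      rewrite mxE clamp01_id ?lexx ?ler01//; [left|right] => //.
exists (fun z : R * 'rV[R]_1 => H (z.1, z.2 ord0 ord0)); split.
- apply: continuous_subspaceT.
  apply: (@cont_comp _ _ _ (fun z : R * 'rV[R]_1 => (z.1, z.2 ord0 ord0)) H) => //.
  apply: cont_pair; first exact: cont_fst.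
  apply: (@cont_comp _ _ _ (fun z : R * 'rV[R]_1 => z.2) (fun v => v ord0 ord0)).
    exact: cont_snd.
  exact: coord_continuous.
- by move=> v /cube1 cv; rewrite /sph /= h0// h1.
- move=> t v t01 /boundary1 hv /=; have [a b] := hb t t01.
  by case: hv => ->.
Qed.

Lemma sph_spheroid (p : loop) : spheroid x0 (sph p).
Proof.
split; last by move=> v /boundary1 [] h; rewrite /sph h ?curve0 ?curve1.
apply: continuous_subspaceT; apply: cont_comp; last exact: curve_cont.
exact: coord_continuous.
Qed.

Lemma spheroid_sph (f : 'rV[R]_1 -> K) : spheroid x0 f ->
  exists p : loop, forall v, cube v -> f v = sph p v.
Proof.
move=> [cf fb].
have c : continuous (fun t : R => f (const_mx (clamp01 t))).
  move=> t; change (cts_at (fun t : R => f (const_mx (clamp01 t))) t).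
  apply: (@cts_in_at _ _ setT); first exact: filterT.
  have hm (z : R) : setT z -> cube (const_mx (clamp01 z) : 'rV[R]_1).
    by move=> _; apply/cube1; rewrite mxE; exact: clamp01_itv.
  apply: (@cts_in_comp _ _ _ setT cube (fun z : R => const_mx (clamp01 z) : 'rV[R]_1) f t hm).
    apply: cts_at_in.
    apply: (@cts_at_comp _ _ _ (fun z : R => (z, z))
      (fun z => const_mx (clamp01 z.1) : 'rV[R]_1)).
      exact: (cont_pair (@cont_id _) (@cont_id _)).
    by apply: const_mx_cts; rcont.
  by apply: (cts_inP _ _).1 cf _ _; exact: hm.
have e0 : f (const_mx (clamp01 0)) = x0.
  by apply: fb; apply/boundary1; left; rewrite mxE clamp01_id// lexx ler01.
have e1 : f (const_mx (clamp01 1)) = x0.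
  by apply: fb; apply/boundary1; right; rewrite mxE clamp01_id// lexx ler01.
exists (Curve c e0 e1) => v /cube1 cv; rewrite /sph /= clamp01_id//.
by congr f; apply/rowP => j; rewrite mxE (ord1 j).
Qed.

Definition pclass (p : loop) := homotopy_class x0 (sph p).

Lemma pclass_in p : homotopy_group R x0 1 (pclass p).
Proof. by exists (sph p) => //; exact: sph_spheroid. Qed.

Lemma pclass_mem (p : loop) f : pclass p f <->
  spheroid x0 f /\ exists2 q : loop, peq p q & forall v, cube v -> f v = sph q v.
Proof.
split=> [[sf hf]|[sf [q pq hq]]]; split=> //.
  have [q hq] := spheroid_sph sf; exists q => //; apply/sph_homotopic.
  by apply: homotopic_cube hf.
by apply: (@homotopic_cube (sph p) _ (sph q)) => //;
  [move=> v cv; rewrite hq|exact/sph_homotopic].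
Qed.

Lemma pclass_eq p q : pclass p = pclass q <-> peq p q.
Proof.
split=> [e|pq].
  have : pclass p (sph p).
    by apply/pclass_mem; split; [exact: sph_spheroid|exists p => //; exact: peq_refl].
  by rewrite e => -[_ /sph_homotopic] /peq_sym.
apply/seteqP; split=> f /pclass_mem [sf [r pr hr]]; apply/pclass_mem; split=> //;
  exists r => //; apply: peq_trans pr => //.
exact: peq_sym.
Qed.

Lemma pclass_surj a : homotopy_group R x0 1 a -> exists p, a = pclass p.
Proof.
move=> [f sf <-]; have [p hp] := spheroid_sph sf; exists p.
apply/seteqP; split=> g [sg hg]; split=> //.
  by apply: homotopic_cube hg.
by apply: homotopic_cube hg => // v /hp.
Qed.

Lemma pclass_mul p q : homotopy_mul x0 (pclass p) (pclass q) = pclass (pcat p q).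
Proof.
have cat_sph (p' q' : loop) f g : (forall v, cube v -> f v = sph p' v) ->
    (forall v, cube v -> g v = sph q' v) ->
    forall v, cube v -> concat f g v = sph (pcat p' q') v.
  move=> hf hg v /cube1 cv; rewrite /concat /sph /= /pcat_fun.
  by case: leP => h; [rewrite hf|rewrite hg];
    rewrite ?/sph ?mxE ?eqxx ?subr0//; apply/cube1; rewrite mxE eqxx; lra.
apply/seteqP; split=> h.
  move=> [sh [f [g [/pclass_mem [sf [p' pp' hf]] /pclass_mem [sg [q' qq' hg]] hh]]]].
  have [r hr] := spheroid_sph sh; apply/pclass_mem; split=> //; exists r => //.
  apply: (peq_trans (peq_cat pp' qq')); apply: peq_sym; apply/sph_homotopic.
  by apply: homotopic_cube hh => //; exact: cat_sph.
move=> /pclass_mem [sh [r hr hrh]]; split=> //; exists (sph p), (sph q); split.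
- by apply/pclass_mem; split; [exact: sph_spheroid|exists p => //; exact: peq_refl].
- by apply/pclass_mem; split; [exact: sph_spheroid|exists q => //; exact: peq_refl].
- apply: (@homotopic_cube (sph r) _ (sph (pcat p q))).
  + by move=> v cv; rewrite hrh.
  + by move=> v cv; rewrite (@cat_sph p q).
  + by apply/sph_homotopic; exact: peq_sym.
Qed.

Lemma peq_cancell (x y z : K) (a : curve R x y) (p q : curve R y z) :
  peq (pcat a p) (pcat a q) -> peq p q.
Proof.
have h (r : curve R y z) : peq r (pcat (pinv a) (pcat a r)).
  apply: (peq_trans (peq_sym (pcat1p r))).
  apply: (peq_trans _ (pcatA _ _ _)); apply: peq_cat (peq_refl _).
  by apply: peq_sym; exact: pcatVp.
move=> e; apply: (peq_trans (h p)); apply: (peq_trans _ (peq_sym (h q))).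
exact: peq_cat (peq_refl _) e.
Qed.

Lemma peq_cancelr (x y z : K) (a : curve R y z) (p q : curve R x y) :
  peq (pcat p a) (pcat q a) -> peq p q.
Proof.
have h (r : curve R x y) : peq r (pcat (pcat r a) (pinv a)).
  apply: (peq_trans (peq_sym (pcatp1 r))); apply: peq_sym.
  apply: (peq_trans (pcatA _ _ _)); apply: peq_cat (peq_refl _) _.
  exact: pcatpV.
move=> e; apply: (peq_trans (h p)); apply: (peq_trans _ (peq_sym (h q))).
exact: peq_cat e (peq_refl _).
Qed.

End FundamentalGroup.

(* A transport of the fundamental group along a choice of paths from the base
   point. *)
Lemma holonomy (R : realType) (K : topologicalType) (x0 : K) (G : groupType) :
  path_connected R K -> fundamental_group_isog R x0 G ->
  exists hol : forall x y : K, curve R x y -> G, [/\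
    forall x y (p q : curve R x y), peq p q <-> hol _ _ p = hol _ _ q,
    forall x y z (p : curve R x y) (q : curve R y z),
      hol _ _ (pcat p q) = (hol _ _ p * hol _ _ q)%g &
    forall x y g, exists p : curve R x y, hol _ _ p = g].
Proof.
move=> [_ pc] [phi [phib phiM]].
have gam_ex y : exists p : curve R x0 y, True.
  have [p [cp p0 p1]] := pc x0 y.
  have c : continuous (fun t => p (clamp01 t)).
    move=> t; change (cts_at (fun t => p (clamp01 t)) t).
    apply: (@cts_in_at _ _ setT); first exact: filterT.
    have hm (z : R) : setT z -> `[0%R, 1%R]%classic (clamp01 z).
      by move=> _; rewrite /= in_itv; exact: clamp01_itv.
    apply: (cts_in_comp (g := p) hm).
      by apply: cts_at_in; exact: clamp01_continuous.
    by apply: (cts_inP _ _).1 cp _ _; exact: hm.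
  have e0 : p (clamp01 0) = x0 by rewrite clamp01_id// lexx ler01.
  have e1 : p (clamp01 1) = y by rewrite clamp01_id// lexx ler01.
  by exists (Curve c e0 e1).
pose gam y := projT1 (cid (gam_ex y)).
pose conj x y (p : curve R x y) := pcat (pcat (gam x) p) (pinv (gam y)).
have phi_inj (p q : curve R x0 x0) : phi (pclass p) = phi (pclass q) <-> peq p q.
  rewrite -pclass_eq; split=> [e|-> //].
  by apply: (set_bij_inj phib) => //; rewrite inE; exact: pclass_in.
exists (fun x y p => phi (pclass (conj x y p))); split.
- move=> x y p q; rewrite phi_inj; split=> [pq|/peq_cancelr/peq_cancell//].
  by apply: peq_cat (peq_refl _); exact: peq_cat (peq_refl _) pq.
- move=> x y z p q; rewrite -phiM; try exact: pclass_in.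
  rewrite pclass_mul; apply/phi_inj; apply: peq_sym.
  apply: (peq_trans (pcatA _ _ _)).
  apply: (@peq_trans _ _ _ _ _ (pcat (pcat (gam x) p) (pcat q (pinv (gam z))))).
    apply: peq_cat (peq_refl _) _.
    apply: (peq_trans (peq_sym (pcatA _ _ _))); apply: peq_cat (peq_refl _).
    apply: (peq_trans (peq_sym (pcatA _ _ _))).
    apply: (peq_trans _ (pcat1p q)); apply: peq_cat (peq_refl _).
    exact: pcatVp.
  apply: (peq_trans (peq_sym (pcatA _ _ _))); apply: peq_cat (peq_refl _).
  exact: pcatA.
- move=> x y g; have [_ _ /(_ g I) [a /pclass_surj [p ->] <-]] := phib.
  exists (pcat (pcat (pinv (gam x)) p) (gam y)); apply/phi_inj.
  apply: (peq_trans (pcatA _ _ _)).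
  apply: (@peq_trans _ _ _ _ _ (pcat (gam x) (pcat (pinv (gam x)) p))).
    apply: peq_cat (peq_refl _) _.
    apply: (peq_trans (pcatA _ _ _)).
    apply: (peq_trans _ (pcatp1 _)); apply: peq_cat (peq_refl _) _.
    exact: pcatpV.
  apply: (peq_trans (peq_sym (pcatA _ _ _))).
  apply: (peq_trans _ (pcat1p p)); apply: peq_cat (peq_refl _).
  exact: pcatpV.
Qed.

(** * Cocycles and nerves *)

Section Choice.
Variable I : choiceType.

(** A choice in each class of lists up to permutation: a simplex of the nerve is then a single list,
    without any order on the indices. *)
Definition canon (s : seq I) := choose (perm_eq s) s.

Lemma canonP s : perm_eq s (canon s). Proof. exact: chooseP. Qed.

Lemma canon_eq s t : perm_eq s t -> canon s = canon t.
Proof.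
move=> st; rewrite /canon; have e : perm_eq s =1 perm_eq t by exact/permPl.
by rewrite (eq_choose e); apply: choose_id => //; rewrite -e.
Qed.

(** The choice operator picks the same element of a pair in either order. This orients the edges of
    a nerve, so that edge data can be chosen in one direction and inverted in the other. *)
Lemma pair_orientation : exists o : I -> I -> bool,
  forall i j, i != j -> o j i = ~~ o i j.
Proof.
exists (fun i j => choose (pred2 i j) i == i) => i j ij.
have e12 : pred2 j i =1 pred2 i j by move=> x /=; rewrite orbC.
have -> : choose (pred2 j i) j = choose (pred2 i j) i.
  by rewrite (eq_choose e12); apply: choose_id; rewrite /= eqxx ?orbT.
have : pred2 i j (choose (pred2 i j) i) by apply: chooseP; rewrite /= eqxx.
rewrite /= => /orP[] /eqP ->; rewrite eqxx; first by rewrite (negbTE ij).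
by rewrite eq_sym (negbTE ij).
Qed.

End Choice.

Section Cochains.
Variables (X : topologicalType) (gT : finGroupType).
Implicit Types (A : set X) (c : X -> X -> gT) (H : {group gT}).

(* Alexander-Spanier 1-cocycles: they classify principal bundles, and no
   continuity is required. *)
Definition cocycle_on A c := forall z, A z -> exists2 V, nbhs z V &
  forall x y w, V x -> V y -> V w -> A x -> A y -> A w ->
    (c x y * c y w)%g = c x w.

(** An isomorphism of the bundles of [c] and [c'] over [A]. A trivialisation is chosen separately at
    each point, hence [b] is an arbitrary function. *)
Definition gauge_eq A (b : X -> gT) c c' := forall z, A z -> exists2 V, nbhs z V &
  forall x y, V x -> V y -> A x -> A y -> c' x y = ((b x)^-1 * c x y * b y)%g.

Definition cocycle_ext H A c := exists c' b, [/\ forall x y, c' x y \in H,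
  cocycle_on setT c', forall x, b x \in H & gauge_eq A b c c'].

(** The bundle over the boundary of the triangle, trivial along the edges 01 and 12 and glued by [g]
    along the edge from 0 to 2. *)
Definition jump (g : gT) (i j : nat) : gT :=
  (if (i == 0%N) && (j == 2%N) then g else if (i == 2%N) && (j == 0%N) then g^-1 else 1)%g.

(* The map from the union of the [C i] to the boundary of a triangle defined by
   the covering pulls the bundle with monodromy [g] back to a bundle that
   extends to [X]. *)
Definition fillable H g := forall (C : 'I_3 -> set X) (iota : X -> 'I_3),
  (forall i, closed (C i)) -> (forall x, ~ forall i, C i x) ->
  (forall x i, C i x -> C (iota x) x) ->
  cocycle_ext H (\bigcup_i C i) (fun x y => jump g (iota x) (iota y)).

End Cochains.

Lemma closed_bigcup_ord (X : topologicalType) n (C : 'I_n -> set X) :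
  (forall i, closed (C i)) -> closed (\bigcup_i C i).
Proof. by move=> cC; apply: closed_bigcup => //; exact: finite_finset. Qed.

Section Nerve.
Variables (R : realType) (X : topologicalType) (gT : finGroupType) (H : {group gT}).
Variables (I : choiceType) (u : I -> X -> R) (c : I -> I -> gT).
Variables (iota : X -> I) (A : set X).

Hypothesis uc : forall i, continuous (u i).
Hypothesis uloc : forall z : X, exists s : seq I, [/\ uniq s, (size s <= 3)%N &
  \forall x \near z, forall i, i \notin s -> u i x = 0].
Hypothesis iotaP : forall x, 3^-1 <= u (iota x) x.

(** The edge data are a coboundary on the simplex [s]: the bundle is trivial over it. *)
Definition coherent (s : seq I) := exists b : I -> gT,
  forall i j, i \in s -> j \in s -> c i j = ((b i)^-1 * b j)%g.

Hypothesis cH : forall i j, c i j \in H.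
Hypothesis c2 : forall i j, coherent [:: i; j].
Hypothesis c3 : forall i j k, uniq [:: i; j; k] -> ~ coherent [:: i; j; k] ->
  (exists x, [/\ 0 < u i x, 0 < u j x & 0 < u k x]) ->
  fillable X H (c i k * (c j k)^-1 * (c i j)^-1)%g.
Hypothesis cA : forall x (s : seq I), A x -> (forall i, i \in s -> 0 < u i x) -> coherent s.

Let b x y := c (iota x) (iota y).

Lemma coherentM s i j k : coherent s -> i \in s -> j \in s -> k \in s ->
  (c i j * c j k)%g = c i k.
Proof. by move=> [be h] si sj sk; rewrite !h// mulgA mulgK. Qed.

Lemma coherent_sub s s' : {subset s <= s'} -> coherent s' -> coherent s.
Proof. by move=> ss [be h]; exists be => i j /ss si /ss sj; exact: h. Qed.

Lemma coherent_size2 s : (size s <= 2)%N -> coherent s.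
Proof.
case: s => [|i [|j [|]]]//= _; first by exists (fun=> 1%g).
by apply: (@coherent_sub _ [:: i; i]) (c2 i i) => j; rewrite !inE orbb.
Qed.

(** The core of a simplex, and in [B] a collar inside the core. As 1/4 < 3/10 < 1/3, a collar
    exists, and a point whose weight at [i] is at most 3/10 is never labelled [i] by [iota]. *)
Let M (s : seq I) := [set x | forall i, i \in s -> 4^-1 <= u i x].
Let B (s : seq I) := M s `&` [set x | exists2 i, i \in s & u i x <= 3 / 10].

Let supp_at x : exists s : seq I, [/\ uniq s, (size s <= 3)%N &
  forall i, i \notin s -> u i x = 0].
Proof.
have [s [us ss]] := uloc x; move=> /nbhs_singleton h.
by exists s.
Qed.

Let M_sub s t x : uniq s -> size s = 3%N -> (size t <= 3)%N -> M s x ->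
  (forall i, i \notin t -> u i x = 0) -> s =i t /\ size t = 3%N.
Proof.
move=> us ss st Mx h.
have st' : {subset s <= t}.
  move=> i si; apply: contraT => /h e; have := Mx _ si.
  by rewrite e leNgt invr_gt0 ltr0n.
have [|e1 e2] := uniq_min_size us st'; first by rewrite ss.
by split=> //; apply/eqP; rewrite eqn_leq st /= -ss; exact: uniq_leq_size.
Qed.

Let iota_B s x : uniq s -> size s = 3%N -> M s x -> iota x \in s.
Proof.
move=> us ss Mx; have [t [ut st h]] := supp_at x.
have [-> _] := M_sub us ss st Mx h.
apply: contraT => /h e; have := iotaP x.
by rewrite e leNgt invr_gt0 ltr0n.
Qed.

Let closed_M s : closed (M s).
Proof.
have -> : M s = \bigcap_(i in [set` s]) [set x | 4^-1 <= u i x] by [].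
by apply: closed_bigI => i _; apply: closed_ge_fun.
Qed.

(** The sets where one of the three weights is at least 1/3 are closed in the collar, cover it
    through [iota], and have no common point since some weight is at most 3/10: fillability applies
    to them. The gauge [be] concentrates the whole monodromy on the edge from [i] to [k], as [jump]
    requires. *)
Let triple_ext i j k : uniq [:: i; j; k] ->
  fillable X H (c i k * (c j k)^-1 * (c i j)^-1)%g ->
  exists c' : X -> X -> gT, [/\ forall x y, c' x y \in H, cocycle_on setT c' &
    forall z, B [:: i; j; k] z -> exists2 V, nbhs z V &
      forall x y, V x -> V y -> B [:: i; j; k] x -> B [:: i; j; k] y ->
        c' x y = b x y].
Proof.
set s := [:: i; j; k]; set g := (c i k * _ * _)%g => us hg.
pose C (l : 'I_3) := M s `&` [set x | (exists2 i, i \in s & u i x <= 3 / 10) /\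
  3^-1 <= u (nth i s l) x].
have cC l : closed (C l).
  have -> : C l = M s `&` (\bigcup_(i in [set` s]) [set x | u i x <= 3 / 10] `&`
      [set x | 3^-1 <= u (nth i s l) x]).
    apply/seteqP; split=> x [Mx].
      by move=> [[a sa ua] ul]; split=> //; split=> //; exists a.
    by move=> [[a sa ua] ul]; split=> //; split=> //; exists a.
  apply: closedI => //; apply: closedI; last exact: closed_ge_fun.
  by apply: closed_bigcup => // a _; exact: closed_le_fun.
have BC : B s = \bigcup_l C l.
  apply/seteqP; split=> x.
    move=> [Mx ux]; have ix := iota_B us erefl Mx.
    have il : (index (iota x) s < 3)%N by rewrite -index_mem in ix.
    by exists (Ordinal il) => //; split=> //; split=> //; rewrite nth_index.
  by move=> [l _ [Mx [ux _]]].
pose io x : 'I_3 := inord (index (iota x) s).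
have ioE x : B s x -> nth i s (io x) = iota x.
  move=> [Mx _]; have ix := iota_B us erefl Mx.
  by rewrite inordK ?nth_index//; rewrite -index_mem in ix.
have [|x l Cx|c' [e [c'H c'c eH ce]]] := hg C io cC.
- move=> x h; have [_ [[a sa ua] _]] := h ord0.
  have al : (index a s < 3)%N by rewrite -index_mem in sa.
  have [_ [_]] := h (Ordinal al); rewrite /= nth_index//; lra.
- have Bx : B s x by rewrite BC; exists l.
  by have [Mx ux] := Bx; split=> //; split=> //; rewrite ioE.
pose be (a : I) : gT := (if a == i then 1 else if a == j then c i j else c i j * c j k)%g.
have beH a : be a \in H.
  by rewrite /be; case: ifP => // _; case: ifP => // _; rewrite groupM.
have cii a : c a a = 1%g.
  by have [w h] := c2 a a; rewrite h ?mem_head// mulVg.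
have cV a a' : c a' a = (c a a')^-1%g.
  by have [w h] := c2 a a'; rewrite !h ?invMg ?invgK// !inE eqxx ?orbT.
have /and3P[] := us; rewrite !inE negb_or => /andP[ij ik] jk _.
have gauge a a' : a \in s -> a' \in s ->
    jump g (index a s) (index a' s) = (be a * c a a' * (be a')^-1)%g.
  rewrite /s !inE /be /jump /=.
  have [ji ki kj] : [/\ j == i = false, k == i = false & k == j = false].
    by rewrite ![_ == i]eq_sym [k == j]eq_sym !(negbTE ij) (negbTE ik) (negbTE jk).
  move=> /or3P[] /eqP -> /or3P[] /eqP -> ;
    rewrite ?eqxx ?ji ?ki ?kj ?(eq_sym i) ?(eq_sym j k) ?ji ?ki ?kj /= ?eqxx /=
      ?cii ?mulg1 ?mul1g ?invg1 ?mulgV //.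
  - by rewrite /g invMg mulgA.
  - by rewrite mulg1 (cV i j) mulgV.
  - by rewrite /g !invMg !invgK (cV i k) mulg1 mulgA.
  - by rewrite (cV j k) mulgK mulgV.
have [w wE wH] : exists2 w : X -> gT, forall x, w x = ((be (iota x))^-1 * e x)%g &
    forall x, w x \in H.
  exists (fun x => (be (iota x))^-1 * e x)%g => // x.
  by rewrite groupM ?groupV ?beH ?eH.
exists (fun x y => w x * c' x y * (w y)^-1)%g; split.
- by move=> x y; rewrite !groupM ?groupV ?c'H ?wH.
- move=> z _; have [V Vz h] := c'c z Logic.I; exists V => // x y t Vx Vy Vt _ _ _.
  by rewrite -(h x y t)// !mulgA mulgKV.
- move=> z; rewrite BC => /ce [V Vz h]; exists V => // x y Vx Vy; rewrite -BC => Bx By.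
  rewrite h -?BC// /io.
  have ix : iota x \in s by have [Mx _] := Bx; exact: iota_B.
  have iy : iota y \in s by have [My _] := By; exact: iota_B.
  rewrite !inordK; [|by rewrite -index_mem in iy|by rewrite -index_mem in ix].
  by rewrite gauge// !wE /b invMg invgK !mulgA !mulgK mulVg mul1g mulgKV.
Qed.

(** The cocycle [b] read on the labels can fail only inside triangles with nontrivial monodromy. On
    their cores it is replaced by the extension from [triple_ext], which equals [b] on the collar.
    By [cA] no such core meets [A], so [b] is kept there. *)
Lemma nerve_ext : exists c' : X -> X -> gT, [/\ forall x y, c' x y \in H,
  cocycle_on setT c' & gauge_eq A (fun=> 1%g) b c'].
Proof.
pose bad s := [/\ canon s = s, uniq s, size s = 3%N & ~ coherent s].
pose ok s (c' : X -> X -> gT) := [/\ forall x y, c' x y \in H, cocycle_on setT c' &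
    forall z, B s z -> exists2 V, nbhs z V &
      forall x y, V x -> V y -> B s x -> B s y -> c' x y = b x y].
have ext_ex s : exists c', bad s -> (exists x, M s x) -> ok s c'.
  have [hb|] := pselect (bad s /\ exists x, M s x); last first.
    by move=> h; exists (fun _ _ => 1%g) => h1 h2; exfalso; apply: h.
  have [[_ us ss nc] [x Mx]] := hb.
  case: s us ss nc Mx {hb} => [|i [|j [|k [|]]]]// us _ nc Mx.
  have p0 : 0 < 4^-1 :> R by rewrite invr_gt0 ltr0n.
  have [|c' hc'] := @triple_ext i j k us; last by exists c'.
  apply: c3 => //; exists x; split; apply: (lt_le_trans p0); apply: Mx;
    by rewrite !inE eqxx ?orbT.
pose ce s := projT1 (cid (ext_ex s)).
have ceP s : bad s -> (exists x, M s x) -> ok s (ce s) := projT2 (cid (ext_ex s)).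
have bH x y : b x y \in H by exact: cH.
pose P x y s := [/\ bad s, M s x & M s y].
pose c' x y := if pselect (exists s, P x y s) is left h
  then ce (projT1 (cid h)) x y else b x y.
have bad_uniq x s t : bad s -> bad t -> M s x -> M t x -> s = t.
  move=> [cs us ss _] [ct ut st _] Ms Mt.
  have [r [ur sr h]] := supp_at x.
  have [e1 _] := M_sub us ss sr Ms h; have [e2 _] := M_sub ut st sr Mt h.
  rewrite -cs -ct; apply: canon_eq; apply: uniq_perm => // i.
  by rewrite e1 e2.
have c'E x y s : bad s -> M s x -> M s y -> c' x y = ce s x y.
  move=> bs Mx My; rewrite /c'; case: pselect => [h|[]]; last by exists s.
  case: (cid h) => t [bt Mtx Mty] /=.
  by rewrite (bad_uniq x t s).
have c'b x y : (forall s, bad s -> M s x -> M s y -> False) -> c' x y = b x y.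
  move=> h; rewrite /c'; case: pselect => // h2; exfalso.
  by case: h2 => s [h3 h4 h5]; exact: h h3 h4 h5.
(* Near each point [c'] is either [b] or one of the extensions. *)
have loc (z : X) : (exists s, bad s /\ (\forall x \near z, M s x)) \/
   (exists2 V, nbhs z V & (forall x y, V x -> V y -> c' x y = b x y) /\
     exists s, coherent s /\ forall x, V x -> iota x \in s).
  have [t [ut st ht]] := uloc z.
  have [tcoh|tncoh] := pselect (coherent t).
    right; exists [set x | forall i, i \notin t -> u i x = 0] => //; split.
      move=> x y Vx Vy; apply: c'b => s [cs us ss nc] Mx My.
      have [e1 _] := M_sub us ss st Mx Vx.
      by apply: nc; apply: coherent_sub tcoh => i; rewrite e1.
    exists t; split=> // x Vx; apply: contraT => /Vx e; have := iotaP x.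
    by rewrite e leNgt invr_gt0 ltr0n.
  have st3 : size t = 3%N.
    apply/eqP; rewrite eqn_leq st ltnNge; apply/negP => h.
    by apply: tncoh; exact: coherent_size2.
  pose s := canon t; have pst : perm_eq t s := canonP t.
  have sti : s =i t by move=> i; rewrite (perm_mem pst).
  have us : uniq s by rewrite -(perm_uniq pst).
  have ss : size s = 3%N by rewrite -(perm_size pst).
  have bs : bad s.
    split=> //; first by rewrite /s; apply: canon_eq; rewrite perm_sym; exact: canonP.
    by move=> h; apply: tncoh; apply: coherent_sub h => i; rewrite sti.
  have onlys s' x : bad s' -> M s' x -> (forall i, i \notin t -> u i x = 0) -> s' = s.
    move=> [cs' us' ss' _] Mx hx; have [e _] := M_sub us' ss' st Mx hx.
    by rewrite -cs'; apply: canon_eq; apply: uniq_perm => // i; rewrite e sti.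
  have [big|] := pselect (forall i, i \in s -> 4^-1 < u i z).
    left; exists s; split=> //.
    have : \forall x \near z, forall i, i \in s -> 4^-1 < u i x.
      apply: (@near_finite X I (nbhs z) [set` s] (fun i x => 4^-1 < u i x)) => //.
      by move=> i si; apply: (cts_at_gt (@uc i z)); exact: big.
    by apply: filterS => x h i /h /ltW.
  (* One weight is at most 1/4 at [z], hence below 3/10 nearby: the labels take only the two other
     values, and a pair is always coherent. *)
  move=> /existsNP [i /not_implyP [si /negP]]; rewrite -leNgt => ui.
  have ui' : u i z < 3 / 10 by lra.
  have nui : \forall x \near z, u i x < 3 / 10 := cts_at_lt (@uc i z) ui'.
  right.
  have [V Vz hV] : exists2 V, nbhs z V & forall x y, V x -> V y -> M s x -> M s y ->
      ce s x y = b x y.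
    have [Mz|Mz] := pselect (M s z).
      have [_ _ h] := ceP s bs (ex_intro _ z Mz).
      have [|V Vz {}h] := h z; first by split=> //; exists i => //; exact: ltW.
      exists (V `&` [set x | u i x < 3 / 10]); first exact: filterI.
      by move=> x y [Vx ux] [Vy uy] Mx My; apply: h => //; split=> //; exists i => //; exact: ltW.
    exists (~` M s); first by apply: open_nbhs_nbhs; split=> //; exact: closed_openC.
    by move=> x y Vx.
  exists (V `&` ([set x | forall i, i \notin t -> u i x = 0] `&` [set x | u i x < 3 / 10])).
    by apply: filterI => //; exact: filterI.
  split.
    move=> x y [Vx [tx ux]] [Vy [ty uy]].
    have [[Mx My]|nM] := pselect (M s x /\ M s y).
      by rewrite (c'E x y s)//; exact: hV.
    apply: c'b => s' bs' Mx My; apply: nM.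
    by rewrite -(onlys s' x).
  exists (rem i t); split.
    by apply: coherent_size2; rewrite size_rem -?sti// st3.
  move=> x [Vx [tx /= ux]]; rewrite (mem_rem_uniq _ ut) !inE.
  have -> : iota x \in t.
    by apply: contraT => /tx e; have := iotaP x; rewrite e leNgt invr_gt0 ltr0n.
  by rewrite andbT; apply/eqP => e; have := iotaP x; rewrite e; lra.
exists c'; split.
- move=> x y; rewrite /c'; case: pselect => // h; case: (cid h) => s [bs Mx My] /=.
  by have [] := ceP s bs (ex_intro _ x Mx).
- move=> z _; have [[s [bs Ms]]|[V Vz [cb [s [[be hs] Vs]]]]] := loc z.
    have [_ cs _] := ceP s bs (ex_intro _ z (nbhs_singleton Ms)).
    have [V Vz h] := cs z Logic.I; exists (V `&` M s); first exact: filterI.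
    move=> x y w [Vx Mx] [Vy My] [Vw Mw] _ _ _.
    by rewrite !(c'E _ _ s)//; exact: h.
  exists V => // x y w Vx Vy Vw _ _ _; rewrite !cb// /b.
  by rewrite !hs ?mulgA ?mulgK//; exact: Vs.
- move=> z Az; have [[s [bs Ms]]|[V Vz [cb _]]] := loc z.
    have [_ _ _ []] := bs; apply: (cA Az) => i si.
    apply: (@lt_le_trans _ _ 4^-1); first by rewrite invr_gt0 ltr0n.
    exact: (nbhs_singleton Ms).
  by exists V => // x y Vx Vy _ _; rewrite invg1 mul1g mulg1; exact: cb.
Qed.

End Nerve.

(** * Partitions of unity in dimension 2 *)

Lemma cont_sum (R : realType) (X : topologicalType) (I : Type) (s : seq I)
    (f : I -> X -> R) : (forall i, continuous (f i)) ->
  continuous (fun x => \sum_(i <- s) f i x).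
Proof.
move=> cf; elim: s => [|i s IH].
  rewrite (_ : (fun x => _) = fun=> 0); first exact: contC.
  by apply/funext => x; rewrite big_nil.
rewrite (_ : (fun x => _) = fun x => f i x + \sum_(j <- s) f j x).
  by apply: contD.
by apply/funext => x; rewrite big_cons.
Qed.

Section Lebesgue.
Variables (R : realType) (X : topologicalType) (d : X -> X -> R).
Hypothesis dX : dist_for d.

Section Fun.
Variable U : set (set X).
Hypothesis Uc : open_cover U.

(** The Lebesgue number of the cover as a function of the point, bounded by 1. *)
Definition lebesgue (x : X) : R := sup [set distset d (~` A) x | A in U].

Let has_sup_leb x : has_sup [set distset d (~` A) x | A in U].
Proof.
split; last by exists 1 => _ [A _ <-]; exact: distset_le1.
have [_ cU] := Uc; have : [set: X] x by [].
by rewrite -cU => -[A UA _]; exists (distset d (~` A) x), A.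
Qed.

Lemma lebesgue_ge A x : U A -> distset d (~` A) x <= lebesgue x.
Proof. by move=> UA; apply: ub_le_sup; [case: (has_sup_leb x)|exists A]. Qed.

Lemma lebesgue_lt r x : r < lebesgue x -> exists2 A, U A & r < distset d (~` A) x.
Proof. by move=> /(sup_gt (has_sup_leb x).1) [_ [A UA <-] h]; exists A. Qed.

Lemma lebesgue_lip x y : `|lebesgue x - lebesgue y| <= d x y.
Proof.
suff h x' y' : lebesgue x' <= lebesgue y' + d x' y'.
  by rewrite ler_norml; have := h x y; have := h y x; rewrite (dist_sym dX y x); lra.
apply: ge_sup; first exact: (has_sup_leb x').1.
move=> _ [A UA <-]; have := lebesgue_ge y' UA.
by have := distset_lip dX (~` A) x' y'; rewrite ler_norml; lra.
Qed.

Lemma lebesgue_continuous : continuous lebesgue.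
Proof. by apply: (@lip_continuous _ _ _ dX _ 1) => x y; rewrite mul1r lebesgue_lip. Qed.

Lemma lebesgue_gt0 x : 0 < lebesgue x.
Proof.
have [oU cU] := Uc; have : [set: X] x by [].
rewrite -cU => -[A UA Ax]; apply: (lt_le_trans _ (lebesgue_ge x UA)).
by apply: distset_gt0 => //; exact: open_closedC (oU _ UA).
Qed.

End Fun.

Lemma ball_sub_distset A x y : d x y < distset d (~` A) x -> A y.
Proof.
move=> h; apply: contrapT => nA; move: h.
by rewrite ltNge (distset_le dX).
Qed.

(** Balls whose radius is an eighth of the Lebesgue number at their centre. Since this number is
    1-Lipschitz, a ball containing [z] has radius comparable with the number at [z]; all such balls
    lie within [lebesgue U z / 2] of [z], hence in one member of [U]. *)
Lemma barycentric U : open_cover U -> exists V, open_cover V /\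
  forall z : X, exists2 A, U A & forall B, V B -> B z -> B `<=` A.
Proof.
move=> Uc.
exists [set [set z | d x z < lebesgue U x / 8] | x in setT]; split.
  split.
    move=> _ [x _ <-]; rewrite openE => z hz; apply/(dist_nbhs dX).
    exists (lebesgue U x / 8 - d x z); first by rewrite subr_gt0.
    by move=> y hy /=; have := dist_tri dX x z y; rewrite /= in hz; lra.
  apply/seteqP; split=> // x _.
  exists [set z | d x z < lebesgue U x / 8]; first by exists x.
  by rewrite /= (dist_refl dX) divr_gt0// lebesgue_gt0.
move=> z; have l0 := lebesgue_gt0 Uc z.
have [|A UA hA] := @lebesgue_lt U Uc (lebesgue U z / 2) z; first lra.
exists A => // _ [x _ <-] /= xz w /= xw.
have := lebesgue_lip Uc x z; rewrite ler_norml => hl.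
have t := dist_tri dX z x w; rewrite (dist_sym dX z x) in t.
by apply: (@ball_sub_distset A z w); lra.
Qed.

(** A cover of order 3 need not be locally finite. Cutting the distance to the complement at half of
    the Lebesgue number repairs this: near [z] the function of [B] is positive only if [B] is deep
    enough to contain [z] itself, that is, for at most three members. *)
Lemma good_partition (U : set (set X)) : covering_dim_le X 2 -> open_cover U ->
  exists (W : set (set X)) (u : set X -> X -> R), [/\
    forall i, continuous (u i), forall i x, 0 <= u i x,
    forall i x, 0 < u i x -> W i /\ i x,
    forall z : X, exists s : seq (set X), [/\ uniq s, (size s <= 3)%N,
      forall i, i \in s -> W i /\ i z &
      \forall x \near z, (forall i, i \notin s -> u i x = 0) /\
        \sum_(i <- s) u i x = 1] &
    forall z : X, exists2 A, U A & forall i, W i -> i z -> i `<=` A].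
Proof.
move=> dimX Uc; have [V [Vc bV]] := barycentric Uc.
have [W [Wc WV W3]] := dimX V Vc; have [oW cW] := Wc.
pose T (x : X) : seq (set X) := finmap.enum_fset (fset_set [set B | W B /\ B x]).
have TP x i : (i \in T x) <-> W i /\ i x.
  have fin : finite_set [set B | W B /\ B x].
    by apply/finite_set_leP; exists 3%N; exact: W3.
  have -> : (i \in T x) = (i \in [set B | W B /\ B x]) := in_fset_set fin i.
  by split=> [/set_mem|/mem_set].
pose rho (B : set X) x := distset d (~` B) x.
pose M x := lebesgue W x.
pose e B x := Num.max 0 (rho B x - M x / 2).
have e0 B x : 0 <= e B x by rewrite le_max lexx.
have ec B : continuous (e B).
  apply: cont_max; first exact: contC.
  apply: contD; first exact: (distset_continuous dX).
  by apply: contN; apply: contM; [exact: lebesgue_continuous|exact: contC].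
have M0 x : 0 < M x := lebesgue_gt0 Wc x.
have e_pos B x : e B x != 0 -> M x / 2 < rho B x.
  rewrite ltNge; apply: contra => h; apply/eqP; rewrite /e max_l//; lra.
have rho_in B x : 0 < rho B x -> B x.
  by move=> h; apply: (@ball_sub_distset B x x); rewrite (dist_refl dX).
pose near_z (z : X) := [set x | d z x < M z / 8].
have near_zP z : nbhs z (near_z z) by apply: (near_dist dX); rewrite divr_gt0.
have e_near z x B : near_z z x -> W B -> e B x != 0 -> B \in T z.
  move=> hx WB /e_pos h; apply/TP; split=> //; apply: rho_in.
  have := distset_lip dX (~` B) z x; rewrite ler_norml -!/(rho _ _) => h1.
  have := lebesgue_lip Wc z x; rewrite ler_norml -!/(M _) => h2.
  by move: hx; rewrite /near_z /=; have := M0 z; lra.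
have e_mem x B : W B -> e B x != 0 -> B \in T x.
  move=> WB /e_pos h; apply/TP; split=> //; apply: rho_in; have := M0 x; lra.
pose E x := \sum_(B <- T x) e B x.
have E_near z x : near_z z x -> E x = \sum_(B <- T z) e B x.
  move=> hx; rewrite /E (bigID (fun B => e B x != 0)) /= [X in _ + X]big1; last first.
    by move=> B; rewrite negbK => /eqP.
  rewrite [RHS](bigID (fun B => e B x != 0)) /= [X in _ = _ + X]big1; last first.
    by move=> B; rewrite negbK => /eqP.
  congr (_ + _); rewrite -!(big_filter _ (fun B => e B x != 0)).
  apply: perm_big; apply: uniq_perm; rewrite ?filter_uniq ?finmap.fset_uniq// => B.
  rewrite !mem_filter; have [//|eB /=] := eqVneq (e B x) 0.
  apply/idP/idP => /TP [WB Bx]; [exact: e_near eB|exact: e_mem].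
have E0 x : 0 < E x.
  have [|B WB hB] := @lebesgue_lt W Wc (M x / 2) x; first by have := M0 x; rewrite /M; lra.
  have eB : 0 < e B x by rewrite lt_max subr_gt0 hB orbT.
  have BT : B \in T x by apply: e_mem => //; rewrite gt_eqF.
  rewrite /E (big_rem B)//=; apply: ltr_wpDr => //; exact: sumr_ge0.
pose u B x := if `[< W B >] then e B x / E x else 0.
have uW B x : 0 < u B x -> W B /\ B x.
  rewrite /u; case: asboolP => [WB h|]; last by rewrite ltxx.
  have eB : e B x != 0.
    by apply/eqP => eB; rewrite eB mul0r ltxx in h.
  exact/TP/e_mem.
exists W, u; split.
- move=> B z; rewrite /u; case: asboolP => WB; last exact: cvg_cst.
  have c : {for z, continuous (fun x => e B x / \sum_(A <- T z) e A x)}.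
    apply: cvgM; first exact: ec.
    apply: cvgV; first by rewrite gt_eqF// -/(E z).
    exact: cont_sum.
  apply: (@cts_at_eq _ _ _ (fun x => e B x / \sum_(A <- T z) e A x)) => //.
  by apply: filterS (near_zP z) => x hx; rewrite (E_near z x hx).
- move=> B x; rewrite /u; case: ifP => // _; apply: divr_ge0 => //; exact/ltW.
- exact: uW.
- move=> z; exists (T z); split.
  + exact: finmap.fset_uniq.
  + exact: (geq_card_fset_set (W3 z)).
  + by move=> B /TP.
  + apply: filterS (near_zP z) => x hx; split.
      move=> B BT; rewrite /u; case: asboolP => // WB.
      have [->|eB] := eqVneq (e B x) 0; first by rewrite mul0r.
      by rewrite (e_near z x B hx WB eB) in BT.
    rewrite (eq_big_seq (fun B => e B x * (E x)^-1)); last first.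
      by move=> B /TP [WB _]; rewrite /u; case: asboolP.
    by rewrite -mulr_suml -(E_near z x hx) divff// gt_eqF.
- move=> z; have [A UA hA] := bV z; exists A => // B WB Bz.
  have [B' VB' BB'] := WV B WB.
  by apply: (subset_trans BB'); apply: hA => //; exact: BB'.
Qed.

End Lebesgue.

Lemma large_weight (R : realType) (I : eqType) (s : seq I) (w : I -> R) :
  (size s <= 3)%N -> \sum_(i <- s) w i = 1 -> exists2 i, i \in s & 3^-1 <= w i.
Proof.
move=> s3 h; apply: contrapT => n.
have lt i : i \in s -> w i < 3^-1.
  by move=> si; rewrite ltNge; apply/negP => hi; apply: n; exists i.
case: s s3 h lt {n} => [|a [|b [|c [|]]]]//= _; rewrite ?big_cons big_nil ?addr0 => h lt.
- lra.
- by have := lt a (mem_head _ _); lra.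
- have := lt a (mem_head _ _); have := lt b; rewrite !inE eqxx orbT; move=> /(_ isT); lra.
- have := lt a (mem_head _ _); have := lt b; have := lt c.
  by rewrite !inE !eqxx !orbT => /(_ isT) ? /(_ isT); lra.
Qed.

(** * Fillable elements *)

Section Fillable.
Variables (R : realType) (X : topologicalType) (d : X -> X -> R) (gT : finGroupType).
Hypothesis dX : dist_for d.
Implicit Types (H N : {group gT}) (A : set X).

Lemma jump_in H g i j : g \in H -> jump g i j \in H.
Proof. by move=> gH; rewrite /jump; do 2?case: ifP => // _; rewrite ?groupV. Qed.

Lemma coherent_pair (I : choiceType) (c : I -> I -> gT) i j :
  (forall i, c i i = 1%g) -> (forall i j, c j i = (c i j)^-1%g) ->
  coherent c [:: i; j].
Proof.
move=> c1 cV; exists (fun k => c i k) => a b.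
rewrite !inE => /orP[] /eqP -> /orP[] /eqP ->; rewrite ?c1 ?mulg1 ?invg1 ?mul1g//.
by rewrite mulVg.
Qed.

(** Reversing the order of the vertices exchanges 0 and 2, hence inverts the monodromy. *)
Lemma fillableV H g : fillable X H g -> fillable X H g^-1.
Proof.
move=> hg C io cC C0 Cio.
have [||x i|c' [b [h1 h2 h3 h4]]] := hg (C \o @rev_ord 3) (@rev_ord 3 \o io).
- by move=> i; exact: cC.
- by move=> x h; apply: (C0 x) => i; have := h (rev_ord i); rewrite /= rev_ordK.
- by move=> /Cio h; rewrite /= rev_ordK.
have e : \bigcup_i (C \o @rev_ord 3) i = \bigcup_i C i.
  apply/seteqP; split=> x [i _ Cx]; first by exists (rev_ord i).
  by exists (rev_ord i) => //=; rewrite rev_ordK.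
have e2 i j : jump g (rev_ord (i : 'I_3)) (rev_ord (j : 'I_3)) = jump g^-1 i j.
  by case: i => [[|[|[|]]]]// ?; case: j => [[|[|[|]]]]// ?; rewrite /jump/= ?invgK.
exists c', b; split=> // z; rewrite -e => /h4 [V Vz h]; exists V => // x y.
by move=> Vx Vy Ax Ay; rewrite h//= e2.
Qed.

Lemma fillableJ H g x : x \in H -> fillable X H g -> fillable X H (g ^ x).
Proof.
move=> xH hg C io cC C0 Cio; have [c' [b [h1 h2 h3 h4]]] := hg C io cC C0 Cio.
exists c', (fun y => x^-1 * b y)%g; split=> //.
  by move=> y; rewrite groupM ?groupV ?h3.
move=> z /h4 [V Vz h]; exists V => // y w Vy Vw Ay Aw; rewrite h//.
have -> : jump (g ^ x) (io y) (io w) = (jump g (io y) (io w) ^ x)%g.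
  by rewrite /jump; do 2?case: ifP => // _; rewrite ?conjVg ?conj1g.
by rewrite conjgE invMg invgK !mulgA !mulgK.
Qed.

Lemma fillable_sub H N g : N \subset H -> fillable X N g -> fillable X H g.
Proof.
move=> /fintype.subsetP NH hg C io cC C0 Cio; have [c' [b [h1 h2 h3 h4]]] := hg C io cC C0 Cio.
by exists c', b; split=> // *; exact: NH.
Qed.

Lemma fillable1 H : fillable X H 1.
Proof.
move=> C io cC C0 Cio; exists (fun _ _ => 1%g), (fun=> 1%g); split=> //.
- by move=> z _; exists setT => //=; [exact: filterT|move=> *; rewrite mulg1].
- move=> z _; exists setT => //=; first exact: filterT.
  by move=> x y _ _ _ _; rewrite /jump !invg1 mul1g mulg1; do 2?case: ifP.
Qed.

(* At each point at most two of the three sets are present. *)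
Lemma jump_cocycle (g : gT) (C : 'I_3 -> set X) (io : X -> 'I_3) :
  (forall i, closed (C i)) -> (forall x, ~ forall i, C i x) ->
  (forall x i, C i x -> C (io x) x) ->
  cocycle_on (\bigcup_i C i) (fun x y => jump g (io x) (io y)).
Proof.
move=> cC C0 Cio z _.
have /existsNP [k nk] := C0 z.
exists (~` C k); first by apply: open_nbhs_nbhs; split=> //; exact: closed_openC.
have avoid x : (~` C k) x -> (\bigcup_i C i) x -> io x != k.
  by move=> nx [i _ /Cio h]; apply/eqP => e; rewrite e in h.
move=> x y w Vx Vy Vw Ax Ay Aw.
have := avoid _ Vx Ax; have := avoid _ Vy Ay; have := avoid _ Vw Aw.
case: k {nk avoid Vx Vy Vw} => [[|[|[|]]]]// ?;
 case: (io x) => [[|[|[|]]]]// ?; case: (io y) => [[|[|[|]]]]// ?;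
 case: (io w) => [[|[|[|]]]]// ?; rewrite /jump //= ?mulg1 ?mul1g ?mulgV ?mulVg //.
Qed.

(** Exchanging two vertices inverts the monodromy, up to conjugation in [H]; the two transpositions
    treated here generate all orders. *)
Lemma monodromy_perm H (I : choiceType) (c : I -> I -> gT) i j k :
  (forall i j, c j i = (c i j)^-1%g) -> (forall i j, c i j \in H) ->
  fillable X H (c i k * (c j k)^-1 * (c i j)^-1)%g ->
  fillable X H (c j k * (c i k)^-1 * (c j i)^-1)%g /\
  fillable X H (c i j * (c k j)^-1 * (c i k)^-1)%g.
Proof.
move=> cV cH h; split.
  have := fillableV (fillableJ (cH i j) h).
  by rewrite conjgE !invMg !invgK !mulgA mulVg mul1g (cV i j) invgK.
have := fillableV h.
by rewrite !invMg !invgK (cV j k) invgK !mulgA.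
Qed.

(* The disc is split into two discs: cone off the boundary triangle from an
   interior vertex, labelled 3. *)
Lemma fillableM H g1 g2 : g1 \in H -> g2 \in H ->
  fillable X H g1 -> fillable X H g2 -> fillable X H (g1 * g2).
Proof.
move=> gH hH fg fh C io cC C0 Cio.
pose A := \bigcup_i C i.
pose a (i : nat) x := distset d (C (inord i)) x.
have ac i : continuous (a i) by exact: (distset_continuous dX).
have a0 i x : 0 <= a i x := distset_ge0 dX _ x.
have aC i x : C (inord i) x -> a i x = 0 by exact: (distset0 dX).
have aN i x : ~ C (inord i) x -> 0 < a i x by exact: (distset_gt0 dX).
pose M x := Num.max (a 0%N x) (Num.max (a 1%N x) (a 2%N x)).
pose m x := Num.min (a 0%N x) (Num.min (a 1%N x) (a 2%N x)).
have Mc : continuous M by do 2?apply: cont_max.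
have mc : continuous m by do 2?apply: cont_min.
have aM i x : (i < 3)%N -> a i x <= M x.
  by case: i => [|[|[|]]]// _; rewrite !le_max lexx ?orbT.
have M_ex x : exists2 i, (i < 3)%N & a i x = M x.
  rewrite /M; case: (leP (a 1%N x) (a 2%N x)) => _.
    by case: (leP (a 0%N x) (a 2%N x)) => _; [exists 2%N|exists 0%N].
  by case: (leP (a 0%N x) (a 1%N x)) => _; [exists 1%N|exists 0%N].
have m_ex x : exists2 i, (i < 3)%N & a i x = m x.
  rewrite /m; case: (leP (a 1%N x) (a 2%N x)) => _.
    by case: (leP (a 0%N x) (a 1%N x)) => _; [exists 0%N|exists 1%N].
  by case: (leP (a 0%N x) (a 2%N x)) => _; [exists 0%N|exists 2%N].
have m_le i x : (i < 3)%N -> m x <= a i x.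
  by case: i => [|[|[|]]]// _; rewrite !ge_min lexx ?orbT.
have M0 x : 0 < M x.
  have /existsNP [i nCi] := C0 x.
  apply: lt_le_trans (aM i x (ltn_ord i)); apply: aN.
  by rewrite inord_val.
have m0 x : A x -> m x = 0.
  move=> [i _ Cx]; apply/eqP; rewrite eq_le; apply/andP; split.
    by apply: le_trans (m_le i x (ltn_ord i)) _; rewrite aC// inord_val.
  by have [k _ <-] := m_ex x.
(* Weights for the coned triangle: a corner counts near its closed set, and the interior vertex has
   weight [m], zero on [A]. A corner whose set is farthest has weight 0, so at most three weights
   are positive and the outer triangle 012 never occurs. *)
pose e (i : nat) x := if (i < 3)%N then Num.max 0 (M x / 2 - a i x)
  else if i == 3%N then m x else 0.
have ec i : continuous (e i).
  rewrite /e; case: (i < 3)%N; last by case: (i == 3%N) => //; exact: contC.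
  apply: cont_max; first exact: contC.
  by apply: contD; [apply: contM => //; exact: contC|exact: contN].
have e0 i x : 0 <= e i x.
  rewrite /e; case: ifP => _; first by rewrite le_max lexx.
  by case: ifP => _ //; have [k _ <-] := m_ex x.
have eM i x : (i < 3)%N -> M x / 2 <= a i x -> e i x = 0.
  by move=> i3 h; rewrite /e i3 max_l//; lra.
pose E x := \sum_(i <- iota 0 4) e i x.
have E0 x : 0 < E x.
  have [i [i4 ei]] : exists i, i \in iota 0 4 /\ 0 < e i x.
    have [i i3 im] := m_ex x; have [mp|mp] := ltP 0 (m x).
      by exists 3%N; split=> //; rewrite /e.
    exists i; split; first by rewrite mem_iota /= (ltn_trans i3).
    have ai := a0 i x; have Mp := M0 x.
    by rewrite /e i3 lt_max; apply/orP; right; lra.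
  by rewrite /E (big_rem i)//=; apply: ltr_wpDr => //; exact: sumr_ge0.
pose u i x := e i x / E x.
have uc i : continuous (u i).
  move=> x; apply: cvgM; first exact: ec.
  by apply: cvgV; [rewrite gt_eqF|exact: cont_sum].
have u0 i x : 0 <= u i x by apply: divr_ge0 => //; exact: ltW.
have u_e i x : 0 < u i x -> 0 < e i x.
  by rewrite pmulr_lgt0// invr_gt0.
have ugt i x : (4 <= i)%N -> u i x = 0.
  case: i => [|[|[|[|]]]]// i _; rewrite /u /e /= mul0r //.
have sumu x : \sum_(i <- iota 0 4) u i x = 1.
  by rewrite -mulr_suml -/(E x) divff// gt_eqF.
have j4 (j : nat) : (j < 3)%N -> j \in iota 0 4.
  by move=> j3; rewrite mem_iota /= (ltn_trans j3).
have out j i x : i \notin rem j (iota 0 4) -> u j x = 0 -> u i x = 0.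
  rewrite (mem_rem_uniq _ (iota_uniq _ _)) !inE negb_and negbK.
  move=> /orP[/eqP -> //|h] _; apply: ugt; rewrite leqNgt; apply: contra h.
  by case: i => [|[|[|[|]]]].
have uz (z : X) : exists2 j, (j < 3)%N & \forall x \near z, M x / 2 < a j x.
  have [j j3 aj] := M_ex z; exists j => //.
  have : cts_at (fun x => a j x - M x / 2) z.
    apply: (contD (ac j) _ : continuous _); apply: contN; apply: contM => //.
    exact: contC.
  move=> /cts_at_gt /(_ 0); rewrite aj; have Mz := M0 z.
  move=> /(_ ltac:(lra)); apply: filterS => x; lra.
have uj j x : (j < 3)%N -> M x / 2 < a j x -> u j x = 0.
  by move=> j3 h; rewrite /u eM ?mul0r//; exact: ltW.
have uloc (z : X) : exists s : seq nat, [/\ uniq s, (size s <= 3)%N &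
    \forall x \near z, forall i, i \notin s -> u i x = 0].
  have [j j3 h] := uz z; exists (rem j (iota 0 4)); split.
  - exact: rem_uniq (iota_uniq _ _).
  - by rewrite size_rem ?j4.
  - by apply: filterS h => x hx i /out; apply; exact: uj.
have io_ex x : exists i, 3^-1 <= u i x.
  have [j j3 /nbhs_singleton h] := uz x.
  have [||i _ hi] := @large_weight R _ (rem j (iota 0 4)) (fun i => u i x).
  - by rewrite size_rem ?j4.
  - by have := sumu x; rewrite (big_rem j) ?j4//= uj// add0r.
  - by exists i.
pose io' x := projT1 (cid (io_ex x)).
have io'P x : 3^-1 <= u (io' x) x := projT2 (cid (io_ex x)).
(* The edge 02 carries [g1 * g2], the edge 32 carries [g2], the others 1. The triangles 013, 123 and
   023 then have monodromies 1, [g2] and [g1^-1]. *)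
pose cc (i j : nat) : gT := (if (i < 3)%N && (j < 3)%N then jump (g1 * g2) i j
  else if (i == 2%N) && (j == 3%N) then g2^-1
  else if (i == 3%N) && (j == 2%N) then g2 else 1)%g.
have c1 i : cc i i = 1%g by case: i => [|[|[|[|]]]].
have cV i j : cc j i = (cc i j)^-1%g.
  by case: i => [|[|[|[|i]]]]; case: j => [|[|[|[|j]]]]; rewrite /cc /jump /= ?andbF /= ?invg1 ?invgK.
have cH i j : cc i j \in H.
  rewrite /cc; case: ifP => _; first by apply: jump_in; exact: groupM.
  by do 2?case: ifP => _; rewrite ?groupV.
pose Q i j k := fillable X H (cc i k * (cc j k)^-1 * (cc i j)^-1)%g.
have Qp i j k : Q i j k -> Q j i k /\ Q i k j by exact: monodromy_perm.
have Q6 i j k : Q i j k -> [/\ Q j i k, Q i k j, Q j k i & Q k i j /\ Q k j i].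
  move=> q; have [q1 q2] := Qp _ _ _ q.
  have [_ q3] := Qp _ _ _ q1; have [q4 _] := Qp _ _ _ q2.
  by have [q5 _] := Qp _ _ _ q3.
have Q013 : Q 0%N 1%N 3%N.
  by rewrite /Q /cc /jump /= !invg1 !mulg1; exact: fillable1.
have Q123 : Q 1%N 2%N 3%N by rewrite /Q /cc /jump /= invg1 invgK mulg1 mul1g.
have Q023 : Q 0%N 2%N 3%N.
  rewrite /Q /cc /jump /= invgK mul1g invMg mulKVg; exact: fillableV.
have [q1 q2 q3 [q4 q5]] := Q6 _ _ _ Q013.
have [q6 q7 q8 [q9 q10]] := Q6 _ _ _ Q123.
have [q11 q12 q13 [q14 q15]] := Q6 _ _ _ Q023.
have [|i j k us nc [x [ui uj' uk]]|x s Ax us|c' [c'H c'c c'A]] :=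
    @nerve_ext R X gT H nat u cc io' A uc uloc io'P cH.
- by move=> i j; exact: coherent_pair.
- have lt4 l : 0 < u l x -> (l < 4)%N.
    by move=> h'; rewrite ltnNge; apply/negP => /(ugt l x) h2; rewrite h2 ltxx in h'.
  have [l l3 ml] := M_ex x.
  have ul : u l x = 0.
    by apply: uj => //; rewrite ml; have := M0 x; lra.
  have nl i' : 0 < u i' x -> i' <> l by move=> h' e'; rewrite e' ul ltxx in h'.
  have := nl _ ui; have := nl _ uj'; have := nl _ uk.
  have := lt4 _ ui; have := lt4 _ uj'; have := lt4 _ uk.
  rewrite -/(Q i j k).
  case: i j k us {nc ui uj' uk} => [|[|[|[|]]]]// [|[|[|[|]]]]// [|[|[|[|]]]]// _ _ _ _;
    case: l l3 {ml ul nl} => [|[|[|]]]// _ //.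
- have [l l3 ml] := M_ex x.
  have ul : u l x = 0.
    by apply: uj => //; rewrite ml; have := M0 x; lra.
  have s3 : {subset s <= rem l [:: 0; 1; 2]%N}.
    move=> i si; have ui := us i si.
    have i3 : (i < 3)%N.
      rewrite ltnNge; apply/negP; rewrite leq_eqVlt => /predU1P[e3|i4].
        by have := u_e _ _ ui; rewrite -e3 /e /= m0// ltxx.
      by rewrite ugt// ltxx in ui.
    rewrite (mem_rem_uniq l (isT : uniq [:: 0; 1; 2]%N)) !inE.
    have -> : i != l by apply/eqP => e'; rewrite e' ul ltxx in ui.
    by case: i i3 {si ui} => [|[|[|]]].
  apply: (coherent_sub s3).
  by case: l l3 {ml ul s3} => [|[|[|]]]// _; rewrite /=; exact: coherent_pair.
exists c', (fun x => cc (io x) (io' x)); split=> // z Az.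
have [V Vz hV] := c'A z Az; have [j j3 hj] := uz z.
exists (V `&` [set x | M x / 2 < a j x]); first exact: filterI.
have two x : A x -> M x / 2 < a j x ->
    nat_of_ord (io x) \in rem j [:: 0; 1; 2]%N /\ io' x \in rem j [:: 0; 1; 2]%N.
  move=> Ax hx; rewrite !(mem_rem_uniq j (isT : uniq [:: 0; 1; 2]%N)) !inE; split.
    apply/andP; split; last by case: (io x) => [[|[|[|]]]].
    apply/eqP => e'; have [i _ /Cio Ci] := Ax.
    have : a j x = 0 by apply: aC; rewrite -e' inord_val.
    by have := M0 x; lra.
  have up := io'P x; have u3 : 0 < u (io' x) x.
    by apply: lt_le_trans up; rewrite invr_gt0 ltr0n.
  apply/andP; split.
    by apply/eqP => e'; rewrite e' uj// ltxx in u3.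
  have i3 : (io' x < 3)%N.
    rewrite ltnNge; apply/negP; rewrite leq_eqVlt => /predU1P[e3|i4].
      by have := u_e _ _ u3; rewrite -e3 /e /= m0// ltxx.
    by rewrite ugt// ltxx in u3.
  by case: (io' x) i3 => [|[|[|]]].
have coh : coherent cc (rem j [:: 0; 1; 2]%N).
  by case: j j3 {hj two} => [|[|[|]]]// _; rewrite /=; exact: coherent_pair.
move=> x y [Vx hx] [Vy hy] Ax Ay.
rewrite (hV x y)// invg1 mul1g mulg1 -cV.
have -> : jump (g1 * g2) (io x) (io y) = cc (io x) (io y) by rewrite /cc !ltn_ord.
have [x1 x2] := two x Ax hx; have [y1 y2] := two y Ay hy.
by rewrite (coherentM coh x2 x1 y1) (coherentM coh x2 y1 y2).
Qed.

End Fillable.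

(** * Lifting along group extensions *)

Section Lift.
Variables (R : realType) (X : topologicalType) (d : X -> X -> R).
Hypothesis dX : dist_for d.
Hypothesis dimX : covering_dim_le X 2.

Definition coset_lift (gT : finGroupType) (H N : {group gT}) (q : coset_of N) : gT :=
  if [pick h in H | (h \in 'N(N)%g) && (coset N h == q)] is Some h then h else 1%g.

Lemma coset_lift_in (gT : finGroupType) (H N : {group gT}) (q : coset_of N) :
  coset_lift H q \in H.
Proof. by rewrite /coset_lift; case: pickP => [h /and3P[]|_]; rewrite ?group1. Qed.

Lemma coset_liftK (gT : finGroupType) (H N : {group gT}) (q : coset_of N) :
  q \in (H / N)%g -> coset N (coset_lift H q) = q.
Proof.
move=> /morphimP[h hN hH e]; rewrite /coset_lift; case: pickP => [h' /and3P[_ _ /eqP]//|].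
by move=> /(_ h); rewrite /= hH hN /= -[coset_morphism N h]/(coset N h) -e eqxx.
Qed.

(* Over a nerve of dimension 2 a bundle with group [H / N] is lifted edge by
   edge; the monodromy around each triangle then lies in [N]. *)
Lemma lift_ext (gT : finGroupType) (H N : {group gT}) (A : set X)
    (c : X -> X -> gT) (e : X -> X -> coset_of N) :
  (N <| H)%g -> (forall g, g \in N -> fillable X H g) -> closed A ->
  (forall x y, c x y \in H) -> cocycle_on A c ->
  (forall x y, e x y \in (H / N)%g) -> cocycle_on setT e ->
  (forall z, A z -> exists2 V, nbhs z V & forall x y, V x -> V y -> A x -> A y ->
     coset N (c x y) = e x y) ->
  cocycle_ext H A c.
Proof.
move=> nNH fN cA cH cc eH ec ce.
have HN := normal_norm nNH.
have [[x0 _]|nX] := pselect (exists x : X, True); last first.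
  exists c, (fun=> 1%g); split=> // z; exfalso; apply: nX; [by exists z|by exists z].
have Vex (y : X) : exists V, [/\ open V, V y,
    forall x z w, V x -> V z -> V w -> (e x z * e z w)%g = e x w,
    A y -> forall x z w, V x -> V z -> V w -> A x -> A z -> A w ->
      (c x z * c z w)%g = c x w &
    (A y -> forall x z, V x -> V z -> A x -> A z -> coset N (c x z) = e x z) /\
    (~ A y -> forall x, V x -> ~ A x)].
  have [V1 n1 h1] := ec y Logic.I.
  have [V2 n2 [h2 [h3 h4]]] : exists2 V, nbhs y V & (A y -> forall x z w, V x -> V z -> V w ->
      A x -> A z -> A w -> (c x z * c z w)%g = c x w) /\
      ((A y -> forall x z, V x -> V z -> A x -> A z -> coset N (c x z) = e x z) /\
      (~ A y -> forall x, V x -> ~ A x)).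
    have [Ay|Ay] := pselect (A y).
      have [V2 n2 h2] := cc y Ay; have [V3 n3 h3] := ce y Ay.
      exists (V2 `&` V3); first exact: filterI.
      split; first by move=> _ x z w [? _] [? _] [? _]; exact: h2.
      by split=> // _ x z [_ ?] [_ ?]; exact: h3.
    exists (~` A); last by split=> //; split=> // _ x.
    by apply: open_nbhs_nbhs; split=> //; exact: closed_openC.
  have : nbhs y (V1 `&` V2) by exact: filterI.
  rewrite nbhsE => -[V [oV Vy] VV]; exists V; split=> //.
  - by move=> x z w /VV[? _] /VV[? _] /VV[? _]; exact: h1.
  - by move=> Ay x z w /VV[_ ?] /VV[_ ?] /VV[_ ?]; exact: h2.
  - split; first by move=> Ay x z /VV[_ ?] /VV[_ ?]; exact: h3.
    by move=> Ay x /VV[_ ?]; exact: h4.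
pose Vf y := projT1 (cid (Vex y)).
have VfP y := projT2 (cid (Vex y)).
have Uc : open_cover [set Vf y | y in setT].
  split; first by move=> _ [y _ <-]; have [] := VfP y.
  apply/seteqP; split=> // y _; exists (Vf y); first by exists y.
  by have [] := VfP y.
have [W [u [uc u0 uW uloc star]]] := good_partition dX dimX Uc.
(* The representative is taken in [A] as soon as the member meets [A]: over [A] the edges are then
   labelled by [c] itself, and the result restricts to [c] up to gauge. *)
pose pt (i : set X) : X :=
  if pselect (exists x, i x /\ A x) is left h then projT1 (cid h)
  else if pselect (exists x, i x) is left h then projT1 (cid h) else x0.
have ptP (i : set X) x : i x -> i (pt i) /\ (A x -> A (pt i)).
  rewrite /pt; case: pselect => [h ix|h ix].
    by case: (cid h) => y [/= iy Ay].
  case: pselect => [h'|[]]; last by exists x.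
  case: (cid h') => y /= iy; split=> // Ax; exfalso.
  by apply: h; exists x.
have starV z : exists y, forall i, W i -> i z -> i `<=` Vf y.
  by have [_ [y _ <-] h] := star z; exists y.
pose L i j := if `[< A (pt i) /\ A (pt j) >] then c (pt i) (pt j)
  else coset_lift H (e (pt i) (pt j)).
have LH i j : L i j \in H.
  by rewrite /L; case: ifP => _ //; exact: coset_lift_in.
have [o oP] := pair_orientation (set X).
pose k i j : gT := (if i == j then 1 else if o i j then L i j else (L j i)^-1)%g.
have kH i j : k i j \in H.
  by rewrite /k; do 2?case: ifP => _; rewrite ?group1 ?groupV.
have k1 i : k i i = 1%g by rewrite /k eqxx.
have kV i j : k j i = (k i j)^-1%g.
  rewrite /k [j == i]eq_sym; case: eqVneq => [_|ij]; first by rewrite invg1.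
  by rewrite oP//; case: (o i j); rewrite /= ?invgK.
have ptV z y i : (forall i, W i -> i z -> i `<=` Vf y) -> W i -> i z -> Vf y (pt i).
  by move=> h Wi iz; apply: (h i Wi iz); have [] := ptP i z iz.
have e1 y x : Vf y x -> e x x = 1%g.
  move=> Vx; have [_ _ h _ _] := VfP y; apply: (mulgI (e x x)).
  by rewrite mulg1; exact: h.
have eV y x z : Vf y x -> Vf y z -> e z x = (e x z)^-1%g.
  move=> Vx Vz; have [_ _ h _ _] := VfP y; apply/esym/eqP; rewrite eq_invg_mul.
  by rewrite (h x z x)// (e1 y).
have Ly z y i j : (forall i, W i -> i z -> i `<=` Vf y) -> W i -> i z -> W j -> j z ->
    coset N (L i j) = e (pt i) (pt j).
  move=> h Wi iz Wj jz; have Vi := ptV _ _ _ h Wi iz; have Vj := ptV _ _ _ h Wj jz.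
  rewrite /L; case: asboolP => [[Ai Aj]|_]; last exact: coset_liftK.
  have [_ _ _ _ [h1 h2]] := VfP y.
  have Ay : A y by apply: contrapT => /h2 /(_ _ Vi).
  exact: h1.
have ky z y i j : (forall i, W i -> i z -> i `<=` Vf y) -> W i -> i z -> W j -> j z ->
    coset N (k i j) = e (pt i) (pt j).
  move=> h Wi iz Wj jz; have Vi := ptV _ _ _ h Wi iz; have Vj := ptV _ _ _ h Wj jz.
  rewrite /k; case: eqVneq => [->|ij]; first by rewrite (e1 y)// morph1.
  case: ifP => _; first exact: (Ly z y).
  have LN : L j i \in 'N(N)%g by apply: (fintype.subsetP HN).
  by rewrite morphV// -[coset_morphism N _]/(coset N _) (Ly z y)// -(eV y).
have kA z i j : A z -> W i -> i z -> W j -> j z -> k i j = c (pt i) (pt j).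
  move=> Az Wi iz Wj jz; have [y h] := starV z.
  have Vi := ptV _ _ _ h Wi iz; have Vj := ptV _ _ _ h Wj jz.
  have Vz : Vf y z := h i Wi iz z iz.
  have [_ _ _ h1 [_ h2]] := VfP y.
  have Ay : A y by apply: contrapT => /h2 /(_ _ Vz).
  have [_ /(_ Az) Ai] := ptP i z iz; have [_ /(_ Az) Aj] := ptP j z jz.
  have cii : c (pt i) (pt i) = 1%g.
    by apply: (mulgI (c (pt i) (pt i))); rewrite mulg1; exact: h1.
  rewrite /k; case: eqVneq => [<-//|ij].
  have Lij : L i j = c (pt i) (pt j) by rewrite /L; case: asboolP => // -[].
  have Lji : L j i = c (pt j) (pt i) by rewrite /L; case: asboolP => // -[].
  rewrite Lij Lji; case: ifP => // _; apply/eqP; rewrite eq_invg_mul.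
  rewrite h1//; apply/eqP; apply: (mulgI (c (pt j) (pt j))).
  by rewrite mulg1; exact: h1.
have io_ex x : exists i, 3^-1 <= u i x.
  have [s [_ s3 _ h]] := uloc x; have [_ sum] := nbhs_singleton h.
  by have [i _ hi] := large_weight s3 sum; exists i.
pose io x := projT1 (cid (io_ex x)).
have ioP x : 3^-1 <= u (io x) x := projT2 (cid (io_ex x)).
have io0 x : 0 < u (io x) x.
  by apply: lt_le_trans (ioP x); rewrite invr_gt0 ltr0n.
have [||i j l us _ [x [ui uj ul]]|x s Ax us|c' [c'H c'c c'A]] :=
    @nerve_ext R X gT H (set X) u k io A uc _ ioP kH.
- by move=> z; have [s [us s3 _ h]] := uloc z; exists s; split=> //;
    apply: filterS h => x [].
- by move=> i j; exact: coherent_pair.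
- have [Wi ix] := uW _ _ ui; have [Wj jx] := uW _ _ uj; have [Wl lx] := uW _ _ ul.
  have [y h] := starV x.
  have [Vi Vj Vl] : [/\ Vf y (pt i), Vf y (pt j) & Vf y (pt l)].
    by split; exact: ptV h _ _.
  have inN v : v \in H -> v \in 'N(N)%g by exact: (fintype.subsetP HN).
  apply: fN; apply: coset_idr; first by rewrite inN// !groupM ?groupV.
  rewrite !morphM ?inN ?groupM ?groupV// !morphV ?inN//.
  have cm v : coset_morphism N v = coset N v by [].
  rewrite !cm !(ky x y)//.
  have [_ _ hc _ _] := VfP y.
  by rewrite -(eV y)// -(eV y)// !hc// (e1 y).
- have [y h] := starV x.
  have Wx i : i \in s -> W i /\ i x by move=> /us /uW.
  exists (fun i => c x (pt i)) => i j /Wx[Wi ix] /Wx[Wj jx].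
  rewrite (kA x)//.
  have Vi := ptV _ _ _ h Wi ix; have Vj := ptV _ _ _ h Wj jx.
  have Vx : Vf y x := h i Wi ix x ix.
  have [_ _ _ h1 [_ h2]] := VfP y.
  have Ay : A y by apply: contrapT => /h2 /(_ _ Vx).
  have [_ /(_ Ax) Ai] := ptP i x ix; have [_ /(_ Ax) Aj] := ptP j x jx.
  by apply: (mulgI (c x (pt i))); rewrite mulKVg; exact: h1.
exists c', (fun x => c x (pt (io x))); split=> //.
move=> z Az; have [V Vz hV] := c'A z Az.
have [s [us s3 sz hs]] := uloc z; have [y h] := starV z.
exists (V `&` [set x | (forall i, i \notin s -> u i x = 0) /\ \sum_(i <- s) u i x = 1]).
  exact: filterI.
have ins x : (forall i, i \notin s -> u i x = 0) -> W (io x) /\ (io x) z.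
  move=> hx; apply: sz; apply: contraT => /hx e'.
  by have := io0 x; rewrite e' ltxx.
move=> x w [Vx [hx _]] [Vw [hw _]] Ax Aw; rewrite (hV x w)// invg1 mul1g mulg1.
have [Wx ixz] := ins x hx; have [Ww iwz] := ins w hw.
rewrite (kA z)//.
have Vi := ptV _ _ _ h Wx ixz; have Vj := ptV _ _ _ h Ww iwz.
have [_ ixx] := uW _ _ (io0 x); have [_ iww] := uW _ _ (io0 w).
have Vyx : Vf y x := h _ Wx ixz x ixx.
have Vyw : Vf y w := h _ Ww iwz w iww.
have [_ _ _ h1 [_ h2]] := VfP y.
have Ay : A y by apply: contrapT => /h2 /(_ _ Vyx).
have [_ /(_ Ax) Ai] := ptP _ _ ixx; have [_ /(_ Aw) Aj] := ptP _ _ iww.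
by apply: (mulgI (c x (pt (io x)))); rewrite -mulgA mulKVg !h1.
Qed.

Definition fillable_group (gT : finGroupType) (H : {group gT}) :=
  forall g, g \in H -> fillable X H g.

Lemma fillable_group_morphim (aT rT : finGroupType) (D : {group aT})
    (f : {morphism D >-> rT}) (H : {group aT}) :
  H \subset D -> fillable_group H -> fillable_group (f @* H)%G.
Proof.
move=> /fintype.subsetP HD fH g /morphimP[h hD hH ->] C io cC C0 Cio.
have [c' [b [c'H c'c bH cb]]] := fH h hH C io cC C0 Cio.
exists (fun x y => f (c' x y)), (fun x => f (b x)); split.
- by move=> x y; apply: mem_morphim => //; exact: HD.
- move=> z _; have [V Vz hV] := c'c z Logic.I; exists V => // x y w Vx Vy Vw _ _ _.
  by rewrite -morphM ?HD// hV.
- by move=> x; apply: mem_morphim => //; exact: HD.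
- move=> z Az; have [V Vz hV] := cb z Az; exists V => // x y Vx Vy Ax Ay.
  have jH : jump h (io x) (io y) \in D by apply: HD; exact: jump_in.
  rewrite hV// !morphM ?groupM ?groupV ?HD//; last 2 first.
    by exact: jump_in.
    by exact: jump_in.
  congr (_ * _ * _)%g; first exact: (morphV f (HD _ (bH x))).
  by rewrite /jump; do 2?case: ifP => _; rewrite ?morphV ?morph1.
Qed.

(** The bundle is first extended modulo [N]. Lifting the gauge of this extension to [H] changes the
    given cocycle into one that reduces exactly to [e], as [lift_ext] requires. *)
Lemma fillable_group_ext (gT : finGroupType) (H N : {group gT}) :
  (N <| H)%g -> fillable_group N -> fillable_group (H / N)%G -> fillable_group H.
Proof.
move=> nNH fN fQ g gH C io cC C0 Cio.
have HN := fintype.subsetP (normal_norm nNH).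
have [e [b [eH ec bH be]]] := fQ (coset N g) (mem_quotient N gH) C io cC C0 Cio.
pose w x := coset_lift H (b x).
have wH x : w x \in H := coset_lift_in _ _.
pose c x y := ((w x)^-1 * jump g (io x) (io y) * w y)%g.
have cH x y : c x y \in H by rewrite !groupM ?groupV ?jump_in.
have [||||c' [b' [c'H c'c b'H cb]]] :=
    @lift_ext gT H N (\bigcup_i C i) c e nNH _ _ cH _ eH ec _.
- by move=> n nN; apply: fillable_sub (normal_sub nNH) _; exact: fN.
- exact: closed_bigcup_ord.
- move=> z Az; have [V Vz hV] := jump_cocycle g cC C0 Cio Az.
  exists V => // x y t Vx Vy Vt Ax Ay At.
  by rewrite /c -(hV x y t)// !mulgA mulgK.
- move=> z Az; have [V Vz hV] := be z Az; exists V => // x y Vx Vy Ax Ay.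
  have jN : jump g (io x) (io y) \in 'N(N)%g by apply: HN; exact: jump_in.
  rewrite hV// /c !morphM ?groupM ?groupV ?HN//.
  rewrite -?[coset_morphism N _]/(coset N _) ?jump_in//; congr (_ * _ * _)%g.
  - rewrite -[RHS](congr1 _ (coset_liftK (bH x))).
    exact: (morphV (coset_morphism N) (HN _ (wH x))).
  - have gN := HN _ gH.
    rewrite /jump; do 2?case: ifP => _ //; last exact: (morph1 (coset_morphism N)).
    exact: (morphV (coset_morphism N) gN).
  - by rewrite coset_liftK.
  - exact: jump_in.
  - exact: jump_in.
exists c', (fun x => w x * b' x)%g; split=> //.
  by move=> x; rewrite groupM.
move=> z Az; have [V Vz hV] := cb z Az; exists V => // x y Vx Vy Ax Ay.
by rewrite hV// /c invMg !mulgA.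
Qed.

Lemma fillable_group_gen (gT : finGroupType) (A : {set gT}) :
  (forall x, x \in A -> fillable_group <[x]>%G) -> fillable_group <<A>>%G.
Proof.
move=> fA g /gen_prodgP [n [f fA' ->]].
elim: n f fA' => [|n IH] f fA'; first by rewrite big_ord0; exact: fillable1.
have inG i : f i \in <<A>>%G by apply: mem_gen.
rewrite big_ord_recl; apply: (fillableM dX) => //.
- by apply: group_prod.
- apply: (@fillable_sub _ _ _ <[f ord0]>%G).
    by rewrite cycle_subG.
  by apply: fA => //; exact: cycle_id.
- by apply: IH => i; exact: fA'.
Qed.

End Lift.

(** * Solvable groups *)

Section Solvable.
Variables (R : realType) (X : topologicalType) (d : X -> X -> R).
Hypothesis dX : dist_for d.
Hypothesis dimX : covering_dim_le X 2.

Lemma fillable_group_quotient (gT : finGroupType) (G N : {group gT}) :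
  G \subset 'N(N)%g -> fillable_group X G -> fillable_group X (G / N)%G.
Proof. by move=> GN; exact: (fillable_group_morphim (f := coset_morphism N)). Qed.

Lemma fillable_group_isog (aT rT : finGroupType) (G : {group aT}) (H : {group rT}) :
  (G \isog H)%g -> fillable_group X G -> fillable_group X H.
Proof.
move=> /isogP [f _ fG] hG.
have := fillable_group_morphim (f := f) (fintype.subxx G) hG.
have e : (f @* G)%G = H :> {group rT} by apply/val_inj; rewrite /= fG.
by rewrite e.
Qed.

Lemma fillable_group_prime (aT rT : finGroupType) (A : {group aT}) (C : {group rT}) :
  solvable A -> prime #|C| -> (#|C|.-group A)%g -> A :!=: 1%g ->
  fillable_group X A -> fillable_group X C.
Proof.
move=> sA pC pA ntA fA; have [M nM pM] := sol_prime_factor_exists sA ntA.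
have iM : #|A : M|%g = #|C|.
  have /andP[_ /allP h] := pnat_dvd (dvdn_indexg A M) pA.
  by apply/eqP/h; rewrite primes_prime// inE.
have cQ : #|(A / M)%g| = #|C| by rewrite card_quotient ?normal_norm.
apply: (@fillable_group_isog _ _ (A / M)%G); last first.
  exact: fillable_group_quotient (normal_norm nM) fA.
by rewrite isog_cyclic_card ?prime_cyclic ?cQ//= eqxx.
Qed.

(** The quotient of [A] by its [p']-core is a nontrivial [p]-group, hence has a quotient of order
    [p]. *)
Lemma fillable_group_prime_dvd (aT rT : finGroupType) (A : {group aT}) (C : {group rT}) :
  prime #|C| -> (#|C| %| #|A|)%N -> abelian A ->
  fillable_group X A -> fillable_group X C.
Proof.
set p := #|C| => pC pA cA fA; pose N := 'O_p^'(A)%G.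
have nN : A \subset 'N(N)%g := normal_norm (pcore_normal _ _).
have cN : #|N| = ((#|A|)`_(p^'))%N.
  by apply: card_Hall; apply: nilpotent_pcore_Hall; exact: abelian_nil.
have iN : #|(A / N)%g| = ((#|A|)`_p)%N.
  rewrite card_quotient//; apply/eqP; rewrite -(eqn_pmul2l (cardG_gt0 N)).
  by rewrite Lagrange ?pcore_sub// cN mulnC partnC.
apply: (@fillable_group_prime _ _ (A / N)%G) => //.
- by apply: abelian_sol; exact: quotient_abelian.
- by rewrite /pgroup iN part_pnat.
- rewrite -cardG_gt1 iN p_part -[X in (X < _)%N](expn0 p) ltn_exp2l ?prime_gt1//.
  by rewrite logn_gt0 mem_primes pC cardG_gt0.
- exact: fillable_group_quotient.
Qed.

(** Induction on the order of [x]: the cyclic group is an extension of a group of order [p] by the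
    one generated by [x ^+ p]. *)
Lemma fillable_group_cycle (gT : finGroupType) p (x : gT) :
  (forall (rT : finGroupType) (C : {group rT}), #|C| = p -> fillable_group X C) ->
  prime p -> p.-elt%g x -> fillable_group X <[x]>%G.
Proof.
move=> hp pp; have [n] := ubnP #[x]%g; elim: n x => // n IH x xn px.
have [->|nt] := eqVneq x 1%g.
  move=> g; rewrite /= cycle1 => /set1P ->; exact: fillable1.
have px1 : (p %| #[x]%g)%N.
  have [k kE] := p_natP px; rewrite kE dvdn_exp// lt0n; apply: contra nt => /eqP k0.
  by rewrite -order_eq1 kE k0.
have ox : #[x ^+ p]%g = (#[x]%g %/ p)%N by exact: orderXdiv.
have nN : (<[x ^+ p]> <| <[x]>)%g.
  by rewrite -sub_abelian_normal ?cycle_abelian ?cycle_subG ?mem_cycle.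
apply: (fillable_group_ext dX dimX nN).
  apply: IH; last by rewrite /p_elt ox; apply: pnat_dvd px; exact: dvdn_div.
  rewrite ox; rewrite ltnS in xn; apply: leq_trans xn; apply: ltn_Pdiv; rewrite ?prime_gt1//.
apply: hp; rewrite card_quotient ?normal_norm// -divgS ?normal_sub// -!orderE ox.
by rewrite divnA// mulKn// order_gt0.
Qed.

(* The elements of [G] whose order is a power of a prime dividing [G : G'] generate
   [G]: the subgroup they generate contains a Sylow subgroup for each of these
   primes, whereas a proper normal subgroup of a solvable group lies in a
   normal subgroup whose index is one of them. *)
Lemma fillable_group_abelianization (gT : finGroupType) (G : {group gT}) :
  solvable G -> fillable_group X (abelianization G) -> fillable_group X G.
Proof.
move=> sG fA.
pose P := [set x in G | [exists p : 'I_#|G|.+1,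
  [&& prime p, (p %| #|abelianization G|)%N & p.-elt%g x]]].
have PG : <<P>>%g \subset G by rewrite gen_subG; apply/fintype.subsetP=> x; rewrite inE => /andP[].
have fH : fillable_group X <<P>>%G.
  apply: (fillable_group_gen dX) => x; rewrite inE => /andP[xG /existsP[p /and3P[pp pA px]]].
  apply: (@fillable_group_cycle _ p) => // rT C oC.
  apply: (@fillable_group_prime_dvd _ _ (abelianization G)); rewrite ?oC//.
  by rewrite /abelianization /=; apply: (@sub_der1_abelian _ G ([~: G, G])%G); rewrite derg1.
have nP : (<<P>> <| G)%g.
  rewrite /normal PG /=; apply: norms_gen; apply/fintype.subsetP=> g gG; rewrite inE.
  apply/fintype.subsetP=> _ /imsetP[x xP ->]; move: xP; rewrite !inE groupJr//.
  move=> /andP[-> /existsP[p /and3P[pp pA px]]]; apply/existsP; exists p.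
  by rewrite pp pA p_eltJ.
suff e : <<P>>%G = G by rewrite -e.
apply/val_inj/eqP; rewrite /= finset.eqEsubset PG /= -quotient_sub1 ?normal_norm//.
apply: contraT; rewrite subG1 => ntQ.
have sQ : solvable (G / <<P>>)%G by exact: quotient_sol.
have [Mb nMb pM] := sol_prime_factor_exists sQ ntQ.
have [M eM PM nM] := inv_quotientN nP nMb; move: pM; rewrite eM.
have GPM : (G :&: <<P>>%G \subset M)%g.
  exact: fintype.subset_trans (finset.subsetIr _ _) PM.
rewrite (index_quotient_eq GPM (normal_sub nM) (normal_norm nP)).
set q := #|G : M|%g => pq.
have cQ : #|(G / M)%g| = q by rewrite card_quotient ?normal_norm.
have GM : ([~: G, G] \subset M)%g.
  rewrite -derg1; apply: der1_min (normal_norm nM) _.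
  by apply: cyclic_abelian; apply: prime_cyclic; rewrite cQ.
have qA : (q %| #|abelianization G|)%N.
  rewrite card_quotient; last exact: (der_norm 1).
  exact: indexgS.
have qG : (q < #|G|.+1)%N by rewrite ltnS dvdn_leq ?dvdn_indexg.
have [Q sylQ] := Sylow_exists q G.
have QM : Q \subset M.
  apply: fintype.subset_trans PM; apply/fintype.subsetP=> x xQ; apply: mem_gen; rewrite inE.
  rewrite (fintype.subsetP (pHall_sub sylQ))//=; apply/existsP; exists (Ordinal qG).
  by rewrite /= pq qA (mem_p_elt (pHall_pgroup sylQ)).
have := pHall_sub sylQ; move: sylQ => /and3P[_ _ h] QG.
have qi : (q %| #|G : Q|%g)%N by apply: indexgS.
by move: (pnat_dvd qi h); rewrite pnatE// !inE eqxx.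
Qed.

End Solvable.

(** * Measures of finite support *)

(* Weighted finite families of points, as positive measures of finite support (the
   weight of an atom is the absolute value of the coefficient), with the
   distance dual to the functions to [0, 1] that are 1-Lipschitz for [d]. A
   metric space embeds in it as the set of Dirac measures, and neighbouring
   Dirac measures are joined by segments and triangles. *)
Definition wpoints (R : realType) (X : choiceType) (d : X -> X -> R) := seq (R * X).

HB.instance Definition _ (R : realType) (X : choiceType) (d : X -> X -> R) :=
  Choice.on (wpoints d).

Section WDist.
Variables (R : realType) (X : choiceType) (d : X -> X -> R).
Implicit Types (m n k : wpoints d) (f g : X -> R).

Definition ev f m : R := \sum_(p <- m) `|p.1| * f p.2.

(** The absolute value around [d x y] puts the constants among the test functions for every [d], so
    that the topology on [wpoints d] can be declared before [d] is known to be a distance. *)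
Definition lip1 f := (forall x, 0 <= f x <= 1) /\ (forall x y, `|f x - f y| <= `|d x y|).

Definition wdist m n : R := sup [set `|ev f m - ev f n| | f in lip1].

Definition dirac x : wpoints d := [:: (1, x)].

Lemma ev_ge0 f m : (forall x, 0 <= f x) -> 0 <= ev f m.
Proof. by move=> f0; rewrite /ev sumr_ge0// => p _; rewrite mulr_ge0. Qed.

Lemma ev_le f g m : (forall x, f x <= g x) -> ev f m <= ev g m.
Proof. by move=> fg; apply: ler_sum => p _; rewrite ler_wpM2l. Qed.

Lemma ev_dirac f x : ev f (dirac x) = f x.
Proof. by rewrite /ev big_seq1 normr1 mul1r. Qed.

Lemma lip1_0 : lip1 (fun=> 0).
Proof. by split=> *; rewrite ?subrr ?normr0 ?lexx ?ler01 ?normr_ge0. Qed.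

Lemma lip1_1 : lip1 (fun=> 1).
Proof. by split=> *; rewrite ?subrr ?normr0 ?lexx ?ler01 ?normr_ge0. Qed.

Let wdist_sup m n : has_sup [set `|ev f m - ev f n| | f in lip1].
Proof.
split; first by exists `|ev (fun=> 0) m - ev (fun=> 0) n|; exists (fun=> 0) => //; exact: lip1_0.
exists (ev (fun=> 1) m + ev (fun=> 1) n) => _ [f [f01 _] <-].
have f0 x : 0 <= f x by case/andP: (f01 x).
have f1 x : f x <= 1 by case/andP: (f01 x).
have := ev_ge0 m f0; have := ev_ge0 n f0; have := ev_le m f1; have := ev_le n f1.
by move=> *; rewrite ler_norml; apply/andP; split; lra.
Qed.

Lemma wdist_ub m n f : lip1 f -> `|ev f m - ev f n| <= wdist m n.
Proof. by move=> hf; apply: ub_le_sup; [case: (wdist_sup m n)|exists f]. Qed.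

Lemma wdist_le m n r : (forall f, lip1 f -> `|ev f m - ev f n| <= r) -> wdist m n <= r.
Proof. by move=> h; apply: ge_sup; [case: (wdist_sup m n)|move=> _ [f hf <-]; exact: h]. Qed.

Lemma wdist_ge0 m n : 0 <= wdist m n.
Proof. exact: le_trans (normr_ge0 _) (wdist_ub m n lip1_0). Qed.

Lemma wdist_eq0 m n : (forall f, ev f m = ev f n) -> wdist m n = 0.
Proof.
move=> h; apply/eqP; rewrite eq_le wdist_ge0 andbT.
by apply: wdist_le => f _; rewrite h subrr normr0.
Qed.

Lemma wdist_refl m : wdist m m = 0. Proof. exact: wdist_eq0. Qed.

Lemma wdist_sym m n : wdist m n = wdist n m.
Proof. by apply/eqP; rewrite eq_le !wdist_le// => f hf; rewrite distrC wdist_ub. Qed.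

Lemma wdist_tri m n k : wdist m k <= wdist m n + wdist n k.
Proof.
apply: wdist_le => f hf; have := wdist_ub m n hf; have := wdist_ub n k hf.
rewrite !ler_norml => /andP[? ?] /andP[? ?]; apply/andP; split; lra.
Qed.

End WDist.

Section WTopology.
Variables (R : realType) (X : choiceType) (d : X -> X -> R).

Definition wnbhs (m : wpoints d) : set_system (wpoints d) :=
  [set V | exists2 e, 0 < e & forall n, wdist m n < e -> V n].

HB.instance Definition _ := hasNbhs.Build (wpoints d) wnbhs.

Let wnbhs_filter (m : wpoints d) : ProperFilter (nbhs m).
Proof.
split; first by move=> [e e0 /(_ m)]; rewrite wdist_refl; exact.
split; first by exists 1.
- move=> P Q [e e0 he] [e' e'0 he']; exists (Num.min e e'); first by rewrite lt_min e0.
  by move=> n; rewrite lt_min => /andP[/he ? /he' ?].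
- by move=> P Q PQ [e e0 he]; exists e => // n /he /PQ.
Qed.

Let wnbhs_singleton (m : wpoints d) (V : set (wpoints d)) : nbhs m V -> V m.
Proof. by move=> [e e0]; apply; rewrite wdist_refl. Qed.

Let wnbhs_nbhs (m : wpoints d) (V : set (wpoints d)) : nbhs m V -> nbhs m (nbhs^~ V).
Proof.
move=> [e e0 he]; exists (e / 2); first by rewrite divr_gt0.
move=> n mn; exists (e / 2); first by rewrite divr_gt0.
by move=> k nk; apply: he; have := wdist_tri m n k; lra.
Qed.

HB.instance Definition _ := Nbhs_isNbhsTopological.Build (wpoints d)
  wnbhs_filter wnbhs_singleton wnbhs_nbhs.

Lemma wdist_dist_for : dist_for (@wdist R X d).
Proof.
split=> //; [exact: wdist_refl|exact: wdist_sym|exact: wdist_tri].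
Qed.

End WTopology.

Section Dirac.
Variables (R : realType) (X : topologicalType) (d : X -> X -> R).
Hypothesis dX : dist_for d.

Let wX := wdist_dist_for d.

Lemma ev_cts f : lip1 d f -> continuous (ev f : wpoints d -> R).
Proof.
move=> hf; apply: (lip_continuous wX (C := 1)) => m n.
by rewrite mul1r wdist_ub.
Qed.

Lemma distset_lip1 A : lip1 d (distset d A).
Proof.
split=> [x|x y]; first by rewrite distset_ge0// distset_le1.
by apply: le_trans (distset_lip dX _ _ _) _; exact: ler_norm.
Qed.

Lemma wdist_near_dirac (m : wpoints d) z e : 0 <= e -> \sum_(p <- m) `|p.1| = 1 ->
  (forall p, p \in m -> d z p.2 <= e) -> wdist m (dirac d z) <= e.
Proof.
move=> e0 m1 hm; apply: wdist_le => f [f01 flip]; rewrite ev_dirac.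
rewrite -[f z]mul1r -m1 mulr_suml /ev -sumrB.
apply: le_trans (ler_norm_sum _ _ _) _; rewrite -[e]mul1r -m1 mulr_suml.
rewrite big_seq [leRHS]big_seq; apply: ler_sum => p pm.
rewrite -mulrBr normrM normr_id ler_wpM2l// distrC.
by apply: le_trans (flip _ _) _; rewrite ger0_norm ?hm// (dist_ge0 dX).
Qed.

(** Local convexity at the Dirac measures: averages of points near [z] are near the Dirac measure at
    [z]. This puts the segments and triangles with vertices near [z] inside [U]. *)
Lemma near_dirac (U : set (wpoints d)) z : nbhs (dirac d z) U ->
  exists2 V, nbhs z V & forall m : wpoints d, (forall p, p \in m -> V p.2) ->
    \sum_(p <- m) `|p.1| = 1 -> U m.
Proof.
move=> [e e0 he]; exists [set x | d z x < e / 2].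
  by apply: near_dist => //; rewrite divr_gt0.
move=> m hm m1; apply: he; rewrite wdist_sym.
apply: (@le_lt_trans _ _ (e / 2)); last by lra.
by apply: wdist_near_dirac => // [|p /hm/ltW//]; rewrite divr_ge0// ltW.
Qed.

Lemma wdist0_eq (K : topologicalType) (F : wpoints d -> K) m n : hausdorff_space K ->
  cts_at F m -> wdist m n = 0 -> F n = F m.
Proof.
move=> hK Fm mn; apply: hK => V W nV mW.
have [e e0 he] := Fm _ mW; exists (F n); split; first exact: nbhs_singleton.
by apply: he; rewrite mn.
Qed.

(* [wpoints d] is not separated: a Dirac measure has many representatives, and
   only the set of all of them is closed. *)
Definition diracs (A : set X) : set (wpoints d) :=
  [set m | exists2 x, A x & wdist m (dirac d x) = 0].

Lemma diracs_dirac (A : set X) x : A x -> diracs A (dirac d x).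
Proof. by move=> Ax; exists x => //; exact: wdist_refl. Qed.

Lemma dist_lip1 x : lip1 d (fun y => Num.min (d x y) 1).
Proof.
split=> [y|y z]; first by rewrite le_min (dist_ge0 dX) ler01 ge_min lexx orbT.
have d1 := dist_tri dX x y z; have d2 := dist_tri dX x z y.
have d3 := dist_sym dX z y; have d4 := dist_ge0 dX y z.
rewrite ler_norml; have := ler_norm (d y z).
have [] := leP (d x y) 1; have [] := leP (d x z) 1 => *; apply/andP; split; lra.
Qed.

Lemma wdist_dirac x y : Num.min (d x y) 1 <= wdist (dirac d x) (dirac d y).
Proof.
have := wdist_ub (dirac d x) (dirac d y) (dist_lip1 x).
rewrite !ev_dirac (dist_refl dX) => h; apply: le_trans h.
rewrite [Num.min 0 1]min_l ?ler01// sub0r normrN; exact: ler_norm.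
Qed.

Lemma dirac_lip x y : wdist (dirac d x) (dirac d y) <= d x y.
Proof.
apply: wdist_near_dirac; rewrite ?(dist_ge0 dX) ?big_seq1 ?normr1// => p.
by rewrite inE => /eqP -> /=; rewrite dist_sym.
Qed.

(** A limit [m] of Dirac measures is not 0, so it has an atom [p] of positive weight. Testing
    against the truncated distance functions forces the approximating points to converge to [p.2],
    which then lies in [A] and represents [m]. *)
Lemma closed_diracs (A : set X) : closed A -> closed (diracs A).
Proof.
move=> cA m mA.
have h e : 0 < e -> exists2 y, A y & wdist m (dirac d y) < e.
  move=> e0; have [n [[x Ax nx] mn]] : diracs A `&` [set n | wdist m n < e] !=set0.
    by apply: mA; exists e.
  by exists x => //; have := wdist_tri m n (dirac d x); rewrite nx; rewrite /= in mn; lra.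
have [p pm p1] : exists2 p, p \in m & 0 < `|p.1|.
  apply: contrapT => hn; have [y Ay] := h 1 ltr01.
  have := wdist_ub m (dirac d y) (lip1_1 d); rewrite ev_dirac.
  have -> : ev (fun=> 1) m = 0.
    rewrite /ev big_seq big1// => p pm; apply/eqP; rewrite mulr1 -normr_le0 normr_id.
    by rewrite leNgt; apply/negP => p1; apply: hn; exists p.
  by rewrite sub0r normrN normr1; lra.
have hp e y : wdist m (dirac d y) < e -> `|p.1| * Num.min (d y p.2) 1 < e.
  have := wdist_ub m (dirac d y) (dist_lip1 y); rewrite ev_dirac (dist_refl dX).
  rewrite [Num.min 0 1]min_l ?ler01// subr0 => h1 h2.
  apply: le_lt_trans h2; apply: le_trans h1; apply: le_trans (ler_norm _).
  rewrite /ev (big_rem p)//= lerDl sumr_ge0// => q _; rewrite mulr_ge0// le_min.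
  by rewrite (dist_ge0 dX) ler01.
have hd e : 0 < e -> e < 1 -> exists y, [/\ A y, d y p.2 < e & wdist m (dirac d y) < e].
  move=> e0 e1; have e'0 : 0 < Num.min e (`|p.1| * e) by rewrite lt_min e0 mulr_gt0.
  have [y Ay my] := h _ e'0; exists y; split=> //.
    have := hp _ _ my; rewrite lt_min => /andP[_]; rewrite ltr_pM2l//.
    by rewrite gt_min => /orP[//|]; lra.
  by move: my; rewrite lt_min => /andP[].
exists p.2.
  apply: cA => V /(dist_nbhs dX) [e e0 he].
  have e'0 : 0 < Num.min e 2^-1 by rewrite lt_min e0 invr_gt0 ltr0n.
  have e'1 : Num.min e 2^-1 < 1 :> R by rewrite gt_min; apply/orP; right; lra.
  have [y [Ay yp _]] := hd _ e'0 e'1; exists y; split=> //; apply: he.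
  by rewrite (dist_sym dX); apply: lt_le_trans yp _; rewrite ge_min lexx.
apply/eqP; rewrite eq_le wdist_ge0 andbT; apply/ler_addgt0Pl => e e0; rewrite addr0.
have e'0 : 0 < Num.min (e / 2) 2^-1 by rewrite lt_min divr_gt0//= invr_gt0 ltr0n.
have e'1 : Num.min (e / 2) 2^-1 < 1 :> R by rewrite gt_min; apply/orP; right; lra.
have [y [Ay yp my]] := hd _ e'0 e'1.
have := wdist_tri m (dirac d y) (dirac d p.2); have := dirac_lip y p.2.
move: yp my; rewrite !lt_min => /andP[? _] /andP[? _]; lra.
Qed.

End Dirac.

(** * Holonomy along segments of measures *)

Lemma cts_at_cst (X K : topologicalType) (k : K) (x : X) : cts_at (fun=> k) x.
Proof. by move=> V /nbhs_singleton Vk; apply: filterE. Qed.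

Section Families.
Variables (R : realType) (X : topologicalType) (d : X -> X -> R).
Hypothesis dX : dist_for d.

Definition wfam (I : Type) (s : seq I) (w : I -> R) (p : I -> X) : wpoints d :=
  [seq (w i, p i) | i <- s].

Lemma ev_wfam (I : Type) (s : seq I) w p f :
  ev f (wfam s w p) = \sum_(i <- s) `|w i| * f (p i).
Proof. by rewrite /ev big_map. Qed.

Lemma wfam_dist (I : Type) (s : seq I) (w w' : I -> R) (p p' : I -> X) :
  wdist (wfam s w p) (wfam s w' p') <=
    \sum_(i <- s) (`|w i - w' i| + `|w' i| * d (p i) (p' i)).
Proof.
apply: wdist_le => f [f01 flip]; rewrite !ev_wfam -sumrB.
apply: le_trans (ler_norm_sum _ _ _) _; apply: ler_sum => i _.
have -> : `|w i| * f (p i) - `|w' i| * f (p' i) =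
  (`|w i| - `|w' i|) * f (p i) + `|w' i| * (f (p i) - f (p' i)) by ring.
apply: le_trans (ler_normD _ _) _; apply: lerD; rewrite normrM.
  have /andP[f0 f1] := f01 (p i); rewrite (ger0_norm f0).
  apply: (@le_trans _ _ `| `|w i| - `|w' i| |); first by rewrite ler_piMr.
  exact: ler_dist_dist.
rewrite normr_id ler_wpM2l//; apply: le_trans (flip _ _) _.
by rewrite ger0_norm ?(dist_ge0 dX).
Qed.

Lemma wfam_cts (Y : topologicalType) (I : Type) (s : seq I) (w : I -> Y -> R) (p : I -> Y -> X) y :
  (forall i, cts_at (w i) y) -> (forall i, cts_at (p i) y) ->
  cts_at (fun z => wfam s (w^~ z) (p^~ z)) y.
Proof.
move=> cw cp V [e e0 he].
suff [P nP hP] : exists2 P, nbhs y P & forall z, P z ->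
    \sum_(i <- s) (`|w i y - w i z| + `|w i z| * d (p i y) (p i z)) < e.
  by apply: filterS nP => z Pz; apply: he; apply: le_lt_trans (wfam_dist _ _ _ _ _) (hP _ Pz).
elim: s e e0 {he V} => [|i s IH] e e0.
  by exists setT; [exact: filterT|move=> z _; rewrite big_nil].
have [|P nP hP] := IH (e / 2); first by rewrite divr_gt0.
have b0 : 0 < `|w i y| + 1 by have := normr_ge0 (w i y); lra.
have h1 : \forall z \near y, `|w i y - w i z| < Num.min 1 (e / 4).
  have /cvgrPdist_lt h : w i z @[z --> y] --> w i y := cw i.
  by apply: h; rewrite lt_min ltr01 divr_gt0.
have h2 : \forall z \near y, d (p i y) (p i z) < e / 4 / (`|w i y| + 1).
  apply: (cp i [set x | d (p i y) x < e / 4 / (`|w i y| + 1)]).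
  by apply: (near_dist dX); rewrite !divr_gt0.
exists (P `&` [set z | `|w i y - w i z| < Num.min 1 (e / 4) /\
   d (p i y) (p i z) < e / 4 / (`|w i y| + 1)]).
  by apply: filterI => //; apply: filterS2 h1 h2.
move=> z [/hP h [/= ]]; rewrite big_cons lt_min => /andP[a1 a2] a3.
have wz : `|w i z| <= `|w i y| + 1.
  by have := lerB_dist (w i z) (w i y); rewrite distrC; lra.
have a4 : `|w i z| * d (p i y) (p i z) <= e / 4.
  apply: (@le_trans _ _ ((`|w i y| + 1) * d (p i y) (p i z))).
    by rewrite ler_wpM2r ?(dist_ge0 dX).
  by rewrite mulrC -ler_pdivlMr// ltW.
lra.
Qed.

Lemma wdist0_open (U : set (wpoints d)) m n : open U -> wdist m n = 0 -> U m -> U n.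
Proof.
by rewrite openE => oU mn /oU [e e0]; apply; rewrite mn.
Qed.

Definition seg (x y : X) (t : R) : wpoints d := [:: (1 - t, x); (t, y)].

Definition tri (x y z : X) (v : R * R) : wpoints d :=
  [:: (1 - v.1 - v.2, x); (v.1, y); (v.2, z)].

Lemma seg_cts x y : continuous (seg x y).
Proof.
move=> t; apply: (@wfam_cts R bool [:: false; true] (fun b t => if b then t else 1 - t)
  (fun b _ => if b then y else x)) => -[]; try exact: cts_at_cst; first exact: cvg_id.
suff c : continuous (fun t : R => 1 - t) by exact: c.
by rcont.
Qed.

Lemma tri_cts x y z : continuous (tri x y z).
Proof.
move=> t; apply: (@wfam_cts _ nat [:: 0%N; 1%N; 2%N]
  (fun b (v : R * R) => if b is 0 then 1 - v.1 - v.2 else if b is 1 then v.1 else v.2)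
  (fun b _ => if b is 0 then x else if b is 1 then y else z)) => -[|[|?]];
  try exact: cts_at_cst; try exact: cvg_fst; try exact: cvg_snd.
suff c : continuous (fun v : R * R => 1 - v.1 - v.2) by exact: c.
by rcont.
Qed.

Lemma ev_seg f x y t : ev f (seg x y t) = `|1 - t| * f x + `|t| * f y.
Proof. by rewrite /ev !big_cons big_nil addr0. Qed.

Lemma ev_tri f x y z v :
  ev f (tri x y z v) = `|1 - v.1 - v.2| * f x + `|v.1| * f y + `|v.2| * f z.
Proof. by rewrite /ev !big_cons big_nil addr0 addrA. Qed.

End Families.

Definition simplex (R : realType) (v : R * R) := [/\ 0 <= v.1, 0 <= v.2 & v.1 + v.2 <= 1].

Lemma weights_simplex (R : realType) (a b c : R) :
  0 <= a -> 0 <= b -> 0 <= c -> a + b + c = 1 -> simplex (b, c).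
Proof. by move=> *; split=> //=; lra. Qed.

Section SegmentHolonomy.
Variables (R : realType) (X : topologicalType) (d : X -> X -> R).
Hypothesis dX : dist_for d.
Variables (K : topologicalType) (gT : finGroupType) (hol : forall x y : K, curve R x y -> gT).
Hypothesis hK : hausdorff_space K.
Hypothesis hol_peq : forall x y (p q : curve R x y), peq p q -> hol p = hol q.
Hypothesis holM : forall x y z (p : curve R x y) (q : curve R y z),
  hol (pcat p q) = (hol p * hol q)%g.
Variables (U : set (wpoints d)) (F : wpoints d -> K).
Hypothesis oU : open U.
Hypothesis Fc : forall m, U m -> cts_at F m.

Local Notation vtx x := (F (dirac d x)).

Definition follows_seg x y (p : curve R (vtx x) (vtx y)) :=
  forall t, 0 <= t <= 1 -> p t = F (seg d x y t).

Lemma wdist0_F m n : U m -> wdist m n = 0 -> F m = F n.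
Proof. by move=> Um mn; apply/esym; apply: (wdist0_eq hK) => //; exact: Fc. Qed.

Lemma seg_curve x y : (forall t, 0 <= t <= 1 -> U (seg d x y t)) ->
  exists p : curve R (vtx x) (vtx y), follows_seg p.
Proof.
move=> hU.
have c : continuous (fun t => F (seg d x y (clamp01 t))).
  move=> t; apply: (@cts_at_comp _ _ _ (fun t => seg d x y (clamp01 t)) F).
    by apply: (@cont_comp _ _ _ (@clamp01 R) (seg d x y)); [exact: clamp01_continuous|exact: seg_cts].
  by apply: Fc; apply: hU; exact: clamp01_itv.
have e0 : F (seg d x y (clamp01 0)) = vtx x.
  apply: wdist0_F; first by apply: hU; exact: clamp01_itv.
  apply: wdist_eq0 => f; rewrite ev_seg ev_dirac clamp01_id ?lexx ?ler01//.
  by rewrite subr0 normr1 normr0 mul1r mul0r addr0.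
have e1 : F (seg d x y (clamp01 1)) = vtx y.
  apply: wdist0_F; first by apply: hU; exact: clamp01_itv.
  apply: wdist_eq0 => f; rewrite ev_seg ev_dirac clamp01_id ?lexx ?ler01//.
  by rewrite subrr normr1 normr0 mul1r mul0r add0r.
by exists (Curve c e0 e1) => t t01 /=; rewrite clamp01_id.
Qed.

(* The pullback along [F] of the universal covering of [K], as a cocycle. *)
Definition segcoc x y : gT :=
  if pselect (exists p : curve R (vtx x) (vtx y), follows_seg p) is left h
  then hol (projT1 (cid h)) else 1%g.

Lemma segcocE x y (p : curve R (vtx x) (vtx y)) : follows_seg p -> segcoc x y = hol p.
Proof.
move=> hp; rewrite /segcoc; case: pselect => [h|[]]; last by exists p.
by case: (cid h) => q hq /=; apply: hol_peq; apply: peq_ext => t t01; rewrite hp// hq.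
Qed.

Lemma tri_fill x y z : (forall v, simplex v -> U (tri d x y z v)) ->
  exists D : R * R -> K, continuous D /\ forall v, simplex v -> D v = F (tri d x y z v).
Proof.
move=> hU; pose s (v : R * R) := clamp01 v.1.
pose cl (v : R * R) := (s v, Num.max 0 (Num.min (1 - s v) v.2)).
have cl_s v : simplex (cl v).
  have /andP[a b] := clamp01_itv v.1; rewrite -/(s v) in a b.
  by split; rewrite /= ?le_max ?lexx//; rewrite maxElt minElt; do 2?case: ifP; lra.
have clE v : simplex v -> cl v = v.
  case: v => a b [/= a0 b0 ab]; rewrite /cl /s /= clamp01_id; last lra.
  by rewrite min_r ?max_r//; lra.
have cc : continuous cl by apply: cont_pair; rewrite /s; rcont.
exists (fun v => F (tri d x y z (cl v))); split; last by move=> v /clE ->.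
move=> v; apply: (@cts_at_comp _ _ _ (fun v => tri d x y z (cl v)) F).
  by apply: (@cont_comp _ _ _ cl (tri d x y z)) => //; exact: tri_cts.
exact: Fc (hU _ (cl_s v)).
Qed.

Section Faces.
Variables x y z : X.
Hypothesis hU : forall v, simplex v -> U (tri d x y z v).

Lemma tri_face01 t : 0 <= t <= 1 -> [/\ simplex (t, 0), U (seg d x y t) &
  F (tri d x y z (t, 0)) = F (seg d x y t)].
Proof.
move=> t01; have st : simplex (t, 0) by split=> /=; lra.
have e : wdist (tri d x y z (t, 0)) (seg d x y t) = 0.
  by apply: wdist_eq0 => f; rewrite ev_seg ev_tri/= subr0 normr0 mul0r addr0.
by split=> //; [exact: wdist0_open e (hU st)|exact: wdist0_F (hU st) e].
Qed.

Lemma tri_face02 t : 0 <= t <= 1 -> [/\ simplex (0, t), U (seg d x z t) &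
  F (tri d x y z (0, t)) = F (seg d x z t)].
Proof.
move=> t01; have st : simplex (0, t) by split=> /=; lra.
have e : wdist (tri d x y z (0, t)) (seg d x z t) = 0.
  by apply: wdist_eq0 => f; rewrite ev_seg ev_tri/= subr0 normr0 mul0r addr0.
by split=> //; [exact: wdist0_open e (hU st)|exact: wdist0_F (hU st) e].
Qed.

Lemma tri_face12 t : 0 <= t <= 1 -> [/\ simplex (1 - t, t), U (seg d y z t) &
  F (tri d x y z (1 - t, t)) = F (seg d y z t)].
Proof.
move=> t01; have st : simplex (1 - t, t) by split=> /=; lra.
have e : wdist (tri d x y z (1 - t, t)) (seg d y z t) = 0.
  apply: wdist_eq0 => f; rewrite ev_seg ev_tri/= opprB addrCA subrr addr0 subrr.
  by rewrite normr0 mul0r add0r.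
by split=> //; [exact: wdist0_open e (hU st)|exact: wdist0_F (hU st) e].
Qed.

(** The image under [F] of the triangle of measures is a homotopy between the two ways from [x] to
    [z]. *)
Lemma segcocM : (segcoc x y * segcoc y z)%g = segcoc x z.
Proof.
have [p hp] : exists p : curve R (vtx x) (vtx y), follows_seg p.
  by apply: seg_curve => t /tri_face01[].
have [q hq] : exists p : curve R (vtx y) (vtx z), follows_seg p.
  by apply: seg_curve => t /tri_face12[].
have [r hr] : exists p : curve R (vtx x) (vtx z), follows_seg p.
  by apply: seg_curve => t /tri_face02[].
rewrite (segcocE hp) (segcocE hq) (segcocE hr) -holM; apply: hol_peq.
have [D [cD DE]] := tri_fill hU; apply: (@triangle_peq _ _ _ _ _ _ _ _ D) => //.
- by move=> t t01; have [st _ e] := tri_face01 t01; rewrite DE// e hp.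
- by move=> t t01; have [st _ e] := tri_face12 t01; rewrite DE// e hq.
- by move=> t t01; have [st _ e] := tri_face02 t01; rewrite DE// e hr.
Qed.

End Faces.

Lemma tri_combo (V : set X) x y z v : V x -> V y -> V z -> simplex v ->
  (forall p, p \in tri d x y z v -> V p.2) /\ \sum_(p <- tri d x y z v) `|p.1| = 1.
Proof.
case: v => a b Vx Vy Vz [/= a0 b0 ab]; split.
  by move=> p; rewrite !inE => /or3P[] /eqP ->.
rewrite !big_cons big_nil /= !ger0_norm//; lra.
Qed.

Lemma seg_combo (V : set X) x y t : V x -> V y -> 0 <= t <= 1 ->
  (forall p, p \in seg d x y t -> V p.2) /\ \sum_(p <- seg d x y t) `|p.1| = 1.
Proof.
move=> Vx Vy t01; split; first by move=> p; rewrite !inE => /orP[] /eqP ->.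
rewrite !big_cons big_nil /= !ger0_norm//; lra.
Qed.

Lemma segcoc_cocycle (A : set X) : (forall x, A x -> U (dirac d x)) -> cocycle_on A segcoc.
Proof.
move=> AU z /AU Uz; have nU : nbhs (dirac d z) U by exact: open_nbhs_nbhs.
have [V nV hV] := near_dirac dX nU.
exists V => // x y w Vx Vy Vw _ _ _; apply: segcocM => v sv.
by have [h1 h2] := tri_combo Vx Vy Vw sv; exact: hV.
Qed.

End SegmentHolonomy.

(** * Extending maps over the nerve *)

Section NerveMap.
Variables (R : realType) (X K : topologicalType) (I : choiceType).
Variables (u : I -> X -> R) (N : I -> set X).
Hypothesis uc : forall i, continuous (u i).
Hypothesis u0 : forall i x, 0 <= u i x.
Hypothesis uloc : forall z : X, exists s : seq I, [/\ uniq s, (size s <= 3)%N,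
  forall i, i \in s -> N i z &
  \forall x \near z, (forall i, i \notin s -> u i x = 0) /\ \sum_(i <- s) u i x = 1].
Variables (v : I -> K) (P : forall i j, curve R (v i) (v j)) (D : I -> I -> I -> R * R -> K).
Hypothesis PV : forall i j t, i != j -> P j i t = P i j (1 - t).
Hypothesis DP : forall i j k z, N i z -> N j z -> N k z -> uniq [:: i; j; k] ->
  [/\ continuous (D i j k), forall t, 0 <= t <= 1 -> D i j k (t, 0) = P i j t,
      forall t, 0 <= t <= 1 -> D i j k (1 - t, t) = P j k t &
      forall t, 0 <= t <= 1 -> D i j k (0, t) = P i k t].
Variable k0 : K.

(** Barycentric coordinates, the weight of the first vertex being implied by the sum 1; the support
    of a point has one, two or three elements. *)
Definition simplex_val (s : seq I) (x : X) : K :=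
  match s with
  | [:: i] => v i
  | [:: i; j] => P i j (u j x)
  | [:: i; j; k] => D i j k (u j x, u k x)
  | _ => k0
  end.

Definition support_at x (s : seq I) :=
  [/\ uniq s, forall i, (i \in s) = (0 < u i x) & \sum_(i <- s) u i x = 1].

Let pos_in (s : seq I) x i : (forall i, i \notin s -> u i x = 0) -> 0 < u i x -> i \in s.
Proof. by move=> h ui; apply: contraT => /h e; rewrite e ltxx in ui. Qed.

Let supp_ex x : exists s, canon s = s /\ support_at x s.
Proof.
have [s [us _ _ /nbhs_singleton [hs sum]]] := uloc x.
pose t := [seq i <- s | 0 < u i x]; exists (canon t).
have tc := canonP t; split; first by apply/esym/canon_eq.
split.
- by rewrite -(perm_uniq tc) filter_uniq.
- move=> i; rewrite -(perm_mem tc) mem_filter.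
  by case: (ltP 0 (u i x)) => //= ui; exact: pos_in hs ui.
- rewrite -sum -(perm_big _ tc) big_filter big_mkcond /=; apply: eq_bigr => i _.
  by case: ltP => // ui; apply/eqP; rewrite eq_le ui u0.
Qed.

Let supp x := projT1 (cid (supp_ex x)).
Let suppP x : canon (supp x) = supp x /\ support_at x (supp x) := projT2 (cid (supp_ex x)).

Let g x := simplex_val (supp x) x.

Let weight01 i x : 0 <= u i x <= 1.
Proof.
rewrite u0 /=; have [_ [us ms <-]] := suppP x; have [ui|ui] := ltP 0 (u i x).
  by rewrite (big_rem i) ?ms//= lerDl sumr_ge0.
by apply: le_trans ui _; exact: sumr_ge0.
Qed.

Let val1 i x : (forall j, j \notin [:: i] -> u j x = 0) -> g x = v i.
Proof.
move=> h; rewrite /g; have [_ [us ms sum]] := suppP x.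
have hs j : j \in supp x -> j = i by rewrite ms => /(pos_in h); rewrite inE => /eqP.
case: (supp x) us sum hs => [|a [|b s]]; first by rewrite big_nil => _ /eqP; rewrite eq_sym oner_eq0.
  by move=> _ _ hs; rewrite (hs a) ?mem_head.
move=> /= /andP[]; rewrite inE negb_or => /andP[/eqP ab _] _ _ hs; case: ab.
by rewrite (hs a) ?mem_head// (hs b)// !inE eqxx orbT.
Qed.

Let val2 i j x : i != j -> (forall l, l \notin [:: i; j] -> u l x = 0) ->
  u i x + u j x = 1 -> g x = P i j (u j x).
Proof.
move=> ij h sum; have [ui|ui] := ltP 0 (u i x); last first.
  have ui0 : u i x = 0 by apply/eqP; rewrite eq_le ui u0.
  rewrite (val1 (i := j)); first by rewrite (_ : u j x = 1) ?curve1//; lra.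
  move=> l lj; have [->//|li] := eqVneq l i; apply: h.
  by rewrite !inE negb_or li; rewrite inE in lj.
have [uj|uj] := ltP 0 (u j x); last first.
  have uj0 : u j x = 0 by apply/eqP; rewrite eq_le uj u0.
  rewrite (val1 (i := i)); first by rewrite uj0 curve0.
  move=> l li; have [->//|lj] := eqVneq l j; apply: h.
  by rewrite !inE negb_or lj andbT; rewrite inE in li.
rewrite /g; have [_ [us ms _]] := suppP x.
have pm : perm_eq (supp x) [:: i; j].
  apply: uniq_perm => //=; first by rewrite inE ij.
  move=> l; rewrite ms; apply/idP/idP; first exact: pos_in.
  by rewrite !inE => /orP[] /eqP ->.
have sz := perm_size pm; case: (supp x) sz pm => [|a [|b []]]// _ pm.
have : a \in [:: i; j] by rewrite -(perm_mem pm) mem_head.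
have : b \in [:: i; j] by rewrite -(perm_mem pm) !inE eqxx orbT.
have ab : a != b by move: (perm_uniq pm); rewrite /= !inE ij andbT.
rewrite !inE => /orP[] /eqP eb /orP[] /eqP ea; move: ab; rewrite ea eb ?eqxx// => _.
by rewrite /= PV//; congr (P i j _); lra.
Qed.

(** [D] depends on the order of its vertices, so the triangle is compared with [supp x] in canonical
    order only. On the edges [PV] takes care of both orders. *)
Let val3 i j k x z : N i z -> N j z -> N k z -> uniq [:: i; j; k] ->
  canon [:: i; j; k] = [:: i; j; k] -> (forall l, l \notin [:: i; j; k] -> u l x = 0) ->
  u i x + u j x + u k x = 1 -> g x = D i j k (u j x, u k x).
Proof.
move=> Ni Nj Nk us cs h sum; have [_ Dij Djk Dik] := DP Ni Nj Nk us.
move: (us); rewrite /= !inE negb_or => /and3P[/andP[ij ik] jk _].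
have z0 l : u l x <= 0 -> u l x = 0 by move=> ul; apply/eqP; rewrite eq_le ul u0.
have h2 a b c l : u c x = 0 -> l \notin [:: a; b] -> perm_eq [:: a; b; c] [:: i; j; k] -> u l x = 0.
  move=> uc0 lab pm; have [->//|lc] := eqVneq l c; apply: h.
  by rewrite -(perm_mem pm) -[_ :: _]/([:: a; b] ++ [:: c]) mem_cat negb_or lab inE.
have [ui|ui] := ltP 0 (u i x); last first.
  rewrite (val2 jk); first by rewrite -Djk//; congr (D i j k (_, _)); have := z0 _ ui; lra.
    by move=> l hl; apply: (h2 j k i) => //; [exact: z0|rewrite -(perm_rot 2)].
  by have := z0 _ ui; lra.
have [uj|uj] := ltP 0 (u j x); last first.
  rewrite (val2 ik); first by rewrite -Dik// (z0 _ uj).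
    move=> l hl; apply: (h2 i k j) => //; first exact: z0.
    by rewrite perm_cons -(perm_rot 1).
  by have := z0 _ uj; lra.
have [uk|uk] := ltP 0 (u k x); last first.
  rewrite (val2 ij); first by rewrite -Dij// (z0 _ uk).
    by move=> l hl; apply: (h2 i j k) => //; exact: z0.
  by have := z0 _ uk; lra.
rewrite /g; have [c' [us' ms _]] := suppP x.
suff -> : supp x = [:: i; j; k] by [].
rewrite -c' -cs; apply: canon_eq; apply: uniq_perm => // l.
rewrite ms; apply/idP/idP; first exact: pos_in.
by rewrite !inE => /or3P[] /eqP ->.
Qed.

(** Near [z] all supports are faces of one simplex; the boundary conditions in [DP] let the formula
    of that simplex compute [g] on its faces as well, and this formula is continuous. *)
Lemma nerve_map : exists g : X -> K, continuous g /\
  forall x, exists2 s, support_at x s & g x = simplex_val s x.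
Proof.
exists g; split; last by move=> x; exists (supp x) => //; case: (suppP x).
move=> z; have [s [us s3 sN hs]] := uloc z.
have pm := canonP s; have ct : canon (canon s) = canon s by apply/esym/canon_eq.
have ut : uniq (canon s) by rewrite -(perm_uniq pm).
have tN i : i \in canon s -> N i z by rewrite -(perm_mem pm); exact: sN.
have ht : \forall x \near z, (forall i, i \notin canon s -> u i x = 0) /\
    \sum_(i <- canon s) u i x = 1.
  apply: filterS hs => x [h1 h2]; split; last by rewrite -(perm_big _ pm).
  by move=> i; rewrite -(perm_mem pm); exact: h1.
have t3 : (size (canon s) <= 3)%N by rewrite -(perm_size pm).
case: (canon s) t3 ct ut tN ht => [|i [|j [|k [|]]]]// _ ct ut tN ht.
- have [_ /eqP] := nbhs_singleton ht; by rewrite big_nil eq_sym oner_eq0.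
- apply: (@cts_at_eq _ _ _ (fun=> v i)); last exact: cts_at_cst.
  by apply: filterS ht => x [h _]; exact: val1.
- have ij : i != j by move: ut; rewrite /= inE andbT.
  apply: (@cts_at_eq _ _ _ (fun x => P i j (u j x))).
    apply: filterS ht => x [h]; rewrite !big_cons big_nil addr0.
    exact: val2.
  by apply: cts_at_comp; [exact: uc|exact: curve_cont].
- have Ni : N i z by apply: tN; rewrite mem_head.
  have Nj : N j z by apply: tN; rewrite !inE eqxx orbT.
  have Nk : N k z by apply: tN; rewrite !inE eqxx !orbT.
  apply: (@cts_at_eq _ _ _ (fun x => D i j k (u j x, u k x))).
    apply: filterS ht => x [h]; rewrite !big_cons big_nil addr0 addrA.
    exact: val3 Nk ut ct h.
  have [cD _ _ _] := DP Ni Nj Nk ut.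
  apply: (@cts_at_comp _ _ _ (fun x => (u j x, u k x)) (D i j k)); last exact: cD.
  by apply: cont_pair_at; exact: uc.
Qed.

End NerveMap.

Section Extension.
Variables (R : realType) (X : topologicalType) (d : X -> X -> R).
Hypothesis dX : dist_for d.
Variables (K : topologicalType).
Hypotheses (hK : hausdorff_space K).

(** Points of [A] at distance 0 have the same image because [K] is Hausdorff, so [f] can be read on
    any representative of a Dirac measure. *)
Lemma diracs_map (A : set X) (f : X -> K) (k0 : K) :
  (forall x, A x -> cts_in A f x) -> exists f0 : wpoints d -> K,
    (forall m, diracs A m -> cts_in (diracs A) f0 m) /\
    forall x m, A x -> wdist m (dirac d x) = 0 -> f0 m = f x.
Proof.
move=> fA.
pose f0 (m : wpoints d) := if pselect (exists2 x, A x & wdist m (dirac d x) = 0) is left h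
  then f (projT1 (cid2 h)) else k0.
have f0E x m : A x -> wdist m (dirac d x) = 0 -> f0 m = f x.
  move=> Ax mx; rewrite /f0; case: pselect => [h|[]]; last by exists x.
  case: (cid2 h) => y Ay my /=.
  have xy : d x y = 0.
    have := wdist_dirac dX x y; have := wdist_tri (dirac d x) m (dirac d y).
    rewrite my [wdist (dirac d x) m]wdist_sym mx addr0 => h1; have := wdist_ge0 (dirac d x) (dirac d y).
    have := dist_ge0 dX x y; rewrite minElt; case: ifP => _; lra.
  apply: hK => V W nV nW; exists (f y); split; first exact: nbhs_singleton nV.
  have /(dist_nbhs dX) [e e0 he] := fA x Ax _ nW.
  by apply: he => //; rewrite xy.
exists f0; split=> // m [x Ax mx] V; rewrite (f0E x)// => fV.
have /(dist_nbhs dX) [e e0 he] := fA x Ax _ fV.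
exists (Num.min e 1); first by rewrite lt_min e0 ltr01.
move=> n mn [y Ay ny]; rewrite (f0E y)//; apply: he => //.
have := wdist_dirac dX x y; have := wdist_tri (dirac d x) m (dirac d y).
have := wdist_tri m n (dirac d y); rewrite ny [wdist (dirac d x) m]wdist_sym mx.
by move: mn; rewrite lt_min minElt => /andP[? ?]; case: ifP => _; lra.
Qed.

Variables (cw : cw_structure R K) (gT : finGroupType) (H : {group gT}).
Variable hol : forall x y : K, curve R x y -> gT.
Hypothesis hol_peq : forall x y (p q : curve R x y), peq p q <-> hol p = hol q.
Hypothesis holM : forall x y z (p : curve R x y) (q : curve R y z),
  hol (pcat p q) = (hol p * hol q)%g.
Hypothesis hol_in : forall x y (p : curve R x y), hol p \in H.
Hypothesis hol_surj : forall x y g, g \in H -> exists p : curve R x y, hol p = g.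
Hypothesis dimX : covering_dim_le X 2.
Hypothesis fH : fillable_group X H.

Let hol1 x : hol (pid R x) = 1%g.
Proof.
have /hol_peq := pcat1p (pid R x); rewrite holM => h.
by apply: (mulgI (hol (pid R x))); rewrite mulg1.
Qed.

Let holV x y (p : curve R x y) : hol (pinv p) = (hol p)^-1%g.
Proof.
have /hol_peq := pcatpV p; rewrite holM hol1 => h.
by apply: (mulgI (hol p)); rewrite h mulgV.
Qed.

Let segcoc_in (F : wpoints d -> K) x y : segcoc hol F x y \in H.
Proof. by rewrite /segcoc; case: pselect. Qed.

(** [lift_ext] with [N := H]: the quotient bundle is trivial and extends. The gauge is then undone,
    to obtain the values of [c] on [A] and not just an isomorphic bundle. *)
Let ext_cocycle (A : set X) c : closed A -> (forall x y, c x y \in H) -> cocycle_on A c ->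
  exists c2 : X -> X -> gT, [/\ forall x y, c2 x y \in H, cocycle_on setT c2 &
    forall z, A z -> exists2 V, nbhs z V &
      forall x y, V x -> V y -> A x -> A y -> c2 x y = c x y].
Proof.
move=> cA cH cc.
have [|||c' [b [c'H c'c bH cb]]] :=
  @lift_ext R X d dX dimX gT H H A c (fun _ _ => 1%g) (normal_refl H) fH cA cH cc.
- by move=> *; exact: group1.
- by move=> z _; exists setT; [exact: filterT|move=> *; rewrite mulg1].
- by move=> z _; exists setT; [exact: filterT|move=> *; exact: coset_id].
exists (fun x y => b x * c' x y * (b y)^-1)%g; split.
- by move=> x y; rewrite !groupM ?groupV.
- move=> z _; have [V nV hV] := c'c z Logic.I; exists V => // x y w Vx Vy Vw _ _ _.
  by rewrite -(hV x y w)// !mulgA mulgKV.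
- move=> z Az; have [V nV hV] := cb z Az; exists V => // x y Vx Vy Ax Ay.
  by rewrite hV// !mulgA mulgV mul1g mulgK.
Qed.

(* The map extends to measures near [A], hence to a neighbourhood of [A], and its
   pullback of the universal covering extends to a cocycle [c] on [X]. On the
   nerve of a fine cover of dimension 2 the edges are mapped to curves with the
   holonomy prescribed by [c], so that the triangles can be filled. The two maps
   agree near [A] up to the straight homotopy in the space of measures. *)
Theorem fillable_extension (A : set X) (f : X -> K) : closed A ->
  (forall x, A x -> cts_in A f x) ->
  exists h : X -> K, continuous h /\ forall x, A x -> h x = f x.
Proof.
move=> cA fA.
have [[x0 _]|nX] := pselect (exists x : X, True); last first.
  by exists f; split=> x; exfalso; apply: nX; exists x.
have [f0 [f0c f0E]] := diracs_map (f x0) fA.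
have [U [F [oU AU Fc FE]]] := cw_nbhd_ext cw hK (wdist_dist_for d) (closed_diracs dX cA) f0c.
have Fdirac x : A x -> F (dirac d x) = f x.
  by move=> Ax; rewrite FE ?(f0E x) ?wdist_refl//; exact: diracs_dirac.
have Udirac x : A x -> U (dirac d x) by move=> Ax; apply: AU; exact: diracs_dirac.
have hol_eq x y (p q : curve R x y) : peq p q -> hol p = hol q by move/hol_peq.
pose cF := segcoc hol F.
have cFH x y : cF x y \in H by exact: segcoc_in.
have cFc : cocycle_on A cF by exact: (segcoc_cocycle dX hK hol_eq holM oU Fc Udirac).
have [c [cH cc cA']] := ext_cocycle cA cFH cFc.
have Vex (y : X) : exists V, [/\ open V, V y,
    forall x z w, V x -> V z -> V w -> (c x z * c z w)%g = c x w,
    A y -> (forall m : wpoints d, (forall p, p \in m -> V p.2) ->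
      \sum_(p <- m) `|p.1| = 1 -> U m) /\
      forall x z, V x -> V z -> A x -> A z -> c x z = cF x z &
    ~ A y -> forall x, V x -> ~ A x].
  have [V1 n1 h1] := cc y Logic.I.
  have [Ay|Ay] := pselect (A y).
    have [V2 n2 h2] := cA' y Ay.
    have [V3 n3 h3] := near_dirac dX (open_nbhs_nbhs (conj oU (Udirac y Ay))).
    have : nbhs y (V1 `&` (V2 `&` V3)) by do 2?apply: filterI.
    rewrite nbhsE => -[V [oV Vy] VV].
    exists V; split=> //.
    - by move=> x z w /VV[? _] /VV[? _] /VV[? _]; exact: h1.
    - move=> _; split; first by move=> m hm; apply: h3 => p /hm /VV[_ []].
      by move=> x z /VV[_ [? _]] /VV[_ [? _]]; exact: h2.
  have : nbhs y (V1 `&` ~` A).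
    by apply: filterI => //; apply: open_nbhs_nbhs; split=> //; exact: closed_openC.
  rewrite nbhsE => -[V [oV Vy] VV]; exists V; split=> //.
  - by move=> x z w /VV[? _] /VV[? _] /VV[? _]; exact: h1.
  - by move=> _ x /VV[].
pose Vf y := projT1 (cid (Vex y)).
have VfP y := projT2 (cid (Vex y)); rewrite -/(Vf _) in VfP.
have Uc : open_cover (range Vf).
  split; first by move=> _ [y _ <-]; case: (VfP y).
  by rewrite -subTset => y _; exists (Vf y); [exists y|case: (VfP y)].
have [W [u [uc u0 uW uloc starU]]] := good_partition dX dimX Uc.
have star z : exists y, forall i, W i -> i z -> i `<=` Vf y.
  by have [_ [y _ <-] h] := starU z; exists y.
have pt_ex (i : set X) : exists p, (forall x, i x -> i p) /\ (forall x, i x -> A x -> A p).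
  have [[x [ix Ax]]|n1] := pselect (exists x, i x /\ A x); first by exists x.
  have [[x ix]|n2] := pselect (exists x, i x).
    by exists x; split=> // y iy Ay; exfalso; apply: n1; exists y.
  by exists x0; split=> y iy; exfalso; apply: n2; exists y.
pose pt i := projT1 (cid (pt_ex i)).
have ptP i x : i x -> i (pt i) /\ (A x -> A (pt i)).
  by move=> ix; have [h1 h2] := projT2 (cid (pt_ex i)); split; [exact: h1 ix|exact: h2 ix].
pose N i := [set z | W i /\ i z].
have ptV y z i : (forall i, W i -> i z -> i `<=` Vf y) -> N i z -> Vf y (pt i).
  by move=> h [Wi iz]; apply: (h i Wi iz); have [] := ptP i z iz.
(* Near the points of [A] everything is dictated by [F]. *)
have near_seg z i j : N i z -> N j z -> A (pt i) -> A (pt j) ->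
    c (pt i) (pt j) = cF (pt i) (pt j) /\
    forall t, 0 <= t <= 1 -> U (seg d (pt i) (pt j) t).
  move=> Ni Nj Ai Aj; have [y h] := star z.
  have Vi := ptV _ _ _ h Ni; have Vj := ptV _ _ _ h Nj.
  have [_ _ _ hU nA] := VfP y.
  have Ay : A y by apply: contrapT => /nA /(_ _ Vi).
  have [h1 h2] := hU Ay; split; first exact: h2.
  by move=> t t01; have [a b] := seg_combo d Vi Vj t01; exact: h1.
have near_tri z i j k : N i z -> N j z -> N k z -> A (pt i) -> A (pt j) -> A (pt k) ->
    forall v, simplex v -> U (tri d (pt i) (pt j) (pt k) v).
  move=> Ni Nj Nk Ai Aj Ak w sw; have [y h] := star z.
  have Vi := ptV _ _ _ h Ni; have Vj := ptV _ _ _ h Nj; have Vk := ptV _ _ _ h Nk.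
  have [_ _ _ hU nA] := VfP y.
  have Ay : A y by apply: contrapT => /nA /(_ _ Vi).
  have [h1 _] := hU Ay.
  by have [a b] := tri_combo d Vi Vj Vk sw; exact: h1.
have c_mul z i j k : N i z -> N j z -> N k z ->
    (c (pt i) (pt j) * c (pt j) (pt k))%g = c (pt i) (pt k).
  move=> Ni Nj Nk; have [y h] := star z.
  have Vi := ptV _ _ _ h Ni; have Vj := ptV _ _ _ h Nj; have Vk := ptV _ _ _ h Nk.
  by have [_ _ hc _ _] := VfP y; exact: hc.
have c_inv z i j : N i z -> N j z -> (c (pt j) (pt i))^-1%g = c (pt i) (pt j).
  move=> Ni Nj; apply/eqP; rewrite eq_invg_mul; apply/eqP.
  by rewrite (c_mul z)//; apply: (mulgI (c (pt j) (pt j))); rewrite mulg1 (c_mul z).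
pose v i := F (dirac d (pt i)).
(* An edge with both ends in [A] has to follow [F] along the segment, whose holonomy is [c] there by
   [near_seg]; for the other edges any curve with the prescribed holonomy will do. *)
have Q_ex i j : exists p : curve R (v i) (v j), forall z, N i z -> N j z ->
    hol p = c (pt i) (pt j) /\ (A (pt i) -> A (pt j) -> follows_seg p).
  have [[z [Ni Nj Ai Aj]]|n] := pselect (exists z, [/\ N i z, N j z, A (pt i) & A (pt j)]).
    have [e hU] := near_seg z i j Ni Nj Ai Aj.
    have [p hp] := seg_curve dX hK Fc hU.
    exists p => _ _ _; split=> //; rewrite e; apply/esym; exact: segcocE hp.
  have [p hp] := hol_surj (v i) (v j) (cH (pt i) (pt j)).
  by exists p => z Ni Nj; split=> // Ai Aj; exfalso; apply: n; exists z.
pose Q i j := projT1 (cid (Q_ex i j)).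
have QP i j := projT2 (cid (Q_ex i j)); rewrite -/(Q _ _) in QP.
have [o oP] := pair_orientation (set X).
pose P i j : curve R (v i) (v j) := if o i j then Q i j else pinv (Q j i).
have PV i j t : i != j -> P j i t = P i j (1 - t).
  move=> ij; rewrite /P oP//; case: (o i j) => //=.
  by rewrite /pinv_fun; congr (Q _ _ _); lra.
have P_hol i j z : N i z -> N j z -> hol (P i j) = c (pt i) (pt j).
  move=> Ni Nj; rewrite /P; case: (o i j); first by have [] := QP i j z Ni Nj.
  by rewrite holV; have [-> _] := QP j i z Nj Ni; exact: (c_inv z).
have P_seg i j z : N i z -> N j z -> A (pt i) -> A (pt j) -> follows_seg (P i j).
  move=> Ni Nj Ai Aj; rewrite /P; case: (o i j).
    by have [_ ] := QP i j z Ni Nj; apply.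
  move=> t t01 /=; rewrite /pinv_fun; have [_ /(_ Aj Ai) ->] := QP j i z Nj Ni; last by lra.
  have [_ hU] := near_seg z j i Nj Ni Aj Ai.
  apply: (wdist0_F hK Fc); first by apply: hU; lra.
  by apply: wdist_eq0 => phi; rewrite !ev_seg addrC opprB addrCA subrr addr0.
have D_ex i j k : exists D : R * R -> K, forall z, N i z -> N j z -> N k z ->
    [/\ continuous D, forall t, 0 <= t <= 1 -> D (t, 0) = P i j t,
      forall t, 0 <= t <= 1 -> D (1 - t, t) = P j k t,
      forall t, 0 <= t <= 1 -> D (0, t) = P i k t &
      A (pt i) -> A (pt j) -> A (pt k) -> forall w, simplex w ->
        D w = F (tri d (pt i) (pt j) (pt k) w)].
  have [[z [Ni Nj Nk]]|n] := pselect (exists z, [/\ N i z, N j z & N k z]); last first.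
    by exists (fun=> v i) => z Ni Nj Nk; exfalso; apply: n; exists z.
  have [[Ai Aj Ak]|n] := pselect [/\ A (pt i), A (pt j) & A (pt k)].
    have hU := near_tri z i j k Ni Nj Nk Ai Aj Ak.
    have [D [cD DE]] := tri_fill dX Fc hU; exists D => _ _ _ _; split=> //.
    - move=> t t01; have [st _ e] := tri_face01 hK oU Fc hU t01.
      by rewrite DE// e (P_seg i j z).
    - move=> t t01; have [st _ e] := tri_face12 hK oU Fc hU t01.
      by rewrite DE// e (P_seg j k z).
    - move=> t t01; have [st _ e] := tri_face02 hK oU Fc hU t01.
      by rewrite DE// e (P_seg i k z).
  have [|D [cD h1 h2 h3]] := @triangle_fill R K _ _ _ (P i j) (P j k) (P i k).
    apply/hol_peq; rewrite holM (P_hol i j z)// (P_hol j k z)// (P_hol i k z)//.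
    exact: (c_mul z).
  by exists D => _ _ _ _; split=> // *; exfalso; apply: n.
pose D i j k := projT1 (cid (D_ex i j k)).
have DP i j k := projT2 (cid (D_ex i j k)); rewrite -/(D _ _ _) in DP.
have uloc' z : exists s : seq (set X), [/\ uniq s, (size s <= 3)%N,
    forall i, i \in s -> N i z &
    \forall x \near z, (forall i, i \notin s -> u i x = 0) /\ \sum_(i <- s) u i x = 1].
  by have [s [us s3 sz hs]] := uloc z; exists s; split=> // i /sz.
have [|g [gc gE]] := @nerve_map R X K (set X) u N uc u0 uloc' v P D PV _ (v setT).
  by move=> i j k z Ni Nj Nk _; have [] := DP i j k z Ni Nj Nk.
pose sx x := projT1 (cid2 (gE x)).
have sxP x : support_at u x (sx x) /\ g x = simplex_val u P D (v setT) (sx x) x.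
  by rewrite /sx; case: (cid2 (gE x)).
have inN i x : i \in sx x -> N i x.
  by have [[_ hs _] _] := sxP x; rewrite hs => /uW.
have sx3 x : (size (sx x) <= 3)%N.
  have [[us ss _] _] := sxP x; have [s [us' s3 _ /nbhs_singleton [h _]]] := uloc x.
  apply: leq_trans s3; apply: uniq_leq_size => // i; rewrite ss => ui.
  by apply: contraT => /h e; rewrite e ltxx in ui.
pose kappa x : wpoints d := wfam d (sx x) (u^~ x) pt.
have g_kappa x : (forall i, i \in sx x -> A (pt i)) -> g x = F (kappa x).
  move=> sA; have [[us ss sum] ->] := sxP x; rewrite /kappa.
  case: (sx x) (sx3 x) sA (inN^~ x) us sum => [|i [|j [|k [|]]]]// _ sA sN us.
  - by rewrite big_nil => /eqP; rewrite eq_sym oner_eq0.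
  - by rewrite big_cons big_nil addr0 /v /wfam /= => ->.
  - rewrite !big_cons big_nil addr0 => sum.
    have Ai := sA i (mem_head _ _); have Ni := sN i (mem_head _ _).
    have j2 : j \in [:: i; j] by rewrite !inE eqxx orbT.
    have Aj := sA j j2; have Nj := sN j j2.
    rewrite /= (P_seg i j x)//; last by have := u0 i x; have := u0 j x; lra.
    by rewrite /seg /wfam /=; congr (F [:: (_, _); _]); lra.
  - rewrite !big_cons big_nil addr0 => sum.
    have Ai := sA i (mem_head _ _); have Ni := sN i (mem_head _ _).
    have j3 : j \in [:: i; j; k] by rewrite !inE eqxx orbT.
    have Aj := sA j j3; have Nj := sN j j3.
    have k3 : k \in [:: i; j; k] by rewrite !inE eqxx !orbT.
    have Ak := sA k k3; have Nk := sN k k3.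
    have [_ _ _ _ DE] := DP i j k x Ni Nj Nk.
    rewrite /= /D DE//; last first.
      by apply: (@weights_simplex _ (u i x)); rewrite ?u0 -?addrA.
    by rewrite /tri /wfam /=; congr (F [:: (_, _); _; _]); lra.
(* On [O] the point [x] and the vertices carrying [kappa x] lie in one [Vf y], so that all measures
   between [kappa x] and the Dirac measure at [x] are in [U]. *)
pose O := [set x | exists y, [/\ A y, Vf y x &
  forall i, i \in sx x -> i `<=` Vf y /\ A (pt i)]]^°.
have oO : open O by exact: open_interior.
have AO : A `<=` O.
  move=> z Az; have [y hy] := star z; have [s [us s3 sz hs]] := uloc z.
  have [i is_] : exists i, i \in s.
    have [_] := nbhs_singleton hs; case: (s) => [|i s' _]; last by exists i; rewrite mem_head.
    by rewrite big_nil => /eqP; rewrite eq_sym oner_eq0.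
  have Vz : Vf y z by have [Wi iz] := sz i is_; exact: (hy i Wi iz z iz).
  have [oV _ _ _ nA] := VfP y.
  have Ay : A y by apply: contrapT => /nA /(_ _ Vz).
  have nV : nbhs z (Vf y) by exact: open_nbhs_nbhs.
  apply: filterS2 nV hs => x Vx [h _]; exists y; split=> // l.
  have [[_ -> _] _] := sxP x => ul.
  have ls : l \in s by apply: contraT => /h e; rewrite e ltxx in ul.
  by have [Wl lz] := sz l ls; split; [exact: hy|have [_] := ptP l z lz; exact].
(* The function is 1 on [A] and vanishes on a whole neighbourhood of the complement of [O]: the two
   formulas for the final map then agree near the boundary of [O]. *)
pose th x := Num.max 0 (2 * sep d (~` O) A x - 1).
have thc : continuous th.
  have cs : continuous (sep d (~` O) A).
    apply: sep_continuous => //; first exact: open_closedC.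
    by apply/seteqP; split=> x // [Ox /AO].
  by rewrite /th; move: (sep d (~` O) A) cs => f1 cs; rcont.
have th01 x : 0 <= th x <= 1.
  rewrite /th le_max lexx ge_max ler01 /=.
  by have := sep_le1 dX (~` O) A x; lra.
have thA x : A x -> th x = 1.
  move=> Ax; rewrite /th sep1//; last first.
    by apply: distset_gt0 => //; [exact: open_closedC|move=> /(_ (AO _ Ax))].
  by rewrite max_r; lra.
have th0 x : ~ O x -> \forall y \near x, th y = 0.
  move=> Ox; have cs : cts_at (sep d (~` O) A) x.
    apply: sep_continuous => //; first exact: open_closedC.
    by apply/seteqP; split=> y // [Oy /AO].
  have : \forall y \near x, sep d (~` O) A y < 2^-1.
    by apply: cts_at_lt => //; rewrite sep0// invr_gt0 ltr0n.
  by apply: filterS => y h; rewrite /th max_l//; lra.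
pose w (i : option (set X)) x := if i is Some i then (1 - th x) * u i x else th x.
pose p (i : option (set X)) x := if i is Some i then pt i else x.
(* The support [sx x] jumps with [x]. Over a fixed list [s] containing the nearby supports the
   family is continuous, and the added atoms have weight 0, so that the measure stays at distance 0
   from [mix x]. *)
pose mixs s x : wpoints d := wfam d (None :: map Some s) (w^~ x) (p^~ x).
pose mix x := mixs (sx x) x.
have mixs_cts s z : cts_at (mixs s) z.
  apply: (wfam_cts dX) => -[i|]; [|exact: thc|exact: cts_at_cst|exact: cvg_id].
  suff ci : continuous (fun x => (1 - th x) * u i x) by exact: ci.
  by have := thc; have := uc i; move: (th) (u i) => f1 f2 c1 c2; rcont.
have mixsE s x : uniq s -> (forall i, i \notin s -> u i x = 0) -> wdist (mixs s x) (mix x) = 0.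
  move=> us hs; apply: wdist_eq0 => phi; rewrite /mix /mixs !ev_wfam !big_cons !big_map.
  congr (_ + _); have [[us' ss' _] _] := sxP x.
  have pm : perm_eq [seq i <- s | 0 < u i x] (sx x).
    apply: uniq_perm; rewrite ?filter_uniq// => i; rewrite mem_filter ss'.
    by case: ltP => //= ui; apply: contraT => /hs e; rewrite e ltxx in ui.
  rewrite -(perm_big _ pm) big_filter [RHS]big_mkcond /=; apply: eq_bigr => i _.
  case: ltP => // ui; rewrite (_ : u i x = 0) ?mulr0 ?normr0 ?mul0r//.
  by apply/eqP; rewrite eq_le ui u0.
have mixU x : O x -> U (mix x).
  move=> /interior_subset [y [Ay Vx hs]]; have [_ _ _ /(_ Ay) [hU _] _] := VfP y.
  apply: hU; rewrite /mix /mixs /wfam /=.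
    move=> q; rewrite inE -map_comp => /orP[/eqP->//|/mapP[i is_ ->]] /=.
    have [_ ix] := inN i x is_; have [iV _] := hs i is_.
    by apply: iV; have [] := ptP i x ix.
  rewrite big_cons !big_map /=; have [[_ ss sum] _] := sxP x.
  have /andP[t0 t1] := th01 x; rewrite ger0_norm//.
  rewrite (eq_bigr (fun i => (1 - th x) * u i x)).
    by rewrite -mulr_sumr sum; ring.
  by move=> i _; rewrite ger0_norm// mulr_ge0// subr_ge0.
have mix_g x : O x -> th x = 0 -> F (mix x) = g x.
  move=> Ox t0; rewrite g_kappa; last by case/interior_subset: Ox => y [_ _ h] i /h[].
  apply: (wdist0_F hK Fc) (mixU _ Ox) _; apply: wdist_eq0 => phi.
  rewrite /kappa /mix /mixs !ev_wfam big_cons big_map /= t0 normr0 mul0r add0r.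
  by apply: eq_bigr => i _; rewrite subr0 mul1r.
exists (fun x => if pselect (O x) then F (mix x) else g x); split; last first.
  move=> x Ax; case: pselect => [Ox|/(_ (AO _ Ax))//]; rewrite -Fdirac//.
  apply: (wdist0_F hK Fc) (mixU _ Ox) _; apply: wdist_eq0 => phi.
  rewrite ev_dirac /mix /mixs ev_wfam big_cons big_map /= thA// normr1 mul1r big1 ?addr0//.
  by move=> i _; rewrite subrr mul0r normr0 mul0r.
move=> z; have [Oz|Oz] := pselect (O z); last first.
  apply: (@cts_at_eq _ _ _ g); last exact: gc.
  apply: filterS (th0 _ Oz) => x t0; case: pselect => // Ox; exact: mix_g.
have [s [us s3 sz hs]] := uloc z.
have Um : U (mixs s z).
  apply: wdist0_open (mixU _ Oz) => //; rewrite wdist_sym mixsE//.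
  by have [] := nbhs_singleton hs.
apply: (@cts_at_eq _ _ _ (fun x => F (mixs s x))); last first.
  by apply: (@cts_at_comp _ _ _ (mixs s) F) => //; exact: Fc.
have nO : nbhs z O by exact: open_nbhs_nbhs.
apply: filterS2 nO hs => x Ox [h _]; case: pselect => // Ox' /=.
by apply: (wdist0_F hK Fc) (mixU _ Ox) _; rewrite wdist_sym mixsE.
Qed.

End Extension.

(** * Monodromy of extendable loops *)

Lemma cts_in_closedU (X K : topologicalType) (A B : set X) (f : X -> K) :
  closed A -> closed B -> (forall x, A x -> cts_in A f x) -> (forall x, B x -> cts_in B f x) ->
  forall x, (A `|` B) x -> cts_in (A `|` B) f x.
Proof.
move=> cA cB fA fB x _; apply: cts_inU.
  have [/fA//|Ax] := pselect (A x) => V _.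
  have : nbhs x (~` A) by apply: open_nbhs_nbhs; split=> //; exact: closed_openC.
  exact: filterS.
have [/fB//|Bx] := pselect (B x) => V _.
have : nbhs x (~` B) by apply: open_nbhs_nbhs; split=> //; exact: closed_openC.
exact: filterS.
Qed.

Section Monodromy.
Variables (R : realType) (X : topologicalType) (d : X -> X -> R).
Hypothesis dX : dist_for d.
Variables (K : topologicalType).
Hypotheses (hK : hausdorff_space K) (cw : cw_structure R K).
Variables (gT : finGroupType) (H : {group gT}).
Variable hol : forall x y : K, curve R x y -> gT.
Hypothesis hol_peq : forall x y (p q : curve R x y), peq p q <-> hol p = hol q.
Hypothesis holM : forall x y z (p : curve R x y) (q : curve R y z),
  hol (pcat p q) = (hol p * hol q)%g.
Hypothesis hol_in : forall x y (p : curve R x y), hol p \in H.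

Let hol_ext x y x' y' (p : curve R x y) (q : curve R x' y') :
  (forall t, 0 <= t <= 1 -> p t = q t) -> hol p = hol q.
Proof.
move=> pq; have ex : x = x' by rewrite -(curve0 p) -(curve0 q) pq// lexx ler01.
have ey : y = y' by rewrite -(curve1 p) -(curve1 q) pq// lexx ler01.
case: _ / ex q pq; case: _ / ey => q pq; apply/hol_peq; exact: peq_ext.
Qed.

Let hol_cst x y (p : curve R x y) : (forall t, 0 <= t <= 1 -> p t = x) -> hol p = 1%g.
Proof.
move=> px; rewrite (@hol_ext _ _ _ _ p (pid R x))//.
have /hol_peq := pcat1p (pid R x); rewrite holM => h.
by apply: (mulgI (hol (pid R x))); rewrite mulg1.
Qed.

Section Loop.
Variables (x0 : K) (l : curve R x0 x0).

Let init_cont (s : R) : continuous (fun t => l (s * t)).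
Proof. by apply: (@cont_comp _ _ _ (fun t => s * t)); [rcont|exact: curve_cont]. Qed.
Let init0 (s : R) : l (s * 0) = x0. Proof. by rewrite mulr0 curve0. Qed.
Let init1 (s : R) : l (s * 1) = l s. Proof. by rewrite mulr1. Qed.
Definition init (s : R) : curve R x0 (l s) := Curve (@init_cont s) (init0 s) (init1 s).

Lemma hol_init0 : hol (init 0) = 1%g.
Proof. by apply: hol_cst => t _ /=; rewrite mul0r curve0. Qed.

Lemma hol_init1 : hol (init 1) = hol l.
Proof. by apply: hol_ext => t _ /=; rewrite mul1r. Qed.

(** The initial part of [l] up to [a 0], followed by the curve, is a reparametrised piece of [l]
    with the same ends as the initial part up to [a 1]. *)
Lemma hol_init x y (p : curve R x y) (a : R -> R) : continuous a ->
  (forall t, 0 <= t <= 1 -> p t = l (a t)) ->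
  hol p = ((hol (init (a 0%R)))^-1 * hol (init (a 1%R)))%g.
Proof.
move=> ca pa.
have ql : continuous (fun t => l (a t)).
  by apply: (@cont_comp _ _ _ a); [exact: ca|exact: curve_cont].
pose q : curve R (l (a 0)) (l (a 1)) := Curve ql erefl erefl.
rewrite (@hol_ext _ _ _ _ p q)//.
suff /hol_peq : peq (pcat (init (a 0)) q) (init (a 1)) by rewrite holM => <-; rewrite mulKg.
apply: (@repar_peq _ _ _ _ _ _ l (fun t => if t <= 2^-1 then a 0 * (2 * t) else a (2 * t - 1))
  (fun t => a 1 * t)).
- exact: curve_cont.
- apply: glue; [by rcont| |exact: cont_id|].
    have c2 : continuous (fun t : R => 2 * t - 1) by rcont.
    by move=> t; apply: continuous_comp; [exact: c2|exact: ca].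
  by move=> t ->; rewrite divff ?pnatr_eq0// mulr1 subrr.
- by rcont.
- by rewrite invr_ge0 ler0n !mulr0.
- by rewrite leNgt invf_lt1 ?ltr0n// ltr1n /= !mulr1; congr a; lra.
- by move=> t t01; rewrite /= /pcat_fun; case: ifP.
- by [].
Qed.

End Loop.

Variables (C : 'I_3 -> set X) (iota : X -> 'I_3).
Hypothesis cC : forall i, closed (C i).
Hypothesis C0 : forall x, ~ forall i, C i x.
Hypothesis Ciota : forall x i, C i x -> C (iota x) x.

Let i0 : 'I_3 := @Ordinal 3 0 isT.
Let i1 : 'I_3 := @Ordinal 3 1 isT.
Let i2 : 'I_3 := @Ordinal 3 2 isT.

Let ord3 (i : 'I_3) : [\/ i = i0, i = i1 | i = i2].
Proof.
by case: i => [[|[|[|]]]]// p; [apply: Or31|apply: Or32|apply: Or33]; exact: val_inj.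
Qed.

Let B : set X := \bigcup_i C i.
Let cB : closed B. Proof. exact: closed_bigcup_ord. Qed.

Let a i x := distset d (C i) x.
Let M x := Num.max (a i0 x) (Num.max (a i1 x) (a i2 x)).
(** Corner weights, largest on [C i] and zero for a farthest set. The factors 1/4 and 1/2 make them
    1-Lipschitz with values in [0, 1], so that their integrals [E i] are continuous on measures. *)
Let e i x := Num.max 0 (M x / 4 - a i x / 2).

Let aM i x : a i x <= M x.
Proof.
by rewrite /M; case: (ord3 i) => ->; rewrite !le_max lexx ?orbT.
Qed.

Let M_lip x y : M x <= M y + d x y.
Proof.
have h i : a i x <= a i y + d x y.
  by have := distset_lip dX (C i) x y; rewrite ler_norml -/(a i x) -/(a i y); lra.
have h' i := le_trans (h i) (lerD (aM i y) (lexx (d x y))).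
by rewrite [M x]/M !ge_max !h'.
Qed.

Let e_lip1 i : lip1 d (e i).
Proof.
split=> [x|].
  rewrite /e le_max lexx ge_max ler01 /=.
  have : M x <= 1 by rewrite /M !ge_max !distset_le1.
  by have := distset_ge0 dX (C i) x; rewrite -/(a i x); lra.
have h x y : e i x <= e i y + d x y.
  have h1 := M_lip x y; have h2 := dist_ge0 dX x y.
  have := distset_lip dX (C i) x y; rewrite ler_norml -/(a i x) -/(a i y) => /andP[h3 h4].
  by rewrite /e; case: (leP 0 (M x / 4 - a i x / 2)); case: (leP 0 (M y / 4 - a i y / 2)); lra.
move=> x y; rewrite [leRHS]ger0_norm ?(dist_ge0 dX)// ler_norml.
by have := h x y; have := h y x; rewrite (dist_sym dX y x); lra.
Qed.

Let e_ge0 i x : 0 <= e i x. Proof. by case: (e_lip1 i) => /(_ x)/andP[]. Qed.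

Let C_e i x : C i x -> 0 < e i x /\ forall j, e j x <= e i x.
Proof.
move=> Cx; have ai : a i x = 0 by exact: distset0.
have M0 : 0 < M x.
  rewrite ltNge; apply/negP => M0; apply: (C0 (x := x)) => j; apply: contrapT => Cj.
  by have := distset_gt0 dX (@cC j) Cj; rewrite -/(a j x); have := aM j x; lra.
have ei : e i x = M x / 4 by rewrite /e ai mul0r subr0 max_r// divr_ge0// ltW.
split; first by rewrite ei divr_gt0.
move=> j; rewrite ei /e ge_max divr_ge0 ?(ltW M0)//=.
by have := distset_ge0 dX (C j) x; rewrite -/(a j x); lra.
Qed.

Let e_zero x : exists i, e i x = 0.
Proof.
have [i hi] : exists i, a i x = M x.
  by rewrite /M; case: leP => _; [case: leP => _|]; by [exists i0|exists i1|exists i2].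
exists i; rewrite /e hi max_l//; have := distset_ge0 dX (C i) x.
by rewrite -/(a i x) hi; lra.
Qed.

Let E i (m : wpoints d) := ev (e i) m.
Let S m := E i0 m + E i1 m + E i2 m.
(** On the edge from 0 to 2 the quotient runs from -1 to 1; the affine map carries its middle third,
    from -1/3 to 1/3, onto [0, 1]. *)
Let theta m := clamp01 (2^-1 + 3 / 2 * ((E i2 m - E i0 m) / S m)).

(** Being a measure of mass 1 carried by [B], expressed by integrals of test functions: in this form
    the condition is closed and passes to measures at distance 0. *)
Let onB (m : wpoints d) := ev (distset d B) m <= 0 /\ ev (fun=> 1) m = 1.

Let E_cts i : continuous (E i).
Proof. exact: (ev_cts (e_lip1 i)). Qed.

Let S_cts : continuous S.
Proof.
by rewrite /S; have c0 := @E_cts i0; have c1 := @E_cts i1; have c2 := @E_cts i2; rcont.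
Qed.

Let theta_cts m : 0 < S m -> cts_at theta m.
Proof.
move=> S0; apply: (@cts_at_comp _ _ _ (fun m => 2^-1 + 3 / 2 * ((E i2 m - E i0 m) / S m)) (@clamp01 R));
  last exact: clamp01_continuous.
apply: (@cvgD R R^o (wpoints d) (nbhs m) _ (cst 2^-1)
  (fun m => 3 / 2 * ((E i2 m - E i0 m) / S m))); first exact: cvg_cst.
apply: cvgM; first exact: cvg_cst.
apply: cvgM; first by apply: cvgB; exact: E_cts.
by apply: cvgV; [rewrite gt_eqF|exact: S_cts].
Qed.

Let E_ge0 i m : 0 <= E i m. Proof. exact: ev_ge0. Qed.

Let onB_S m : onB m -> 0 < S m.
Proof.
move=> [mB m1].
have [p pm p1] : exists2 p, p \in m & 0 < `|p.1|.
  apply: contrapT => hn; have := m1; rewrite /ev big_seq big1.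
    by move/eqP; rewrite eq_sym oner_eq0.
  move=> p pm; apply/eqP; rewrite mulr1 -normr_le0 normr_id.
  by rewrite leNgt; apply/negP => p1; apply: hn; exists p.
have evp f : (forall x, 0 <= f x) -> `|p.1| * f p.2 <= ev f m.
  by move=> f0; rewrite /ev (big_rem p)//= lerDl sumr_ge0// => q _; rewrite mulr_ge0.
have Bp : B p.2.
  apply: contrapT => /(distset_gt0 dX cB) h.
  have := evp _ (distset_ge0 dX B); have := mulr_gt0 p1 h; lra.
have [i _ Ci] := Bp; have [ei _] := C_e Ci.
have := evp _ (e_ge0 i); have := mulr_gt0 p1 ei; rewrite -/(E i m).
have := E_ge0 i0 m; have := E_ge0 i1 m; have := E_ge0 i2 m; rewrite /S.
by case: (ord3 i) => ->; lra.
Qed.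

Let Zb : set (wpoints d) := [set m | onB m /\ 5 * E i1 m <= S m].
Let Zc : set (wpoints d) := [set m | onB m /\
  (S m <= 4 * E i1 m \/ S m <= 3 * `|E i0 m - E i2 m|)].

Let closed_onB : closed onB.
Proof.
have -> : onB = [set m : wpoints d | ev (distset d B) m <= 0] `&`
    ([set m | ev (fun=> 1) m <= 1] `&` [set m | 1 <= ev (fun=> 1) m]).
  apply/seteqP; split=> m; first by move=> [h1 h2]; split=> //; rewrite /= h2.
  by move=> [h1 [h2 h3]]; split=> //; apply/eqP; rewrite eq_le h2.
have c1 : continuous (ev (fun=> 1) : wpoints d -> R) by apply: ev_cts; exact: lip1_1.
apply: closedI; first by apply: closed_le_fun; apply: ev_cts => //; exact: distset_lip1.
by apply: closedI; [exact: closed_le_fun|exact: closed_ge_fun].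
Qed.

Let closed_le2 (f g : wpoints d -> R) : continuous f -> continuous g ->
  closed [set m | f m <= g m].
Proof.
move=> cf cg; have -> : [set m | f m <= g m] = [set m | f m - g m <= 0].
  by apply/seteqP; split=> m /=; rewrite subr_le0.
by apply: closed_le_fun; rcont.
Qed.

Let closed_Zb : closed Zb.
Proof.
apply: closedI; first exact: closed_onB.
apply: closed_le2; last exact: S_cts.
by have := @E_cts i1 => c1; rcont.
Qed.

Let closed_Zc : closed Zc.
Proof.
apply: closedI; first exact: closed_onB.
have c0 := @E_cts i0; have c1 := @E_cts i1; have c2 := @E_cts i2.
apply: closedU; apply: closed_le2; try exact: S_cts; first by rcont.
apply: (@contM _ _ (fun=> 3)); first by rcont.
have c : continuous (fun m => E i0 m - E i2 m) by rcont.
by apply: (@cont_comp _ _ _ (fun m => E i0 m - E i2 m) (fun x : R => `|x|)) => // t; exact: norm_continuous.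
Qed.

(* The triple [E i] of barycentric coordinates (up to scale) sends [B] to the
   boundary of a triangle, which [Psi] maps to [K] by [l] on the middle third of
   the edge between 0 and 2 and by [x0] elsewhere. [Psi] is defined on the
   measures carried by [B] and concentrated enough for their coordinates to lie
   in [Zb] or [Zc]. *)
Variables (x0 : K) (l : curve R x0 x0).

Let Psi m := if 5 * E i1 m <= S m then l (theta m) else x0.

Let theta0 m : 0 < S m -> S m <= 3 * (E i0 m - E i2 m) -> theta m = 0.
Proof.
move=> S0 h; have h' : (E i2 m - E i0 m) / S m <= - 3^-1.
  by rewrite ler_pdivrMr//; lra.
rewrite /theta /clamp01 max_l// ge_min; apply/orP; right; lra.
Qed.

Let theta1 m : 0 < S m -> S m <= 3 * (E i2 m - E i0 m) -> theta m = 1.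
Proof.
move=> S0 h; have h' : 3^-1 <= (E i2 m - E i0 m) / S m.
  by rewrite ler_pdivlMr//; lra.
rewrite /theta /clamp01 min_l; last by lra.
by rewrite max_r.
Qed.

Let Psi_b m : Zb m -> Psi m = l (theta m).
Proof. by move=> [_ h]; rewrite /Psi h. Qed.

Let Psi_c m : Zc m -> Psi m = x0.
Proof.
move=> [mB h]; have S0 := onB_S mB; rewrite /Psi; case: ifP => // h5.
have h1 : S m <= 3 * `|E i0 m - E i2 m| by case: h => //; lra.
have [h2|h2] := leP 0 (E i0 m - E i2 m).
  by rewrite ger0_norm// in h1; rewrite theta0// curve0.
rewrite ltr0_norm// in h1; rewrite theta1 ?curve1//; lra.
Qed.

Let Psi_cts m : (Zb `|` Zc) m -> cts_in (Zb `|` Zc) Psi m.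
Proof.
apply: cts_in_closedU => // {}m Zm.
  apply: (@cts_in_eq _ _ _ _ (fun m => l (theta m))); first exact: Psi_b.
    by apply: filterE => n; exact: Psi_b.
  apply: cts_at_in; apply: (@cts_at_comp _ _ _ theta l); last exact: curve_cont.
  by apply: theta_cts; apply: onB_S; case: Zm.
apply: (@cts_in_eq _ _ _ _ (fun=> x0)); first exact: Psi_c.
  by apply: filterE => n; exact: Psi_c.
by apply: cts_at_in; exact: cts_at_cst.
Qed.

Let Psi_eq m n : wdist m n = 0 -> Psi m = Psi n.
Proof.
move=> mn; have h i : E i m = E i n.
  apply/eqP; rewrite -subr_eq0 -normr_le0 -mn; exact: wdist_ub.
by rewrite /Psi /theta /S !h.
Qed.

Let onB_combo (m : wpoints d) : (forall p, p \in m -> B p.2) ->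
  \sum_(p <- m) `|p.1| = 1 -> onB m.
Proof.
move=> mB m1; split.
  rewrite /ev big_seq big1// => p pm; rewrite distset0 ?mulr0//; exact: mB.
by rewrite /ev -[RHS]m1; apply: eq_bigr => p _; rewrite mulr1.
Qed.

Let onB_dirac x : B x -> onB (dirac d x).
Proof.
move=> Bx; apply: onB_combo; last by rewrite big_seq1 normr1.
by move=> p; rewrite inE => /eqP ->.
Qed.

Let theta_eq m n : wdist m n = 0 -> theta m = theta n.
Proof.
move=> mn; have h i : E i m = E i n.
  apply/eqP; rewrite -subr_eq0 -normr_le0 -mn; exact: wdist_ub.
by rewrite /theta /S !h.
Qed.

Let far z i : ~ C i z -> exists2 V, nbhs z V & forall x, V x -> B x -> iota x != i.
Proof.
move=> Cz; exists (~` C i); first by apply: open_nbhs_nbhs; split=> //; exact: closed_openC.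
by move=> x Cx [j _ /Ciota Cj]; apply/eqP => e'; apply: Cx; rewrite -e'.
Qed.

Let E_dirac i x : E i (dirac d x) = e i x. Proof. exact: ev_dirac. Qed.

(** One of the three coordinates vanishes at every point. If the first one is between 1/5 and 1/4 of
    [S], the vanishing one is at 0 or 2 and the last is at least 3/4 of [S], well outside the middle
    third. The inequalities are strict, hence stable under passage to nearby measures. *)
Let region x : B x -> [\/ 5 * E i1 (dirac d x) < S (dirac d x),
  S (dirac d x) < 4 * E i1 (dirac d x) |
  S (dirac d x) < 3 * `|E i0 (dirac d x) - E i2 (dirac d x)| ].
Proof.
move=> /onB_dirac/onB_S; rewrite /S !E_dirac.
have := e_ge0 i0 x; have := e_ge0 i1 x; have := e_ge0 i2 x; have [i] := e_zero x.
have [?|h5] := ltP (5 * e i1 x) (e i0 x + e i1 x + e i2 x); first by move=> *; apply: Or31.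
have [?|h4] := ltP (e i0 x + e i1 x + e i2 x) (4 * e i1 x); first by move=> *; apply: Or32.
move=> hi h2 h1 h0 hS; apply: Or33; move: hi; case: (ord3 i) => ->; last 2 first.
- by move=> hi; exfalso; lra.
- by move=> hi; rewrite hi subr0 ger0_norm//; lra.
- by move=> hi; rewrite hi sub0r normrN ger0_norm//; lra.
Qed.

Let near_open (P : set (wpoints d)) z : open P -> P (dirac d z) ->
  exists2 V, nbhs z V & forall m : wpoints d, (forall p, p \in m -> V p.2) ->
      \sum_(p <- m) `|p.1| = 1 -> P m.
Proof. by move=> oP Pz; apply: near_dirac => //; exact: open_nbhs_nbhs. Qed.

Let open_lt2 (f g : wpoints d -> R) : continuous f -> continuous g ->
  open [set m | f m < g m].
Proof.
move=> cf cg; rewrite -closedC (_ : ~` _ = [set m | g m <= f m]); first exact: closed_le2.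
by apply/seteqP; split=> m /=; rewrite leNgt => /negP.
Qed.

Let near_b z : 5 * E i1 (dirac d z) < S (dirac d z) ->
  exists2 V, nbhs z V & forall m : wpoints d, (forall p, p \in m -> V p.2) ->
      \sum_(p <- m) `|p.1| = 1 -> 5 * E i1 m < S m.
Proof.
move=> h; apply: (@near_open [set m | 5 * E i1 m < S m]) => //.
by apply: open_lt2 => //; have := @E_cts i1 => c1; rcont.
Qed.

Let near_c z : S (dirac d z) < 4 * E i1 (dirac d z) \/
    S (dirac d z) < 3 * `|E i0 (dirac d z) - E i2 (dirac d z)| ->
  exists2 V, nbhs z V & forall m : wpoints d, (forall p, p \in m -> V p.2) ->
    \sum_(p <- m) `|p.1| = 1 ->
    S m <= 4 * E i1 m \/ S m <= 3 * `|E i0 m - E i2 m|.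
Proof.
move=> h; pose P := [set m | S m < 4 * E i1 m] `|` [set m | S m < 3 * `|E i0 m - E i2 m|].
have oP : open P.
  have c0 := @E_cts i0; have c1 := @E_cts i1; have c2 := @E_cts i2.
  apply: openU; apply: open_lt2 => //; first by rcont.
  apply: (@contM _ _ (fun=> 3)); first by rcont.
  have c : continuous (fun m => E i0 m - E i2 m) by rcont.
  apply: (@cont_comp _ _ _ (fun m => E i0 m - E i2 m) (fun x : R => `|x|)) => // t.
  exact: norm_continuous.
have [//|V nV hV] := @near_open P z oP; exists V => // m mV m1.
by have [/ltW|/ltW] := hV m mV m1; [left|right].
Qed.

(* The extension of [Psi] to [X], and then to the measures near the Dirac ones,
   pulls the universal covering of [K] back to a cocycle on [X]; on [B] its
   holonomy is computed by [Psi]. *)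
Lemma fillable_loop :
  (forall (A : set X) (f : X -> K), closed A -> (forall x, A x -> cts_in A f x) ->
    exists h : X -> K, continuous h /\ forall x, A x -> h x = f x) ->
  cocycle_ext H B (fun x y => jump (hol l) (iota x) (iota y)).
Proof.
move=> ext.
have ZB x : B x -> (Zb `|` Zc) (dirac d x).
  move=> Bx; have oB := onB_dirac Bx; have [h|h|h] := region Bx.
  - by left; split=> //; exact: ltW.
  - by right; split=> //; left; exact: ltW.
  - by right; split=> //; right; exact: ltW.
have dc : continuous (dirac d : X -> wpoints d).
  move=> x V [r r0 hr]; apply/(dist_nbhs dX); exists r => // y xy; apply: hr.
  exact: le_lt_trans (dirac_lip dX _ _) xy.
have [|f [fc fB]] := ext B (fun x => Psi (dirac d x)) cB.
  move=> x Bx V nV.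
  have h : \forall y \near x, (Zb `|` Zc) (dirac d y) -> V (Psi (dirac d y)).
    exact: dc x _ (Psi_cts (ZB x Bx) nV).
  by apply: filterS h => y h By; apply: h; exact: ZB.
have [fd [fdc fdE]] := @diracs_map R X d dX K hK setT f x0 (fun x _ => cts_at_in _ (fc x)).
(* The neighbourhood extension has to restrict to [Psi] on [Zb] and [Zc], where holonomies are
   computed, and to [f] on all Dirac measures, so that [segcoc] is a cocycle on the whole of [X]. *)
pose f0 m := if pselect ((Zb `|` Zc) m) then Psi m else fd m.
have f0d m : diracs setT m -> f0 m = fd m.
  move=> [x _ mx]; rewrite /f0; case: pselect => //= Zm; rewrite (fdE x)//.
  suff Bx : B x by rewrite fB//; exact: Psi_eq.
  apply: contrapT => /(distset_gt0 dX cB).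
  have [mB _] : onB m by case: Zm => -[].
  have := wdist_ub m (dirac d x) (distset_lip1 dX B); rewrite mx ev_dirac normr_le0 subr_eq0.
  by move=> /eqP <-; lra.
have f0P m : (diracs setT `|` (Zb `|` Zc)) m -> cts_in (diracs setT `|` (Zb `|` Zc)) f0 m.
  apply: cts_in_closedU => // [||{}m Dm|{}m Zm].
  - exact: closed_diracs.
  - exact: closedU.
  - apply: (cts_in_eq (f0d m Dm)); last exact: fdc.
    by apply: filterE => n; exact: f0d.
  - have fP n : (Zb `|` Zc) n -> f0 n = Psi n by rewrite /f0; case: pselect.
    apply: (cts_in_eq (fP m Zm)); last exact: Psi_cts.
    by apply: filterE => n; exact: fP.
have cZ : closed (diracs setT `|` (Zb `|` Zc)).
  by apply: closedU; [exact: closed_diracs|exact: closedU].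
have [U [F [oU ZU Fc FE]]] := cw_nbhd_ext cw hK (wdist_dist_for d) cZ f0P.
have FPsi m : (Zb `|` Zc) m -> F m = Psi m.
  by move=> Zm; rewrite FE; [rewrite /f0; case: pselect|right].
have UZ m : (Zb `|` Zc) m -> U m by move=> Zm; apply: ZU; right.
have hol_eq x y (p q : curve R x y) : peq p q -> hol p = hol q by move/hol_peq.
pose c := segcoc hol F.
pose n (i : 'I_3) : gT := if i == i2 then hol l else 1%g.
pose lam s := hol (init l s).
(* Where [Psi] follows [l], the fibre at [x] is compared with the one at [x0] along the initial part
   of [l]; the factor [n] absorbs the jump between the labels 0 and 2. *)
pose b x := (if (5 * E i1 (dirac d x) <= S (dirac d x))%R
  then (n (iota x))^-1 * lam (theta (dirac d x)) else 1)%g.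
have lH : hol l \in H by exact: hol_in.
have nH i : n i \in H by rewrite /n; case: ifP.
exists c, b; split.
- by move=> x y; rewrite /c /segcoc; case: pselect.
- apply: (segcoc_cocycle dX hK hol_eq holM oU Fc) => x _.
  by apply: ZU; left; exact: diracs_dirac.
- by move=> x; rewrite /b; case: ifP => // _; rewrite groupM ?groupV ?nH ?hol_in.
move=> z Bz; have S0 := onB_S (onB_dirac Bz).
have [h5|h5] := ltP (5 * E i1 (dirac d z)) (S (dirac d z)).
  have nC1 : ~ C i1 z.
    move=> /C_e [_ h]; have := h i0; have := h i2; have := e_ge0 i1 z.
    by move: h5 S0; rewrite /S !E_dirac; lra.
  have [V1 nV1 hV1] := near_b h5; have [V2 nV2 hV2] := far nC1.
  exists (V1 `&` V2); first exact: filterI.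
  move=> x y [Vx V2x] [Vy V2y] Bx By.
  have segZ t : 0 <= t <= 1 -> Zb (seg d x y t).
    move=> t01; split.
      by have [h1 h2] := seg_combo d Bx By t01; exact: onB_combo.
    by have [h1 h2] := seg_combo d Vx Vy t01; apply: ltW; exact: hV1.
  have dirZ w : V1 w -> 5 * E i1 (dirac d w) <= S (dirac d w).
    move=> Vw; apply/ltW/hV1; last by rewrite big_seq1 normr1.
    by move=> p; rewrite inE => /eqP ->.
  have [|p hp] := @seg_curve R X d dX K hK U F Fc x y.
    by move=> t t01; apply: UZ; left; exact: segZ.
  have ac : continuous (fun t => theta (seg d x y (clamp01 t))).
    move=> t; apply: (@cts_at_comp _ _ _ (fun t => seg d x y (clamp01 t)) theta).
      by apply: (@cont_comp _ _ _ (@clamp01 R) (seg d x y)); [exact: clamp01_continuous|exact: seg_cts].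
    by apply: theta_cts; apply: onB_S; case: (segZ _ (clamp01_itv t)).
  rewrite /c (segcocE hol_eq hp) (@hol_init x0 l _ _ p _ ac); last first.
    move=> t t01; rewrite hp// FPsi; last by left; exact: segZ.
    by rewrite Psi_b ?clamp01_id//; exact: segZ.
  rewrite -/(lam _) -/(lam _) !clamp01_id ?lexx ?ler01//.
  have -> : theta (seg d x y 0) = theta (dirac d x).
    apply: theta_eq; apply: wdist_eq0 => phi.
    by rewrite ev_seg ev_dirac subr0 normr1 normr0 mul1r mul0r addr0.
  have -> : theta (seg d x y 1) = theta (dirac d y).
    apply: theta_eq; apply: wdist_eq0 => phi.
    by rewrite ev_seg ev_dirac subrr normr1 normr0 mul1r mul0r add0r.
  rewrite /b !dirZ// invMg invgK.
  have -> : jump (hol l) (iota x) (iota y) = ((n (iota x))^-1 * n (iota y))%g.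
    have := hV2 x V2x Bx; have := hV2 y V2y By.
    by rewrite /jump /n; case: (ord3 (iota x)) => ->; case: (ord3 (iota y)) => -> //= _ _;
      rewrite ?invg1 ?mulg1 ?mul1g ?mulVg.
  by rewrite !mulgA mulgK -!mulgA mulKVg.
(* Away from the middle third the gauge is 1: next to the corner 2 the full loop in [lam] cancels
   [n]. Moreover one of the labels 0 and 2 is missing near [z], so [jump] is 1 there too. *)
have trivial_near : exists2 V, nbhs z V & (forall x, V x -> B x -> b x = 1%g) /\
    ((forall x, V x -> B x -> iota x != i0) \/ (forall x, V x -> B x -> iota x != i2)).
  have V1P w (V1 : set X) (P : set (wpoints d)) : (forall m : wpoints d,
      (forall p, p \in m -> V1 p.2) -> \sum_(p <- m) `|p.1| = 1 -> P m) -> V1 w -> P (dirac d w).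
    by move=> h Vw; apply: h; rewrite ?big_seq1 ?normr1// => p; rewrite inE => /eqP ->.
  have [Cz|nC1] := pselect (C i1 z).
    have [V1 nV1 hV1] : exists2 V, nbhs z V & forall m : wpoints d,
        (forall p, p \in m -> V p.2) -> \sum_(p <- m) `|p.1| = 1 -> S m < 5 * E i1 m.
      apply: (@near_open [set m | S m < 5 * E i1 m]).
        by apply: open_lt2 => //; have := @E_cts i1 => c1; rcont.
      have [e1 h] := C_e Cz; have := h i0; have := h i2.
      by rewrite /= /S !E_dirac; lra.
    have b1 x : V1 x -> b x = 1%g.
      by move=> /(V1P _ _ _ hV1) h; rewrite /b leNgt h.
    have [C0z|nC0] := pselect (C i0 z).
      have nC2 : ~ C i2 z.
        by move=> C2z; apply: (C0 (x := z)) => i; case: (ord3 i) => ->.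
      have [V2 nV2 hV2] := far nC2; exists (V1 `&` V2); first exact: filterI.
      split=> [x [/b1//]|]; by right=> x [_]; exact: hV2.
    have [V2 nV2 hV2] := far nC0; exists (V1 `&` V2); first exact: filterI.
    split=> [x [/b1//]|]; by left=> x [_]; exact: hV2.
  have e1 : 0 < e i1 z by move: h5 S0; rewrite !E_dirac; lra.
  have [i _ Ci] := Bz; have [ei hi] := C_e Ci; have [k ek] := e_zero z.
  move: (h5); rewrite /S !E_dirac => h5'.
  have [V2 nV2 hV2] := far nC1.
  case: (ord3 i) Ci ei hi => -> // Ci ei hi.
  - have e2 : e i2 z = 0 by move: ek; case: (ord3 k) => -> //; lra.
    have nC2 : ~ C i2 z by move=> /C_e [+ _]; rewrite e2 ltxx.
    have [V3 nV3 hV3] := far nC2.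
    have [V1 nV1 hV1] : exists2 V, nbhs z V & forall m : wpoints d,
        (forall p, p \in m -> V p.2) -> \sum_(p <- m) `|p.1| = 1 ->
        S m < 3 * (E i0 m - E i2 m).
      apply: (@near_open [set m | S m < 3 * (E i0 m - E i2 m)]).
        by apply: open_lt2 => //; have := @E_cts i0 => c0; have := @E_cts i2 => c2; rcont.
      by rewrite /= /S !E_dirac; have := hi i1; lra.
    exists (V1 `&` (V2 `&` V3)); first by do 2?apply: filterI.
    split; last by right=> x [_ [_]]; exact: hV3.
    move=> x [/(V1P _ _ _ hV1) h [/hV2 h2 /hV3 h3]] Bx; rewrite /b; case: ifP => // _.
    have := h2 Bx; have := h3 Bx; case: (ord3 (iota x)) => ->; rewrite ?eqxx// => _ _.
    by rewrite theta0 ?ltW//; [rewrite /lam hol_init0 /n invg1 mulg1|exact: onB_S (onB_dirac Bx)].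
  - have e0 : e i0 z = 0 by move: ek; case: (ord3 k) => -> //; lra.
    have nC0 : ~ C i0 z by move=> /C_e [+ _]; rewrite e0 ltxx.
    have [V3 nV3 hV3] := far nC0.
    have [V1 nV1 hV1] : exists2 V, nbhs z V & forall m : wpoints d,
        (forall p, p \in m -> V p.2) -> \sum_(p <- m) `|p.1| = 1 ->
        S m < 3 * (E i2 m - E i0 m).
      apply: (@near_open [set m | S m < 3 * (E i2 m - E i0 m)]).
        by apply: open_lt2 => //; have := @E_cts i0 => c0; have := @E_cts i2 => c2; rcont.
      by rewrite /= /S !E_dirac; have := hi i1; lra.
    exists (V1 `&` (V2 `&` V3)); first by do 2?apply: filterI.
    split; last by left=> x [_ [_]]; exact: hV3.
    move=> x [/(V1P _ _ _ hV1) h [/hV2 h2 /hV3 h3]] Bx; rewrite /b; case: ifP => // _.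
    have := h2 Bx; have := h3 Bx; case: (ord3 (iota x)) => ->; rewrite ?eqxx// => _ _.
    by rewrite theta1 ?ltW//; [rewrite /lam hol_init1 /n mulVg|exact: onB_S (onB_dirac Bx)].
have hc : S (dirac d z) < 4 * E i1 (dirac d z) \/
    S (dirac d z) < 3 * `|E i0 (dirac d z) - E i2 (dirac d z)|.
  by have [|h|h] := region Bz; [rewrite ltNge h5|left|right].
have [V1 nV1 hV1] := near_c hc; have [V2 nV2 [hb hj]] := trivial_near.
exists (V1 `&` V2); first exact: filterI.
move=> x y [Vx V2x] [Vy V2y] Bx By.
have segZ t : 0 <= t <= 1 -> Zc (seg d x y t).
  move=> t01; split.
    by have [h1 h2] := seg_combo d Bx By t01; exact: onB_combo.
  by have [h1 h2] := seg_combo d Vx Vy t01; exact: hV1.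
have [|p hp] := @seg_curve R X d dX K hK U F Fc x y.
  by move=> t t01; apply: UZ; right; exact: segZ.
have px0 t : 0 <= t <= 1 -> p t = x0.
  by move=> t01; rewrite hp// FPsi ?Psi_c//; [|right]; exact: segZ.
rewrite /c (segcocE hol_eq hp) (@hol_cst _ _ p); last first.
  by move=> t t01; rewrite px0// -(px0 0) ?curve0// lexx ler01.
rewrite !hb// invg1 mul1g mulg1 /jump; case: hj => hj.
- have hx := hj x V2x Bx; have hy := hj y V2y By.
  by move: hx hy; case: (ord3 (iota x)) => ->; case: (ord3 (iota y)) => ->.
- have hx := hj x V2x Bx; have hy := hj y V2y By.
  by move: hx hy; case: (ord3 (iota x)) => ->; case: (ord3 (iota y)) => ->.
Qed.

End Monodromy.

(** * Extension properties and fillability *)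

Lemma kuratowski_tauP (X K : topologicalType) (k0 : K) : kuratowski_tau X K <->
  forall (A : set X) (f : X -> K), closed A -> (forall x, A x -> cts_in A f x) ->
    exists h : X -> K, continuous h /\ forall x, A x -> h x = f x.
Proof.
split=> h A => [f cA /cts_inP fA|cA f fc].
  have [h' hc he] := h A cA (sigL A f) ((subspace_sigL_continuousP A f).1 fA).
  exists h'; split=> // x Ax.
  have := he (SigSub (mem_set Ax)); rewrite /sigL /=; exact.
pose f' x := if pselect (A x) is left Ax then f (SigSub (mem_set Ax)) else k0.
have f'E a : f' (set_val a) = f a.
  rewrite /f'; case: pselect => [Ax|[]]; last exact: set_valP.
  by congr f; apply: val_inj.
have [|h' [hc he]] := h A f' cA.
  apply/cts_inP; apply/subspace_sigL_continuousP.
  rewrite (_ : sigL A f' = f)//; apply/funext => a; exact: f'E.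
by exists h' => // a; rewrite he ?f'E//; exact: set_valP.
Qed.

Lemma metrizable_dist (R : realType) (X : topologicalType) :
  metrizable R X -> exists d : X -> X -> R, dist_for d.
Proof.
move=> [M [f [g [fg gf cf cg]]]]; exists (fun x y => mdist (f x) (f y)); split.
- by move=> x; exact: mdistxx.
- by move=> x y; exact: metric_sym.
- by move=> x y z; exact: metric_triangle.
- move=> x V; split=> [xV|[e e0 he]].
    have : nbhs (f x) (g @^-1` V) by apply: cg; rewrite fg.
    rewrite -nbhs_ballE => -[e e0 he]; exists e => // y xy.
    by rewrite -(fg y); apply: he; rewrite ballEmdist.
  have : nbhs x (f @^-1` ball (f x) e) by apply: cf; exact: nbhsx_ballx.
  by apply: filterS => y; rewrite /preimage /= ballEmdist => /he.
Qed.

(** After this equivalence the complexes are gone, and the theorem becomes the group theory of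
    fillability. The holonomy, with values in [[subg G]], is moved by [sgval] to [gT], where
    fillability is stated. *)
Lemma kuratowski_tau_fillable (R : realType) (X K : topologicalType) (d : X -> X -> R)
    (gT : finGroupType) (G : {group gT}) :
  dist_for d -> covering_dim_le X 2 -> eilenberg_maclane1 R [subg G] K ->
  kuratowski_tau X K <-> fillable_group X G.
Proof.
move=> dX dimX [[hK [cw]] pc [x0 [isoG _]]].
have [hol0 [hol0_peq hol0M hol0_surj]] := holonomy pc isoG.
pose hol (x y : K) (p : curve R x y) : gT := sgval (hol0 x y p).
have hol_peq x y (p q : curve R x y) : peq p q <-> hol x y p = hol x y q.
  by rewrite hol0_peq; split=> [e|/subg_inj//]; rewrite /hol e.
have holM x y z (p : curve R x y) (q : curve R y z) :
    hol x z (pcat p q) = (hol x y p * hol y z q)%g by rewrite /hol hol0M.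
have hol_in x y (p : curve R x y) : hol x y p \in G by exact: subgP.
have hol_surj x y g : g \in G -> exists p : curve R x y, hol x y p = g.
  move=> gG; have [p hp] := hol0_surj x y (subg G g).
  by exists p; rewrite /hol hp subgK.
rewrite (kuratowski_tauP _ x0); split=> [ext g gG C io cC C0 Cio|fG A f cA fA].
  have [l <-] := hol_surj x0 x0 g gG.
  exact: (fillable_loop dX hK cw hol_peq holM hol_in cC C0 Cio).
exact: (fillable_extension dX hK cw hol_peq holM hol_in hol_surj dimX fG).
Qed.

Theorem theorem4p1 (R : realType) (gT : finGroupType) (G : {group gT})
    (X K L : topologicalType)
    (solG : solvable G)
    (metX : metrizable R X) (dimX : covering_dim_eq X 2)
    (KG : eilenberg_maclane1 R [subg G] K)
    (LGab : eilenberg_maclane1 R [subg (abelianization G)] L) :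
  kuratowski_tau X K <-> kuratowski_tau X L.
Proof.
have [d dX] := metrizable_dist metX; have [dimX2 _] := dimX.
rewrite (kuratowski_tau_fillable dX dimX2 KG) (kuratowski_tau_fillable dX dimX2 LGab).
split; last exact: (fillable_group_abelianization dX dimX2).
exact: fillable_group_quotient (der_norm 1 G).
Qed.
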